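(* Let $m$ be a positive integer and let $h(z)\in\mathbb{C}[z]$ be a polynomial which is not of the form $h_1(z^l)$ for any polynomial $h_1$ and any integer $l>1$. Let $S:L^2_a(D)\to L^2_a(D)$ be a bounded linear operator which commutes with the Toeplitz operator $T_{h(z^m)}$. Then $S$ commutes with $T_{z^m}$, i.e. $[S,T_{z^m}]=0$. In particular, if in addition $S$ is compact, then $S=0$.
   Context: $D=\{z\in\mathbb{C}:|z|<1\}$ is the open unit disk with normalized Lebesgue area measure $dA$ (so $D$ has measure $1$). $L^2_a(D)$ is the Bergman space of square-integrable holomorphic functions on $D$, a closed subspace of $L^2(D)$ with inner product $\langle f,g\rangle=\int_D f\bar g\,dA$; $P$ denotes the orthogonal projection of $L^2(D)$ onto $L^2_a(D)$. For $f\in L^\infty(D)$, the Toeplitz operator $T_f:L^2_a(D)\to L^2_a(D)$ is $T_f(g)=P(fg)$. $[A,B]=AB-BA$. *)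

(* Defs.v *)
From HB Require Import structures.
From mathcomp Require Import all_boot all_order all_algebra.
From mathcomp Require Import all_classical all_reals all_analysis.
From mathcomp Require Import complex.
Set Implicit Arguments.
Unset Strict Implicit.
Unset Printing Implicit Defensive.
Import Order.TTheory GRing.Theory Num.Theory.
Import numFieldNormedType.Exports.
Local Open Scope classical_set_scope.
Local Open Scope ring_scope.

(** The complex plane is [R[i]] for a real type [R]; it is identified with
    [R * R] (Lebesgue product measure) through [cplx]. *)
Definition cplx (R : realType) (p : R * R) : R[i] := Complex p.1 p.2.

Definition disk (R : realType) : set R[i] :=
  [set z | (complex.Re z) ^+ 2 + (complex.Im z) ^+ 2 < 1].
Definition diskR2 (R : realType) : set (R * R) := (@cplx R) @^-1` (@disk R).

Definition leb2 (R : realType) :=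
  ((@lebesgue_measure R) \x (@lebesgue_measure R))%E.

(** Normalized area measure dA = dx dy / pi on the disk; integrals of
    real functions over the disk. *)
Definition intD (R : realType) (f : R * R -> R) : R :=
  pi^-1 * (\int[@leb2 R]_(p in @diskR2 R) f p).

Definition sqmod (R : realType) (z : R[i]) : R := (complex.Re z) ^+ 2 + (complex.Im z) ^+ 2.

(** L^2(D, dA): (equivalence classes of) measurable complex functions on D
    with square-integrable modulus. Functions are given on all of C; only
    their values on D matter. *)
Definition L2D (R : realType) : set (R[i] -> R[i]) :=
  [set u | measurable_fun (@diskR2 R) (fun p => complex.Re (u (cplx p))) /\
           measurable_fun (@diskR2 R) (fun p => complex.Im (u (cplx p))) /\
           (@leb2 R).-integrable (@diskR2 R)
              (fun p => (sqmod (u (cplx p)))%:E)].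

Definition ipD (R : realType) (u v : R[i] -> R[i]) : R[i] :=
  Complex (intD (fun p => complex.Re (u (cplx p) * conjc (v (cplx p)))))
          (intD (fun p => complex.Im (u (cplx p) * conjc (v (cplx p))))).

Definition normD (R : realType) (u : R[i] -> R[i]) : R :=
  Num.sqrt (intD (fun p => sqmod (u (cplx p)))).

Definition holomorphic_on_disk (R : realType) (f : R[i] -> R[i]) : Prop :=
  forall z, z \in @disk R -> derivable (f : (R[i])^o -> (R[i])^o) z 1.

Definition bergman (R : realType) : set (R[i] -> R[i]) :=
  [set f | holomorphic_on_disk f /\ f \in @L2D R].

Definition bergman_proj (R : realType) (u : R[i] -> R[i]) : R[i] -> R[i] :=
  xget (fun _ => 0) [set g | g \in @bergman R /\
       forall k, k \in @bergman R -> ipD (u \- g) k = 0].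

(** Toeplitz operator T_f g = P (f g) (used here only for polynomial,
    hence bounded, symbols f). *)
Definition toeplitz (R : realType) (f g : R[i] -> R[i]) : R[i] -> R[i] :=
  bergman_proj (f \* g).

Definition eqD (R : realType) (f g : R[i] -> R[i]) : Prop :=
  forall z, z \in @disk R -> f z = g z.

Definition bounded_linear_op (R : realType)
    (S : (R[i] -> R[i]) -> (R[i] -> R[i])) : Prop :=
  (forall f, f \in @bergman R -> S f \in @bergman R) /\
  (forall (a : R[i]) f g, f \in @bergman R -> g \in @bergman R ->
      eqD (S (a \*: f \+ g)) (a \*: S f \+ S g)) /\
  (exists M : R, forall f, f \in @bergman R -> normD (S f) <= M * normD f).

Definition commute_op (R : realType)
    (A B : (R[i] -> R[i]) -> (R[i] -> R[i])) : Prop :=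
  forall f, f \in @bergman R -> eqD (A (B f)) (B (A f)).

(** Compact operator: the image of every bounded sequence has a norm-Cauchy
    subsequence (equivalently, the image of the unit ball is relatively
    compact, L^2_a(D) being complete). *)
Definition compact_op (R : realType)
    (S : (R[i] -> R[i]) -> (R[i] -> R[i])) : Prop :=
  forall u : nat -> (R[i] -> R[i]),
    (forall n, u n \in @bergman R) -> (forall n, normD (u n) <= 1) ->
    exists phi : nat -> nat, (forall n, (phi n < phi n.+1)%N) /\
      forall e : R, 0 < e -> exists N, forall n k, (N <= n)%N -> (N <= k)%N ->
        normD (S (u (phi n)) \- S (u (phi k))) < e.

(* Main.v *)
Require Import Defs.
From HB Require Import structures.
From mathcomp Require Import all_boot all_order all_algebra.
From mathcomp Require Import all_classical all_reals all_analysis.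
From mathcomp Require Import complex.
From mathcomp Require Import measurable_realfun ring lra.
Import Order.TTheory GRing.Theory Num.Theory.
Import numFieldNormedType.Exports.
Local Open Scope classical_set_scope.
Local Open Scope ring_scope.

(** If [(h(z^m) - h(w^m)) = (z^m - w^m) r(z)] with [r] bounded below on the disc, every [f] in the
    Bergman space satisfies [(z^m - w^m) f = (h(z^m) - h(w^m)) (f / r)], so applying [S] and
    evaluating at [w] gives [S (z^m f) w = w^m S f w]. It suffices to find an open set of such [w],
    by the identity theorem; and for that, a point [w] of the unit circle such that [h] takes
    the value [h w] on the closed disc only at [w], and simply.

    Were there none, maximising [Re (conj a * h)] over the closed disc for infinitely many
    directions [a] would yield infinitely many pairs [z <> w] on the unit circle with
    [h z = h w]. Put [t = z / w]. By elimination the two equations [h (t w) = h w] and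
    [conj h (1 / (t w)) = conj h (1 / w)] have common solutions either for finitely many [t], whence
    [h (t w) = h w] identically for some [t <> 1] and [h] is a polynomial in [w^l]; or for
    arbitrarily large [t], which is absurd since then [t w] and [1 / w] are both bounded.

    If [S] is compact and [S z^j = z^s G] with [G 0 <> 0], then [S] maps the normalised monomials
    [z^(m n + j) / |z^(m n + j)|] to a sequence whose differences are bounded below, because
    [|z^p H|^2 >= |H 0|^2 |z^p|^2] and the ratios [|z^(p + 1)| / |z^p|] are bounded below. Hence [S]
    kills monomials, and [S f = S (z^(m K) f_K) = z^(m K) S f_K] vanishes to every order at [0]. *)

Set Implicit Arguments.
Unset Strict Implicit.
Unset Printing Implicit Defensive.
Import Normc.

(** The search for [w] takes place on the unit circle because a maximum of [Re (conj a * h)] over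
    the closed disc is attained only there, at points where [h'] does not vanish. A further point of
    the disc with the same value is again a maximiser, hence also on the circle, and on the circle
    [conj w = 1 / w] supplies the second equation of the elimination. Distinct directions give
    distinct maximisers because [Im (conj a * w * h' w) = 0] recovers the real line through [a].
    Univalence and simplicity are expressed together by the divided difference of [h] having no zero
    in the closed disc, a condition that persists for nearby [w], in particular for an open set of
    points inside the disc. The function theory rests on a bisection argument on real rectangles:
    the circle is contracted to a point along segments, so that the parameters range over a
    rectangle. The lower bound for [|z^p H|] comes from averaging over rotations, which are products
    of shears, in place of polar coordinates. Operators act on functions given on all of C, so their
    identities hold up to [eqD]. *)

Section Modulus.
Context {R : realType}.
Implicit Types z w : R[i].

Lemma normc_ge0 z : 0 <= normc z.
Proof. by case: z => a b; rewrite /normc sqrtr_ge0. Qed.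

Lemma sqmodE z : sqmod z = normc z ^+ 2.
Proof. by case: z => a b; rewrite /sqmod /normc /= sqr_sqrtr// addr_ge0// sqr_ge0. Qed.

Lemma normc_gt0 z : (0 < normc z) = (z != 0).
Proof.
rewrite lt_def normc_ge0 andbT; congr negb; apply/eqP/eqP => [|->]; last exact: normc0.
exact: eq0_normc.
Qed.

Lemma normcB z w : normc (z - w) <= normc z + normc w.
Proof. by rewrite -(normcN w); exact: le_normcD. Qed.

Lemma normc_distC z w : normc (z - w) = normc (w - z).
Proof. by rewrite -normcN opprB. Qed.

Lemma normc_le_subD z w : normc z - normc w <= normc (z - w).
Proof. by rewrite lerBlDr -{1}(subrK w z); exact: le_normcD. Qed.

Lemma normcX z n : normc (z ^+ n) = normc z ^+ n.
Proof. by elim: n => [|n IH]; rewrite ?expr0 ?normc1// !exprS normcM IH. Qed.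

Lemma normcR (r : R) : normc r%:C%C = `|r|.
Proof. by rewrite /normc /= expr0n/= addr0 sqrtr_sqr. Qed.

Lemma Re_le_normc z : `|complex.Re z| <= normc z.
Proof.
case: z => a b; rewrite /normc /= -sqrtr_sqr ler_wsqrtr// lerDl sqr_ge0//.
Qed.

Lemma Im_le_normc z : `|complex.Im z| <= normc z.
Proof.
case: z => a b; rewrite /normc /= -sqrtr_sqr ler_wsqrtr// lerDr sqr_ge0//.
Qed.

Lemma normc_le_ReIm z : normc z <= `|complex.Re z| + `|complex.Im z|.
Proof.
case: z => a b; rewrite /normc /=.
rewrite -[leRHS]ger0_norm ?addr_ge0// -sqrtr_sqr ler_wsqrtr//.
rewrite sqrrD !real_normK ?num_real// addrAC lerDl mulrn_wge0// mulr_ge0//.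
Qed.

Lemma normc_sum (I : Type) (r : seq I) (F : I -> R[i]) :
  normc (\sum_(i <- r) F i) <= \sum_(i <- r) normc (F i).
Proof.
elim: r => [|i r IH]; rewrite ?big_nil ?normc0// !big_cons.
by rewrite (le_trans (le_normcD _ _))// lerD2l.
Qed.

Lemma normcE z : `|z| = (normc z)%:C%C.
Proof. by []. Qed.

Lemma diskE z : (z \in @disk R) = (normc z < 1).
Proof.
apply/idP/idP; rewrite inE /disk /= -/(sqmod z) sqmodE.
  by rewrite expr_lt1// normc_ge0.
by move=> h; rewrite expr_lt1// normc_ge0.
Qed.

Lemma eqc_le0 z : (forall e : R, 0 < e -> normc z <= e) -> z = 0.
Proof.
move=> h; apply: eq0_normc; apply/eqP; rewrite eq_le normc_ge0 andbT.
by apply/ler_addgt0Pl => e e0; rewrite addr0 h.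
Qed.

End Modulus.

(** * Complex differentiability by explicit estimates *)

Section ComplexDifferentiability.
Context {R : realType}.
Local Notation C := R[i].
Implicit Types (f g : C -> C) (z w d : C).

(** Division-free form of [f' z = d] with real tolerances; it includes [w = z] and composes directly
    with maps of two real variables. *)
Definition cdiff f z d := forall e : R, 0 < e ->
  exists2 del : R, 0 < del & forall w, normc (w - z) < del ->
    normc (f w - f z - d * (w - z)) <= e * normc (w - z).

Lemma derivable_cdiff f z :
  derivable (f : C^o -> C^o) z 1 <-> exists d, cdiff f z d.
Proof.
split.
  move=> /cvg_ex[/= d /cvgrPdist_le /= H]; exists d => e e0.
  have /H : 0 < e%:C%C by rewrite ltcR.
  case/nbhs_ballP => del /= del0 Hd.
  (* The order on [R[i]] is partial: a positive element is a positive real, so complex radii reduce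
     to real ones. *)
  have [r0 rE] : 0 < complex.Re del /\ del = (complex.Re del)%:C%C.
    by case: del del0 {Hd} => a b; rewrite ltcE /= => /andP[/eqP -> ->].
  exists (complex.Re del) => // w wz.
  have [->|wnz] := eqVneq w z; first by rewrite !subrr mulr0 subr0 normc0 mulr0.
  have wz0 : w - z != 0 by rewrite subr_eq0.
  have := Hd (w - z).
  rewrite /ball /= /ball_ sub0r normrN normcE rE ltcR => /(_ wz wz0).
  rewrite /GRing.scale /= mulr1 subrK normcE lecR => h.
  have -> : f w - f z - d * (w - z) = - (d - (w - z)^-1 * (f w - f z)) * (w - z).
    rewrite opprB mulrBl mulrAC mulVf// mul1r//.
  by rewrite normcM normcN ler_wpM2r// normc_ge0.
case=> d Hd; apply/cvg_ex; exists d; apply/cvgrPdist_le => /= e.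
rewrite ltcE /= => /andP[/eqP e1 e0]; have eE : e = (complex.Re e)%:C%C.
  by case: e e1 {e0} => a b /= ->.
have [del del0 H] := Hd _ e0.
have del0C : 0 < del%:C%C :> C by rewrite ltcR.
apply/nbhs_ballP; exists del%:C%C => //= w.
rewrite /ball /= /ball_ sub0r normrN normcE ltcR => wd w0.
have := H (w + z); rewrite addrK => /(_ wd) h.
rewrite eE normcE lecR /GRing.scale /= mulr1.
rewrite -(@ler_pM2r _ (normc w)) ?normc_gt0//.
apply: le_trans h; rewrite -normcM -normcN mulrBl opprB mulrAC mulVf// mul1r//.
Qed.

Lemma cdiff_cont f z d : cdiff f z d -> forall e : R, 0 < e ->
  exists2 del : R, 0 < del & forall w, normc (w - z) < del -> normc (f w - f z) <= e.
Proof.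
move=> /(_ 1 ltr01)[del del0 H] e e0.
have K0 : 0 < 1 + normc d by rewrite ltr_pwDl// normc_ge0.
exists (Num.min del (e / (1 + normc d))).
  by rewrite lt_min del0 divr_gt0.
move=> w; rewrite lt_min => /andP[/H h1 h2].
rewrite -(subrK (d * (w - z)) (f w - f z)).
apply: (le_trans (le_normcD _ _)); rewrite normcM.
apply: (@le_trans _ _ ((1 + normc d) * normc (w - z))); first by rewrite mulrDl lerD2r.
by move: h2; rewrite ltr_pdivlMr// mulrC => /ltW.
Qed.

End ComplexDifferentiability.

(** * Goursat's lemma on rectangles *)

Section SegmentIntegral.
Context {R : realType}.
Implicit Types (f g : R -> R) (a b c x : R).

Definition cont1 f x := forall e : R, 0 < e ->
  exists2 del : R, 0 < del & forall y, `|y - x| < del -> `|f y - f x| <= e.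

Definition cont_on a b f := forall x, a <= x <= b -> cont1 f x.

Definition segint a b f : R := \int[@lebesgue_measure R]_(x in `[a, b]) f x.

Lemma cont1_continuous f x : cont1 f x -> {for x, continuous f}.
Proof.
move=> cf; apply/cvgrPdist_le => /= e e0.
have [del del0 H] := cf _ e0.
apply/nbhs_ballP; exists del => //= y.
by rewrite /ball /= distrC => /H; rewrite distrC.
Qed.

Lemma cont_on_integrable a b f : cont_on a b f ->
  (@lebesgue_measure R).-integrable `[a, b] (EFin \o f).
Proof.
move=> cf; apply: continuous_compact_integrable; first exact: segment_compact.
apply: continuous_in_subspaceT => x; rewrite inE /= in_itv /= => xab.
exact/cont1_continuous/cf.
Qed.

Lemma cont_onS a b a' b' f : a <= a' -> b' <= b -> cont_on a b f -> cont_on a' b' f.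
Proof.
by move=> h1 h2 cf x /andP[h3 h4]; apply: cf; rewrite (le_trans h1)//= (le_trans h4).
Qed.

Lemma cont1_cst (r : R) x : cont1 (fun=> r) x.
Proof. by move=> e e0; exists 1 => // y _; rewrite subrr normr0 ltW. Qed.

Lemma cont1D f g x : cont1 f x -> cont1 g x -> cont1 (fun s => f s + g s) x.
Proof.
move=> cf cg e e0; have e2 : 0 < e / 2 by rewrite divr_gt0.
have [d1 d10 H1] := cf _ e2; have [d2 d20 H2] := cg _ e2.
exists (Num.min d1 d2); first by rewrite lt_min d10.
move=> y; rewrite lt_min => /andP[/H1 h1 /H2 h2].
rewrite opprD addrACA (le_trans (ler_normD _ _))//; lra.
Qed.

Lemma cont1N f x : cont1 f x -> cont1 (fun s => - f s) x.
Proof.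
move=> cf e e0; have [d d0 H] := cf _ e0; exists d => // y /H.
by rewrite -opprD normrN.
Qed.

Lemma cont1B f g x : cont1 f x -> cont1 g x -> cont1 (fun s => f s - g s) x.
Proof. by move=> cf cg; apply: cont1D => //; exact: cont1N. Qed.

Lemma segintD a b f g : cont_on a b f -> cont_on a b g ->
  segint a b (fun x => f x + g x) = segint a b f + segint a b g.
Proof. by move=> cf cg; rewrite /segint RintegralD//; exact: cont_on_integrable. Qed.

Lemma segintB a b f g : cont_on a b f -> cont_on a b g ->
  segint a b (fun x => f x - g x) = segint a b f - segint a b g.
Proof. by move=> cf cg; rewrite /segint RintegralB//; exact: cont_on_integrable. Qed.

Lemma segintZ a b r f : cont_on a b f ->
  segint a b (fun x => r * f x) = r * segint a b f.
Proof. by move=> cf; rewrite /segint RintegralZl//; exact: cont_on_integrable. Qed.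

Lemma segint_cst a b r : a <= b -> segint a b (fun=> r) = r * (b - a).
Proof.
move=> ab; rewrite /segint Rintegral_cst//= lebesgue_measure_itv /= lte_fin.
case: ltP => // ba; have -> : a = b by apply/eqP; rewrite eq_le ab.
by rewrite subrr.
Qed.

Lemma eq_segint a b f g : (forall x, a <= x <= b -> f x = g x) ->
  segint a b f = segint a b g.
Proof.
by move=> h; apply: eq_Rintegral => x; rewrite inE /= in_itv /=; exact: h.
Qed.

Lemma segint_bound a b f m M : a <= b -> cont_on a b f ->
  (forall x, a <= x <= b -> `|f x - m| <= M) ->
  `|segint a b f - m * (b - a)| <= M * (b - a).
Proof.
move=> ab cf h; rewrite -segint_cst// -segintB//; last by move=> ? _; exact: cont1_cst.
have ci r : cont_on a b (fun=> r) by move=> ? _; exact: cont1_cst.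
have cB : cont_on a b (fun x => f x - m).
  by move=> x xab; apply: cont1B; [exact: cf|exact: cont1_cst].
rewrite ler_norml; apply/andP; split.
  rewrite -mulNr -segint_cst//; apply: le_Rintegral => //; first exact: cont_on_integrable.
    exact: cont_on_integrable.
  by move=> x; rewrite /= in_itv /= => /h; rewrite ler_norml => /andP[].
rewrite -segint_cst//; apply: le_Rintegral => //; [exact: cont_on_integrable|exact: cont_on_integrable|].
by move=> x; rewrite /= in_itv /= => /h; rewrite ler_norml => /andP[].
Qed.

Lemma segint_split a c b f : a <= c -> c <= b -> cont_on a b f ->
  segint a b f = segint a c f + segint c b f.
Proof.
move=> ac cb cf; rewrite /segint.
have := @Rintegral_itvB R f (BLeft a) (BRight b) c (cont_on_integrable cf).
rewrite !bnd_simp => /(_ ac cb) h.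
rewrite -(@Rintegral_itv_obnd_cbnd R c (BRight b)); last first.
  apply: integrableS (cont_on_integrable (cont_onS ac (lexx b) cf)) => //.
  exact: subset_itv_oc_cc.
by rewrite -h addrC subrK.
Qed.

End SegmentIntegral.

Section Goursat.
Context {R : realType}.
Implicit Types (F P Q : R -> R -> R).

Definition diff2 F x y (a b : R) := forall e : R, 0 < e ->
  exists2 del : R, 0 < del & forall x' y', `|x' - x| < del -> `|y' - y| < del ->
    `|F x' y' - F x y - a * (x' - x) - b * (y' - y)| <= e * (`|x' - x| + `|y' - y|).

Lemma diff2_cont F x y a b : diff2 F x y a b ->
  forall e : R, 0 < e -> exists2 del : R, 0 < del & forall x' y',
  `|x' - x| < del -> `|y' - y| < del -> `|F x' y' - F x y| <= e.
Proof.
move=> /(_ 1 ltr01)[del del0 H] e e0.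
have K0 : 0 < 2 + `|a| + `|b| by rewrite -addrA ltr_pwDl// addr_ge0.
exists (Num.min del (e / (2 + `|a| + `|b|))); first by rewrite lt_min del0 divr_gt0.
move=> x' y'; rewrite !lt_min => /andP[hx hx'] /andP[hy hy'].
have := H _ _ hx hy; rewrite mul1r => h.
have -> : F x' y' - F x y = (F x' y' - F x y - a * (x' - x) - b * (y' - y)) +
  (a * (x' - x) + b * (y' - y)) by ring.
apply: (le_trans (ler_normD _ _)).
have h2 := ler_normD (a * (x' - x)) (b * (y' - y)); rewrite !normrM in h2.
have k1 := ler_wpM2l (normr_ge0 a) (ltW hx').
have k2 := ler_wpM2l (normr_ge0 b) (ltW hy').
have : (2 + `|a| + `|b|) * (e / (2 + `|a| + `|b|)) = e by rewrite mulrC divfK// gt_eqF.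
lra.
Qed.

Lemma diff2_cont1l F x y a b : diff2 F x y a b -> cont1 (fun s => F s y) x.
Proof.
move=> /diff2_cont H e /H[del del0 h]; exists del => // x' hx.
by apply: h => //; rewrite subrr normr0.
Qed.

Lemma diff2_cont1r F x y a b : diff2 F x y a b -> cont1 (fun t => F x t) y.
Proof.
move=> /diff2_cont H e /H[del del0 h]; exists del => // x' hx.
by apply: h => //; rewrite subrr normr0.
Qed.

(** The shared [b] is both the derivative of [P] in the second variable and that of [Q] in the
    first. The form [P dx + Q dy] is closed pointwise, with no continuity of the derivatives. *)
Definition closed_form_at P Q x y := exists a b c, diff2 P x y a b /\ diff2 Q x y b c.

Definition closed_form_on P Q x y l k := forall s t, x <= s <= x + l -> y <= t <= y + k ->
  closed_form_at P Q s t.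

(* Boundary integral of [P dx + Q dy] over a rectangle with corner [(x, y)],
   opposite sides being paired inside one integral. *)
Definition rectint P Q x y l k : R :=
  segint x (x + l) (fun s => P s y - P s (y + k)) +
  segint y (y + k) (fun t => Q (x + l) t - Q x t).

Section Rect.
Variables P Q : R -> R -> R.

Lemma closed_formP_cont x y l k t : closed_form_on P Q x y l k -> y <= t <= y + k ->
  cont_on x (x + l) (fun s => P s t).
Proof. by move=> H ht s hs; have [a [b [c [/diff2_cont1l]]]] := H _ _ hs ht. Qed.

Lemma closed_formQ_cont x y l k s : closed_form_on P Q x y l k -> x <= s <= x + l ->
  cont_on y (y + k) (fun t => Q s t).
Proof. by move=> H hs t ht; have [a [b [c [_ /diff2_cont1r]]]] := H _ _ hs ht. Qed.

Lemma closed_formS x y l k x' y' l' k' : x <= x' -> x' + l' <= x + l -> y <= y' ->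
  y' + k' <= y + k -> closed_form_on P Q x y l k -> closed_form_on P Q x' y' l' k'.
Proof.
move=> h1 h2 h3 h4 H s t /andP[s1 s2] /andP[t1 t2].
by apply: H; rewrite ?(le_trans h1 s1) ?(le_trans h3 t1) ?(le_trans s2 h2) ?(le_trans t2 h4).
Qed.

Lemma rectint_cutx x y l l' k : 0 <= l -> 0 <= l' -> 0 <= k ->
  closed_form_on P Q x y (l + l') k ->
  rectint P Q x y (l + l') k = rectint P Q x y l k + rectint P Q (x + l) y l' k.
Proof.
move=> l0 l'0 k0 H; rewrite /rectint addrA.
have cP : cont_on x (x + l + l') (fun s => P s y - P s (y + k)).
  move=> s hs; apply: cont1B; [apply: (closed_formP_cont H)|apply: (closed_formP_cont H)].
  - by rewrite lexx lerDl.
  - by rewrite addrA.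
  - by rewrite lexx lerDl k0.
  - by rewrite addrA.
rewrite (@segint_split _ x (x + l)) ?lerDl// addrACA; congr (_ + _).
have cQ s : x <= s <= x + (l + l') -> cont_on y (y + k) (Q s).
  by move=> hs; exact: (closed_formQ_cont H).
have cB s s' : x <= s <= x + (l + l') -> x <= s' <= x + (l + l') ->
    cont_on y (y + k) (fun t => Q s t - Q s' t).
  by move=> h1 h2 t ht; apply: cont1B; apply: cQ.
rewrite -segintD; first by apply: eq_segint => t _; ring.
all: apply: cB; lra.
Qed.

Lemma rectint_cuty x y l k k' : 0 <= l -> 0 <= k -> 0 <= k' ->
  closed_form_on P Q x y l (k + k') ->
  rectint P Q x y l (k + k') = rectint P Q x y l k + rectint P Q x (y + k) l k'.
Proof.
move=> l0 k0 k'0 H; rewrite /rectint addrA.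
have cQ : cont_on y (y + k + k') (fun t => Q (x + l) t - Q x t).
  move=> t ht; apply: cont1B; apply: (closed_formQ_cont H); lra.
rewrite (@segint_split _ y (y + k)) ?lerDl// addrACA; congr (_ + _).
have cP t : y <= t <= y + (k + k') -> cont_on x (x + l) (fun s => P s t).
  by move=> ht; exact: (closed_formP_cont H).
have cB t t' : y <= t <= y + (k + k') -> y <= t' <= y + (k + k') ->
    cont_on x (x + l) (fun s => P s t - P s t').
  by move=> h1 h2 s hs; apply: cont1B; apply: cP.
rewrite -segintD; first by apply: eq_segint => t _; ring.
all: apply: cB; lra.
Qed.

Lemma rectint_quarter x y l k c : 0 <= l -> 0 <= k ->
  closed_form_on P Q x y (l + l) (k + k) -> 4 * c <= `|rectint P Q x y (l + l) (k + k)| ->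
  exists x' y', [/\ x' = x \/ x' = x + l, y' = y \/ y' = y + k
                 & c <= `|rectint P Q x' y' l k|].
Proof.
move=> l0 k0 H hc; apply: contrapT => /forallNP N.
have n x' y' : x' = x \/ x' = x + l -> y' = y \/ y' = y + k -> `|rectint P Q x' y' l k| < c.
  by move=> hx hy; rewrite ltNge; apply/negP => hh; apply: (N x'); exists y'.
have n1 := n _ _ (or_introl erefl) (or_introl erefl).
have n2 := n _ _ (or_introl erefl) (or_intror erefl).
have n3 := n _ _ (or_intror erefl) (or_introl erefl).
have n4 := n _ _ (or_intror erefl) (or_intror erefl).
move: hc; rewrite rectint_cutx ?addr_ge0// !rectint_cuty//.
- have e1 := ler_normD (rectint P Q x y l k + rectint P Q x (y + k) l k)
    (rectint P Q (x + l) y l k + rectint P Q (x + l) (y + k) l k).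
  have e2 := ler_normD (rectint P Q x y l k) (rectint P Q x (y + k) l k).
  have e3 := ler_normD (rectint P Q (x + l) y l k) (rectint P Q (x + l) (y + k) l k).
  lra.
- by apply: (closed_formS _ _ _ _ H); lra.
- by apply: (closed_formS _ _ _ _ H); lra.
Qed.

(** The affine parts of [P] and [Q] contribute [- b * k * l] and [b * l * k], which cancel because
    the cross derivatives agree. On each side there remains an error of at most [e * (l + k)] times
    its length. *)
Lemma rectint_small x y l k xs ys e del a b c :
  0 <= l -> 0 <= k -> closed_form_on P Q x y l k ->
  x <= xs <= x + l -> y <= ys <= y + k -> 0 < e -> l + k < del ->
  (forall x' y', `|x' - xs| < del -> `|y' - ys| < del ->
    `|P x' y' - P xs ys - a * (x' - xs) - b * (y' - ys)| <= e * (`|x' - xs| + `|y' - ys|)) ->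
  (forall x' y', `|x' - xs| < del -> `|y' - ys| < del ->
    `|Q x' y' - Q xs ys - b * (x' - xs) - c * (y' - ys)| <= e * (`|x' - xs| + `|y' - ys|)) ->
  `|rectint P Q x y l k| <= 2 * e * (l + k) ^+ 2.
Proof.
move=> l0 k0 H hxs hys e0 hd hP hQ.
have dx s : x <= s <= x + l -> `|s - xs| <= l by move=> hs; rewrite ler_norml; lra.
have dy t : y <= t <= y + k -> `|t - ys| <= k by move=> ht; rewrite ler_norml; lra.
have bP s t : x <= s <= x + l -> y <= t <= y + k ->
    `|P s t - P xs ys - a * (s - xs) - b * (t - ys)| <= e * (l + k).
  move=> /dx hs /dy ht; apply: le_trans (hP _ _ _ _) _; [lra|lra|].
  by rewrite ler_pM2l// lerD.
have bQ s t : x <= s <= x + l -> y <= t <= y + k ->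
    `|Q s t - Q xs ys - b * (s - xs) - c * (t - ys)| <= e * (l + k).
  move=> /dx hs /dy ht; apply: le_trans (hQ _ _ _ _) _; [lra|lra|].
  by rewrite ler_pM2l// lerD.
have y1 : y <= y <= y + k by lra.
have y2 : y <= y + k <= y + k by lra.
have x1 : x <= x <= x + l by lra.
have x2 : x <= x + l <= x + l by lra.
have I1 : `|segint x (x + l) (fun s => P s y - P s (y + k)) - (- (b * k)) * (x + l - x)| <=
    2 * (e * (l + k)) * (x + l - x).
  apply: segint_bound; first lra.
    by move=> s hs; apply: cont1B; apply: (closed_formP_cont H).
  move=> s hs; have h1 := bP _ _ hs y1; have h2 := bP _ _ hs y2.
  have -> : P s y - P s (y + k) - - (b * k) =
    (P s y - P xs ys - a * (s - xs) - b * (y - ys)) -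
    (P s (y + k) - P xs ys - a * (s - xs) - b * (y + k - ys)) by ring.
  by apply: le_trans (ler_normB _ _) _; lra.
have I2 : `|segint y (y + k) (fun t => Q (x + l) t - Q x t) - (b * l) * (y + k - y)| <=
    2 * (e * (l + k)) * (y + k - y).
  apply: segint_bound; first lra.
    by move=> s hs; apply: cont1B; apply: (closed_formQ_cont H).
  move=> t ht; have h1 := bQ _ _ x1 ht; have h2 := bQ _ _ x2 ht.
  have -> : Q (x + l) t - Q x t - b * l =
    (Q (x + l) t - Q xs ys - b * (x + l - xs) - c * (t - ys)) -
    (Q x t - Q xs ys - b * (x - xs) - c * (t - ys)) by ring.
  by apply: le_trans (ler_normB _ _) _; lra.
rewrite /rectint.
move: I1 I2; set A := segint _ _ _; set B := segint _ _ _.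
have -> : x + l - x = l by ring.
have -> : y + k - y = k by ring.
move=> I1 I2.
have -> : A + B = (A - - (b * k) * l) + (B - b * l * k) by ring.
apply: le_trans (ler_normD _ _) _; apply: le_trans (lerD I1 I2) _.
by rewrite le_eqVlt; apply/orP; left; apply/eqP; ring.
Qed.

End Rect.

Lemma nested_point (u : nat -> R) (d : R) :
  (forall n, u n <= u n.+1) ->
  (forall n, u n.+1 + d / 2 ^+ n.+1 <= u n + d / 2 ^+ n) -> 0 <= d ->
  exists x, forall n, u n <= x <= u n + d / 2 ^+ n.
Proof.
move=> u1 u2 d0.
have mono n m : (n <= m)%N -> u n <= u m.
  by move=> /subnK <-; elim: (m - n)%N => // k IH; exact: le_trans IH (u1 _).
have anti n m : (n <= m)%N -> u m + d / 2 ^+ m <= u n + d / 2 ^+ n.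
  by move=> /subnK <-; elim: (m - n)%N => // k IH; exact: le_trans (u2 _) IH.
have pd n : 0 <= d / 2 ^+ n by rewrite divr_ge0// exprn_ge0.
have ub n m : u m <= u n + d / 2 ^+ n.
  have [nm|mn] := leP n m.
    by apply: le_trans (anti _ _ nm); rewrite lerDl.
  by apply: le_trans (mono _ _ (ltW mn)) _; rewrite lerDl.
exists (sup (range u)) => n; apply/andP; split.
  apply: ub_le_sup; last by exists n.
  by exists (u 0%N + d / 2 ^+ 0%N) => _ [m _ <-].
by apply: ge_sup; [exists (u 0%N), 0%N|move=> _ [m _ <-]].
Qed.

Lemma half_pow_small (d e : R) : 0 < e -> exists n : nat, d / 2 ^+ n < e.
Proof.
move=> e0; have [n hn] : exists n : nat, d / e < n%:R.
  by exists (Num.bound `|d / e|); rewrite (le_lt_trans (ler_norm _))// archi_boundP.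
exists n; rewrite ltr_pdivrMr ?exprn_gt0// mulrC -ltr_pdivrMr//.
apply: lt_trans hn _; rewrite -natrX ltr_nat; exact: ltn_expl.
Qed.

(** Bisection: if the integral has modulus [c > 0], some nested quarter of generation [n] carries at
    least [c / 4 ^+ n], while differentiability at the common point makes it smaller than any fixed
    multiple of that. *)
Theorem goursat P Q x y l k : 0 < l -> 0 < k -> closed_form_on P Q x y l k ->
  rectint P Q x y l k = 0.
Proof.
move=> l0 k0 H; apply: contrapT => /eqP nz.
set c := `|rectint P Q x y l k|; have c0 : 0 < c by rewrite normr_gt0.
pose sz (d : R) n := d / 2 ^+ n.
have szS d n : sz d n = sz d n.+1 + sz d n.+1.
  by rewrite /sz exprS invfM; field; rewrite expf_neq0.
have sz0 d n : 0 < d -> 0 < sz d n by move=> d0; rewrite divr_gt0// exprn_gt0.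
pose inv n (p : R * R) := [/\ x <= p.1, p.1 + sz l n <= x + l, y <= p.2,
  p.2 + sz k n <= y + k & c / 4 ^+ n <= `|rectint P Q p.1 p.2 (sz l n) (sz k n)|].
have step n p : inv n p -> exists p', inv n.+1 p' /\
    [/\ p.1 <= p'.1, p'.1 + sz l n.+1 <= p.1 + sz l n,
        p.2 <= p'.2 & p'.2 + sz k n.+1 <= p.2 + sz k n].
  case=> h1 h2 h3 h4 h5.
  have l1 := sz0 l n.+1 l0; have k1 := sz0 k n.+1 k0.
  have lS := szS l n; have kS := szS k n.
  move: h2 h4 h5; rewrite lS kS => h2 h4 h5.
  have [|x' [y' [hx hy hc]]] := @rectint_quarter P Q p.1 p.2 (sz l n.+1) (sz k n.+1)
      (c / 4 ^+ n.+1) (ltW l1) (ltW k1) (closed_formS h1 h2 h3 h4 H).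
    apply: le_trans h5; rewrite exprS invfM le_eqVlt; apply/orP; left; apply/eqP.
    by field; rewrite expf_neq0.
  exists (x', y'); rewrite /inv /=.
  by case: hx => hx; case: hy => hy; split; split => //; move: hx hy l1 k1 h1 h2 h3 h4; clear; lra.
have i0 : inv 0%N (x, y) by rewrite /inv /sz !expr0 !divr1 /=; split.
(* Dependent choice of a chain of quarters, each corner packed with its invariant. *)
pose sq := fix sq n : {p | inv n p} := match n with
  | 0%N => exist _ _ i0
  | m.+1 => let p := sq m in let w := cid (step m (sval p) (svalP p)) in
      exist _ (sval w) (svalP w).1 end.
have sqS n := (svalP (cid (step n (sval (sq n)) (svalP (sq n))))).2.
have [xs hxs] : exists s, forall n, (sval (sq n)).1 <= s <= (sval (sq n)).1 + sz l n.
  by apply: nested_point => [n|n|]; [case: (sqS n)|case: (sqS n)|exact: ltW].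
have [ys hys] : exists s, forall n, (sval (sq n)).2 <= s <= (sval (sq n)).2 + sz k n.
  by apply: nested_point => [n|n|]; [case: (sqS n)|case: (sqS n)|exact: ltW].
have [a [b [c' [dP dQ]]]] : closed_form_at P Q xs ys.
  apply: H; [have := hxs 0%N|have := hys 0%N].
  - by rewrite /= /sz expr0 divr1.
  - by rewrite /= /sz expr0 divr1.
have lk0 : 0 < l + k by rewrite addr_gt0.
(* With this tolerance the upper bound [2 * e * ((l + k) / 2 ^+ n) ^+ 2] is half of the lower bound
   [c / 4 ^+ n]. *)
pose e := c / (4 * (l + k) ^+ 2).
have e0 : 0 < e by rewrite divr_gt0// mulr_gt0// exprn_gt0.
have [d1 d10 h1] := dP _ e0; have [d2 d20 h2] := dQ _ e0.
have d0 : 0 < Num.min d1 d2 by rewrite lt_min d10.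
have [n hn] := half_pow_small (l + k) d0.
have [g1 g2 g3 g4 g5] := svalP (sq n).
have small := @rectint_small P Q (sval (sq n)).1 (sval (sq n)).2 (sz l n) (sz k n) xs ys e
  (Num.min d1 d2) a b c' (ltW (sz0 l n l0)) (ltW (sz0 k n k0)) (closed_formS g1 g2 g3 g4 H)
  (hxs n) (hys n) e0.
have : c / 4 ^+ n <= 2 * e * (sz l n + sz k n) ^+ 2.
  apply: le_trans g5 _; apply: small; first by rewrite /sz -mulrDl.
    by move=> x' y'; rewrite !lt_min => /andP[? _] /andP[? _]; exact: h1.
  by move=> x' y'; rewrite !lt_min => /andP[_ ?] /andP[_ ?]; exact: h2.
have -> : 2 * e * (sz l n + sz k n) ^+ 2 = (c / 4 ^+ n) / 2.
  rewrite /sz -mulrDl expr_div_n -exprM mulnC exprM /e.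
  have -> : (2 : R) ^+ 2 = 4 by rewrite -natrX.
  by field; rewrite expf_neq0//= gt_eqF.
have : 0 < c / 4 ^+ n by rewrite divr_gt0// exprn_gt0.
by clear; lra.
Qed.

End Goursat.

(** * Rules for complex derivatives *)

Section ComplexDerivable.
Context {R : realType}.
Local Notation C := R[i].
Implicit Types (f g : C -> C) (z : C).

Definition cdv f z := derivable (f : C^o -> C^o) z 1.

Lemma cdv_cst (c : C) z : cdv (fun=> c) z.
Proof. exact: derivable_cst. Qed.

Lemma cdv_id z : cdv (fun w => w) z.
Proof. exact: derivable_id. Qed.

Lemma cdvD f g z : cdv f z -> cdv g z -> cdv (fun w => f w + g w) z.
Proof. by move=> df dg; exact: (@derivableD C C^o C^o f g z 1 df dg). Qed.

Lemma cdvB f g z : cdv f z -> cdv g z -> cdv (fun w => f w - g w) z.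
Proof. by move=> df dg; exact: (@derivableB C C^o C^o f g z 1 df dg). Qed.

Lemma cdvM f g z : cdv f z -> cdv g z -> cdv (fun w => f w * g w) z.
Proof. by move=> df dg; exact: (@derivableM C C^o f g z 1 df dg). Qed.

Lemma cdvV f z : f z != 0 -> cdv f z -> cdv (fun w => (f w)^-1) z.
Proof. by move=> fz df; exact: (@derivableV C C^o f z 1 fz df). Qed.

Lemma cdvX n z : cdv (fun w => w ^+ n) z.
Proof.
elim: n => [|n IH]; first exact: cdv_cst.
under eq_fun do rewrite exprS; apply: cdvM IH; exact: cdv_id.
Qed.

Lemma cdv_cont f z : cdv f z -> forall e : R, 0 < e ->
  exists2 del : R, 0 < del & forall w, normc (w - z) < del -> normc (f w - f z) <= e.
Proof. by move=> /derivable_cdiff[d]; exact: cdiff_cont. Qed.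

Lemma cdv_eq f g z (e : R) : 0 < e -> (forall w, normc (w - z) < e -> f w = g w) ->
  cdv f z -> cdv g z.
Proof.
move=> e0 fg /derivable_cdiff[d Hd]; apply/derivable_cdiff; exists d => e' e'0.
have [del del0 H] := Hd _ e'0; exists (Num.min del e); first by rewrite lt_min del0.
move=> w; rewrite lt_min => /andP[w1 w2]; rewrite -fg// -fg ?subrr ?normc0//; exact: H.
Qed.

Lemma cdv_comp f g z : cdv g z -> cdv f (g z) -> cdv (fun w => f (g w)) z.
Proof.
move=> /[dup] /cdv_cont cg /derivable_cdiff[d Hd] /derivable_cdiff[d' Hd'].
apply/derivable_cdiff; exists (d' * d) => e e0.
have K0 : 0 < 1 + normc d by rewrite ltr_pwDl// normc_ge0.
have K0' : 0 < 1 + normc d' by rewrite ltr_pwDl// normc_ge0.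
have [|d1 d10 H1] := Hd' (e / 2 / (1 + normc d)); first by rewrite !divr_gt0.
(* The bound [1] makes [g] Lipschitz at [z] with constant [1 + normc d]; the other bound controls
   the error of [g] once multiplied by [d']. *)
have [|d2 d20 H2] := Hd (Num.min 1 (e / 2 / (1 + normc d'))).
  by rewrite lt_min ltr01 !divr_gt0.
have [|d3 d30 H3] := cg (d1 / 2); first by rewrite divr_gt0.
exists (Num.min d2 d3); first by rewrite lt_min d20.
move=> w; rewrite lt_min => /andP[/H2 h2 /H3 h3].
have /H1 h1 : normc (g w - g z) < d1 by apply: (le_lt_trans h3); rewrite ltr_pdivrMr// mulr_natr mulr2n ltrDl.
have n0 := normc_ge0 (w - z).
have b1 : normc (g w - g z - d * (w - z)) <= normc (w - z).
  by apply: le_trans h2 _; rewrite -[leRHS]mul1r ler_wpM2r// ge_min lexx.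
have b2 : normc (g w - g z - d * (w - z)) <= e / 2 / (1 + normc d') * normc (w - z).
  by apply: le_trans h2 _; rewrite ler_wpM2r// ge_min lexx orbT.
have b3 : normc (g w - g z) <= (1 + normc d) * normc (w - z).
  rewrite -(subrK (d * (w - z)) (g w - g z)) (le_trans (le_normcD _ _))//.
  by rewrite normcM mulrDl mul1r lerD2r.
have -> : f (g w) - f (g z) - d' * d * (w - z) =
  (f (g w) - f (g z) - d' * (g w - g z)) + d' * (g w - g z - d * (w - z)) by ring.
apply: le_trans (le_normcD _ _) _; rewrite normcM.
have c1 : normc (f (g w) - f (g z) - d' * (g w - g z)) <= e / 2 * normc (w - z).
  apply: le_trans h1 _; rewrite -[leRHS](@divfK _ (1 + normc d)) ?gt_eqF//.
  have -> : e / 2 * normc (w - z) / (1 + normc d) * (1 + normc d) =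
    e / 2 / (1 + normc d) * ((1 + normc d) * normc (w - z)) by ring.
  by rewrite ler_wpM2l// !divr_ge0// ltW.
have c2 : normc d' * normc (g w - g z - d * (w - z)) <= e / 2 * normc (w - z).
  apply: (@le_trans _ _ ((1 + normc d') * (e / 2 / (1 + normc d') * normc (w - z)))).
    by rewrite ler_pM ?normc_ge0// lerDr.
  by rewrite mulrA mulrC [X in _ * X]mulrC divfK ?gt_eqF// mulrC.
lra.
Qed.

Lemma cdv_horner (p : {poly C}) z : cdv (fun w => p.[w]) z.
Proof.
elim/poly_ind: p => [|p c IH].
  by under eq_fun do rewrite horner0; exact: cdv_cst.
under eq_fun do rewrite !hornerE.
by apply: cdvD; [apply: cdvM; [|exact: cdv_id]|exact: cdv_cst].
Qed.

End ComplexDerivable.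

(** * Real differentials of complex-valued functions of two real variables *)

Section Differential2.
Context {R : realType}.
Local Notation C := R[i].
Implicit Types (F G : R -> R -> C).

Definition cdiff2 F x y (A B : C) := forall e : R, 0 < e ->
  exists2 del : R, 0 < del & forall x' y', `|x' - x| < del -> `|y' - y| < del ->
    normc (F x' y' - F x y - A * (x' - x)%:C%C - B * (y' - y)%:C%C) <=
    e * (`|x' - x| + `|y' - y|).

Lemma cdiff2_Re F x y A B : cdiff2 F x y A B ->
  diff2 (fun s t => complex.Re (F s t)) x y (complex.Re A) (complex.Re B).
Proof.
move=> H e /H[del del0 h]; exists del => // x' y' hx hy.
apply: le_trans (h _ _ hx hy); apply: le_trans (Re_le_normc _).
rewrite le_eqVlt; apply/orP; left; apply/eqP; congr `| _ |.
case: (F x' y') (F x y) A B {H h} => [a b] [c d] [u v] [p q] /=; ring.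
Qed.

Lemma cdiff2_Im F x y A B : cdiff2 F x y A B ->
  diff2 (fun s t => complex.Im (F s t)) x y (complex.Im A) (complex.Im B).
Proof.
move=> H e /H[del del0 h]; exists del => // x' y' hx hy.
apply: le_trans (h _ _ hx hy); apply: le_trans (Im_le_normc _).
rewrite le_eqVlt; apply/orP; left; apply/eqP; congr `| _ |.
case: (F x' y') (F x y) A B {H h} => [a b] [c d] [u v] [p q] /=; ring.
Qed.

Lemma cdiff2_lip F x y A B : cdiff2 F x y A B ->
  exists2 del : R, 0 < del & forall x' y', `|x' - x| < del -> `|y' - y| < del ->
    normc (F x' y' - F x y) <= (1 + normc A + normc B) * (`|x' - x| + `|y' - y|).
Proof.
move=> /(_ 1 ltr01)[del del0 H]; exists del => // x' y' hx hy.
have := H _ _ hx hy; rewrite mul1r => h.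
have -> : F x' y' - F x y = (F x' y' - F x y - A * (x' - x)%:C%C - B * (y' - y)%:C%C) +
  (A * (x' - x)%:C%C + B * (y' - y)%:C%C) by ring.
apply: le_trans (le_normcD _ _) _.
apply: le_trans (lerD h (le_normcD _ _)) _; rewrite !normcM !normcR.
have := normc_ge0 A; have := normc_ge0 B.
have := normr_ge0 (x' - x); have := normr_ge0 (y' - y); nra.
Qed.

Lemma cdiff2_cst (c : C) x y : cdiff2 (fun _ _ => c) x y 0 0.
Proof.
move=> e e0; exists 1 => // x' y' _ _.
by rewrite !mul0r !subr0 subrr normc0 mulr_ge0 ?addr_ge0// ltW.
Qed.

Lemma cdiff2_fst x y : cdiff2 (fun s _ => s%:C%C) x y 1 0.
Proof.
move=> e e0; exists 1 => // x' y' _ _.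
rewrite mul0r subr0 mul1r [(x' - x)%:C%C]rmorphB subrr normc0 mulr_ge0 ?addr_ge0//; exact: ltW.
Qed.

Lemma cdiff2D F G x y A B A' B' : cdiff2 F x y A B -> cdiff2 G x y A' B' ->
  cdiff2 (fun s t => F s t + G s t) x y (A + A') (B + B').
Proof.
move=> HF HG e e0; have e2 : 0 < e / 2 by rewrite divr_gt0.
have [d1 d10 H1] := HF _ e2; have [d2 d20 H2] := HG _ e2.
exists (Num.min d1 d2); first by rewrite lt_min d10.
move=> x' y'; rewrite !lt_min => /andP[x1 x2] /andP[y1 y2].
have h1 := H1 _ _ x1 y1; have h2 := H2 _ _ x2 y2.
set X := (X in normc X).
have -> : X = (F x' y' - F x y - A * (x' - x)%:C%C - B * (y' - y)%:C%C) +
  (G x' y' - G x y - A' * (x' - x)%:C%C - B' * (y' - y)%:C%C) by rewrite /X; ring.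
by apply: le_trans (le_normcD _ _) _; lra.
Qed.

Lemma cdiff2M F G x y A B A' B' : cdiff2 F x y A B -> cdiff2 G x y A' B' ->
  cdiff2 (fun s t => F s t * G s t) x y (A * G x y + F x y * A') (B * G x y + F x y * B').
Proof.
move=> HF HG e e0.
have := cdiff2_lip HG; set L := 1 + _ + _ => -[d3 d30 H3].
have L0 : 0 < L by rewrite /L -addrA ltr_pwDl// addr_ge0 ?normc_ge0.
set M := 1 + normc A + normc B.
have M0 : 0 < M by rewrite /M -addrA ltr_pwDl// addr_ge0 ?normc_ge0.
set g := 1 + normc (G x y); have g0 : 0 < g by rewrite /g ltr_pwDl// normc_ge0.
set h := 1 + normc (F x y); have h0 : 0 < h by rewrite /h ltr_pwDl// normc_ge0.
have := cdiff2_lip HF; rewrite -/M => -[d4 d40 H4].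
have [|d1 d10 H1] := HF (e / 3 / g); first by rewrite !divr_gt0.
have [|d2 d20 H2] := HG (e / 3 / h); first by rewrite !divr_gt0.
(* The last entry is for the product of the two increments, at most [M * L * N ^+ 2], where [N] is
   the sum of two distances and so at most [e / 3 / L / M]. *)
exists (Num.min (Num.min d1 d2) (Num.min (Num.min d3 d4) (e / 6 / L / M))).
  by rewrite !lt_min d10 d20 d30 d40 !divr_gt0.
move=> x' y'; rewrite !lt_min => /andP[/andP[x1 x2] /andP[/andP[x3 x4] x5]].
move=> /andP[/andP[y1 y2] /andP[/andP[y3 y4] y5]].
have k1 := H1 _ _ x1 y1; have k2 := H2 _ _ x2 y2; have k3 := H3 _ _ x3 y3.
set N := `|x' - x| + `|y' - y| in k1 k2 k3 *.
have N0 : 0 <= N by rewrite addr_ge0.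
set X := (X in normc X).
have -> : X = (F x' y' - F x y - A * (x' - x)%:C%C - B * (y' - y)%:C%C) * G x y +
  ((F x' y' - F x y) * (G x' y' - G x y) +
   F x y * (G x' y' - G x y - A' * (x' - x)%:C%C - B' * (y' - y)%:C%C)).
  by rewrite /X; ring.
apply: le_trans (le_normcD _ _) _; apply: le_trans (lerD (lexx _) (le_normcD _ _)) _.
rewrite !normcM.
have F1 := H4 _ _ x4 y4; rewrite -/N in F1.
have t1 : normc (F x' y' - F x y - A * (x' - x)%:C%C - B * (y' - y)%:C%C) * normc (G x y) <=
    e / 3 * N.
  apply: (@le_trans _ _ ((e / 3 / g * N) * g)).
    by rewrite ler_pM ?normc_ge0// lerDr.
  by rewrite mulrAC divfK ?gt_eqF.
have t3 : normc (F x y) * normc (G x' y' - G x y - A' * (x' - x)%:C%C - B' * (y' - y)%:C%C) <=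
    e / 3 * N.
  apply: (@le_trans _ _ (h * (e / 3 / h * N))).
    by rewrite ler_pM ?normc_ge0// lerDr.
  by rewrite mulrA mulrC [X in _ * X]mulrC divfK ?gt_eqF// mulrC.
have t2 : normc (F x' y' - F x y) * normc (G x' y' - G x y) <= e / 3 * N.
  apply: (@le_trans _ _ ((M * N) * (L * N))); first by rewrite ler_pM ?normc_ge0.
  have NN : N <= e / 3 / L / M.
    have -> : e / 3 / L / M = e / 6 / L / M + e / 6 / L / M by field; rewrite !gt_eqF.
    by rewrite lerD ?ltW.
  have -> : M * N * (L * N) = (M * L * N) * N by ring.
  rewrite ler_wpM2r//; move: NN; rewrite ler_pdivlMr// ler_pdivlMr//.
  by have -> : N * M * L = M * L * N by ring.
by move: t1 t2 t3; clear; lra.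
Qed.

End Differential2.

(** * Cauchy's formula and Taylor expansion *)

Section CircleParam.
Context {R : realType}.
Local Notation C := R[i].

Definition eit (t : R) : C := Complex (cos t) (sin t).

Lemma normc_eit t : normc (eit t) = 1.
Proof. by rewrite /normc /= cos2Dsin2 sqrtr1. Qed.

Lemma eit0 : eit 0 = 1.
Proof. by rewrite /eit cos0 sin0. Qed.

Lemma eit2pi : eit (pi *+ 2) = 1.
Proof. by rewrite /eit cos2pi sin2pi. Qed.

Lemma eitD s t : eit (s + t) = eit s * eit t.
Proof.
by apply/eqP; rewrite eq_complex /= cosD sinD addrC [in X in _ && (_ == X)]addrC !eqxx.
Qed.

Lemma eitMn t n : eit (t *+ n) = eit t ^+ n.
Proof. by elim: n => [|n IH]; rewrite ?mulr0n ?eit0 ?expr0// mulrS exprS eitD IH. Qed.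

Lemma is_derive_diff (f : R -> R) (x df : R) : is_derive x 1 f df -> forall e : R, 0 < e ->
  exists2 del : R, 0 < del & forall y, `|y - x| < del ->
    `|f y - f x - df * (y - x)| <= e * `|y - x|.
Proof.
move=> [/cvg_ex[/= l lP] lE] e e0.
have dfE : l = df by rewrite -lE; apply/esym/cvg_lim.
move: lP => /cvgrPdist_le /(_ _ e0) /nbhs_ballP[del /= del0 H]; exists del => // y hy.
have [->|ynx] := eqVneq y x; first by rewrite !subrr mulr0 subr0 normr0 mulr0.
have yx0 : y - x != 0 by rewrite subr_eq0.
have := H (y - x); rewrite /ball /= sub0r normrN => /(_ hy yx0).
rewrite /GRing.scale /= mulr1 subrK dfE => h.
have -> : f y - f x - df * (y - x) = - (df - (y - x)^-1 * (f y - f x)) * (y - x).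
  by rewrite opprB mulrBl mulrAC mulVf// mul1r.
by rewrite normrM normrN ler_wpM2r.
Qed.

Lemma cdiff2_eit (x y : R) : cdiff2 (fun _ t => eit t) x y 0 (Complex 0 1 * eit y).
Proof.
move=> e e0; have e2 : 0 < e / 2 by rewrite divr_gt0.
have [d1 d10 H1] := is_derive_diff (is_derive_cos y) e2.
have [d2 d20 H2] := is_derive_diff (is_derive_sin y) e2.
exists (Num.min d1 d2); first by rewrite lt_min d10.
move=> x' y' _; rewrite lt_min => /andP[/H1 h1 /H2 h2].
apply: le_trans (normc_le_ReIm _) _ => /=.
set X := `|_|; set Y := `|_|.
have -> : X = `|cos y' - cos y - - sin y * (y' - y)| by congr `| _ |; ring.
have -> : Y = `|sin y' - sin y - cos y * (y' - y)| by congr `| _ |; ring.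
have := ler_wpM2l (ltW e0) (normr_ge0 (x' - x)); lra.
Qed.

Lemma cdiff2_comp (f : C -> C) d (G : R -> R -> C) x y A B :
  cdiff f (G x y) d -> cdiff2 G x y A B ->
  cdiff2 (fun s t => f (G s t)) x y (d * A) (d * B).
Proof.
move=> Hf HG e e0.
have := cdiff2_lip HG; set L := 1 + _ + _ => -[d3 d30 H3].
have L0 : 0 < L by rewrite /L -addrA ltr_pwDl// addr_ge0 ?normc_ge0.
set K := 1 + normc d; have K0 : 0 < K by rewrite /K ltr_pwDl// normc_ge0.
have [|d1 d10 H1] := Hf (e / 2 / L); first by rewrite !divr_gt0.
have [|d2 d20 H2] := HG (e / 2 / K); first by rewrite !divr_gt0.
exists (Num.min (Num.min d2 d3) (d1 / 2 / L)).
  by rewrite !lt_min d20 d30 !divr_gt0.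
move=> x' y'; rewrite !lt_min => /andP[/andP[x2 x3] x1] /andP[/andP[y2 y3] y1].
have k2 := H2 _ _ x2 y2; have k3 := H3 _ _ x3 y3.
set N := `|x' - x| + `|y' - y| in k2 k3 *.
have N0 : 0 <= N by rewrite addr_ge0.
have /H1 k1 : normc (G x' y' - G x y) < d1.
  apply: le_lt_trans k3 _; rewrite mulrC -ltr_pdivlMr//.
  have -> : d1 / L = d1 / 2 / L + d1 / 2 / L by field; rewrite gt_eqF.
  by rewrite ltrD.
set X := (X in normc X).
have -> : X = (f (G x' y') - f (G x y) - d * (G x' y' - G x y)) +
  d * (G x' y' - G x y - A * (x' - x)%:C%C - B * (y' - y)%:C%C) by rewrite /X; ring.
apply: le_trans (le_normcD _ _) _; rewrite normcM.
have t1 : normc (f (G x' y') - f (G x y) - d * (G x' y' - G x y)) <= e / 2 * N.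
  apply: le_trans k1 _; have -> : e / 2 * N = e / 2 / L * (L * N) by field; rewrite gt_eqF.
  by rewrite ler_wpM2l// !divr_ge0// ltW.
have t2 : normc d * normc (G x' y' - G x y - A * (x' - x)%:C%C - B * (y' - y)%:C%C) <=
    e / 2 * N.
  have -> : e / 2 * N = K * (e / 2 / K * N) by field; rewrite gt_eqF.
  by rewrite ler_pM ?normc_ge0// lerDr.
by move: t1 t2; clear; lra.
Qed.

End CircleParam.

Section Cauchy.
Context {R : realType}.
Local Notation C := R[i].
Implicit Types (f g : C -> C) (a z : C).

(** Integration is in the angle: for a contour integral, the factor [z] of [dz = i z dt] goes into
    the integrand. *)
Definition cint (F : R -> C) : C :=
  Complex (segint 0 (pi *+ 2) (fun t => complex.Re (F t)))
          (segint 0 (pi *+ 2) (fun t => complex.Im (F t))).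

Definition circ (r : R) t : C := r%:C%C * eit t.

Lemma normc_circ r t : 0 <= r -> normc (circ r t) = r.
Proof. by move=> r0; rewrite normcM normcR normc_eit mulr1 ger0_norm. Qed.

Lemma cdiff2_circ r x y : cdiff2 (fun _ t => circ r t) x y 0 (Complex 0 1 * circ r y).
Proof.
have := cdiff2M (cdiff2_cst r%:C%C x y) (cdiff2_eit x y).
rewrite mul0r mulr0 !add0r.
by have -> // : r%:C%C * (Complex 0 1 * eit y) = Complex 0 1 * circ r y by rewrite /circ; ring.
Qed.

Section Kernel.
Variables (f : C -> C) (a : C) (r : R).
Hypothesis hf : forall z, normc z < 1 -> cdv f z.
Hypothesis (ar : normc a < r) (r1 : r < 1).

Let r0 : 0 < r. Proof. exact: le_lt_trans (normc_ge0 _) ar. Qed.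

Let w t := circ r t - a.
Let gam (l t : R) := a + l%:C%C * w t.

Let w_neq0 t : w t != 0.
Proof.
rewrite subr_eq0; apply/eqP => h; move: ar.
by rewrite -h normc_circ ?ltxx// ltW.
Qed.

Let gam_in l t : 0 <= l <= 1 -> normc (gam l t) < 1.
Proof.
move=> /andP[l0 l1].
have -> : gam l t = (1 - l)%:C%C * a + l%:C%C * circ r t.
  by rewrite /gam /w rmorphB rmorph1; ring.
apply: le_lt_trans (le_normcD _ _) _.
rewrite !normcM !normcR normc_eit mulr1 !ger0_norm ?subr_ge0//; last exact: ltW.
have := normc_ge0 a; have := ar; have := r1; nra.
Qed.

(* The pull-back of [(f z - f a) / (z - a) dz] along [gam]; the [dl]-part is [Pk], the
   [dt]-part [Qk]. Shrinking [l] to 0 contracts the circle to [a]. *)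
Let Pk l t := (f (gam l t) - f a) * (l%:C%C)^-1.
Let Qk l t := (f (gam l t) - f a) * (Complex 0 1 * circ r t * (circ r t - a)^-1).

(** Both cross derivatives equal [d * i * circ r t], where [d] is the complex derivative of [f] at
    [gam l t]: in [Pk] the factor [l] cancels, in [Qk] the factor [w t]. *)
Let closed_kernel l t : 0 < l <= 1 -> exists A B D,
  cdiff2 Pk l t A B /\ cdiff2 Qk l t B D.
Proof.
move=> /andP[l0 l1].
have dw : cdiff2 (fun _ t => w t) l t 0 (Complex 0 1 * circ r t).
  have := cdiff2D (cdiff2_circ r l t) (cdiff2_cst (- a) l t).
  by rewrite !addr0.
have dg : cdiff2 gam l t (w t) (l%:C%C * (Complex 0 1 * circ r t)).
  have := cdiff2D (cdiff2_cst a l t) (cdiff2M (cdiff2_fst l t) dw).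
  by rewrite mul1r mulr0 mul0r !add0r addr0.
have /hf/derivable_cdiff[d dd] : normc (gam l t) < 1 by rewrite gam_in// (ltW l0).
have dfa : cdiff2 (fun s u => f (gam s u) - f a) l t (d * w t)
    (d * (l%:C%C * (Complex 0 1 * circ r t))).
  have := cdiff2D (cdiff2_comp dd dg) (cdiff2_cst (- f a) l t).
  by rewrite !addr0.
have l0' : l%:C%C != 0 by rewrite -normc_gt0 normcR normr_gt0 gt_eqF.
have /derivable_cdiff[dv ddv] : cdv (fun z => z^-1) (l%:C%C : C).
  by apply: cdvV => //; exact: cdv_id.
have dinv : cdiff2 (fun s _ => (s%:C%C : C)^-1) l t (dv * 1) (dv * 0).
  exact: (cdiff2_comp ddv (cdiff2_fst l t)).
have /derivable_cdiff[dk ddk] : cdv (fun z => Complex 0 1 * z * (z - a)^-1) (circ r t).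
  apply: cdvM; first by apply: cdvM; [exact: cdv_cst|exact: cdv_id].
  apply: cdvV; first exact: w_neq0.
  by apply: cdvB; [exact: cdv_id|exact: cdv_cst].
have dker := cdiff2_comp (G := fun _ t => circ r t) ddk (cdiff2_circ r l t).
have dP := cdiff2M dfa dinv; have dQ := cdiff2M dfa dker.
eexists; eexists; eexists; split; first exact: dP.
have E : d * (l%:C%C * (Complex 0 1 * circ r t)) / l%:C%C + (f (gam l t) - f a) * (dv * 0) =
    d * w t * (Complex 0 1 * circ r t / (circ r t - a)) + (f (gam l t) - f a) * (dk * 0).
  have w0 : circ r t - a != 0 by exact: w_neq0.
  rewrite !mulr0 !addr0 /w; field; rewrite ?l0' ?w0 //=.
rewrite E; exact: dQ.
Qed.

Let pi0 : 0 < (pi *+ 2 : R). Proof. by rewrite mulrn_wgt0// pi_gt0. Qed.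

(** Here [p] is the real or the imaginary part. On the rectangle from [eps] to 1 in [l], which stays
    away from the pole of [Pk] at 0, the sides [t = 0] and [t = 2 pi] contribute nothing by
    periodicity. Hence the integral of [Qk] is the same at [l = eps] as at [l = 1], and it tends to
    0 with [eps] by continuity of [f] at [a]. *)
Let kernel_part (p : C -> R) :
  (forall l t, 0 < l <= 1 -> closed_form_at (fun l t => p (Pk l t)) (fun l t => p (Qk l t)) l t) ->
  (forall z, `|p z| <= normc z) ->
  segint 0 (pi *+ 2) (fun t => p (Qk 1 t)) = 0.
Proof.
move=> cl pz.
have const eps : 0 < eps < 1 -> segint 0 (pi *+ 2) (fun t => p (Qk 1 t)) =
    segint 0 (pi *+ 2) (fun t => p (Qk eps t)).
  move=> /andP[e0 e1].
  have cf : closed_form_on (fun l t => p (Pk l t)) (fun l t => p (Qk l t))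
      eps 0 (1 - eps) (pi *+ 2).
    by move=> s t /andP[s1 s2] _; apply: cl; rewrite (lt_le_trans e0 s1); lra.
  have := goursat _ pi0 cf; rewrite subr_gt0 => /(_ e1).
  rewrite /rectint add0r.
  rewrite (_ : segint eps _ _ = 0) ?add0r; last first.
    rewrite (@eq_segint _ _ _ _ (fun=> 0)); first by rewrite segint_cst ?mul0r//; lra.
    by move=> s _; rewrite /Pk /gam /w /circ eit2pi eit0 subrr.
  have -> : eps + (1 - eps) = 1 by ring.
  have cQ s : eps <= s <= 1 -> cont_on 0 (0 + pi *+ 2) (fun t => p (Qk s t)).
    move=> hs; apply: (closed_formQ_cont cf); lra.
  rewrite add0r in cQ.
  rewrite segintB; [move/eqP; rewrite subr_eq0 => /eqP//| |]; apply: cQ; lra.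
apply/eqP; rewrite -normr_le0; apply/ler_addgt0Pl => e e0; rewrite addr0.
(* The tolerance compensates the kernel, bounded by [r / (r - normc a)], and the length of the
   interval of integration. *)
have [|del del0 H] := cdv_cont (hf (lt_trans ar r1)) (e := e * (r - normc a) / r / (pi *+ 2)).
  by rewrite !divr_gt0// mulr_gt0// subr_gt0.
(* As [normc (w t) < 2], the contracted circle stays within [del] of [a]. *)
pose eps := Num.min (1 / 2) (del / 4).
have eps0 : 0 < eps by rewrite lt_min !divr_gt0.
have eps1 : eps < 1 by rewrite gt_min ltr_pdivrMr// mul1r ltrDl ltr01.
rewrite (const eps) ?eps0//.
have cQ : cont_on 0 (pi *+ 2) (fun t => p (Qk eps t)).
  move=> t _; have [|A [B [D [_ h]]]] := cl eps t; first by rewrite eps0 ltW.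
  exact: diff2_cont1r h.
have := @segint_bound _ 0 (pi *+ 2) _ 0 (e / (pi *+ 2)) (ltW pi0) cQ.
rewrite mul0r !subr0 divfK ?gt_eqF//; apply => t _; rewrite subr0.
apply: le_trans (pz _) _; rewrite normcM.
have q1 : normc (f (gam eps t) - f a) <= e * (r - normc a) / r / (pi *+ 2).
  apply: H; rewrite /gam addrAC subrr add0r normcM normcR gtr0_norm//.
  apply: (@le_lt_trans _ _ (eps * 2)).
    rewrite ler_pM2l//; apply: le_trans (normcB _ _) _; rewrite normc_circ ?(ltW r0)//.
    by have := ar; have := r1; lra.
  have : eps <= del / 4 by rewrite ge_min lexx orbT.
  by move: del0; lra.
have q2 : normc (Complex 0 1 * circ r t * (circ r t - a)^-1) <= r / (r - normc a).
  rewrite normcM (normcM (Complex 0 1)) normcV normc_circ ?(ltW r0)//.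
  have -> : normc (Complex 0 1 : C) = 1 by rewrite /normc /= expr0n /= add0r expr1n sqrtr1.
  rewrite mul1r ler_pM2l// lef_pV2 ?posrE ?normc_gt0 ?subr_gt0//; last exact: w_neq0.
  by apply: le_trans (normc_le_subD _ _); rewrite normc_circ// ltW.
apply: le_trans (ler_pM (normc_ge0 _) (normc_ge0 _) q1 q2) _.
have key (T u v : R) : T != 0 -> u != 0 -> v != 0 -> e * u / v / T * (v / u) = e / T.
  by move=> T0 u0 v0; field; rewrite T0 u0 v0.
by rewrite key// gt_eqF// subr_gt0.
Qed.

(** Up to the factor [i] this is the contour integral of [(f z - f a) / (z - a)]: Cauchy's formula,
    but for the integral of the kernel itself. *)
Lemma cauchy_kernel :
  cint (fun t => (f (circ r t) - f a) * (circ r t / (circ r t - a))) = 0.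
Proof.
have Q1 t : Qk 1 t = Complex 0 1 * ((f (circ r t) - f a) * (circ r t / (circ r t - a))).
  have -> : Qk 1 t = (f (gam 1 t) - f a) * (Complex 0 1 * circ r t * (circ r t - a)^-1) by [].
  have -> : gam 1 t = circ r t by rewrite /gam /w rmorph1; ring.
  by ring.
have i1 : segint 0 (pi *+ 2) (fun t => complex.Re (Qk 1 t)) = 0.
  apply: kernel_part; last exact: Re_le_normc.
  move=> l t /(@closed_kernel l t)[A [B [D [h1 h2]]]].
  by exists (complex.Re A), (complex.Re B), (complex.Re D); split; exact: cdiff2_Re.
have i2 : segint 0 (pi *+ 2) (fun t => complex.Im (Qk 1 t)) = 0.
  apply: kernel_part; last exact: Im_le_normc.
  move=> l t /(@closed_kernel l t)[A [B [D [h1 h2]]]].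
  by exists (complex.Im A), (complex.Im B), (complex.Im D); split; exact: cdiff2_Im.
apply/eqP; rewrite eq_complex /=; apply/andP; split; apply/eqP.
  rewrite -[RHS]i2; apply: eq_segint => t _; rewrite Q1.
  by case: (_ * (circ r t / _)) => u v /=; ring.
rewrite -[RHS]oppr0 -[in RHS]i1.
have cQ : cont_on 0 (pi *+ 2) (fun t => complex.Re (Qk 1 t)).
  move=> t _; have [|A [B [D [_ h2]]]] := @closed_kernel 1 t; first by rewrite ltr01 lexx.
  exact: (diff2_cont1r (cdiff2_Re h2)).
rewrite -[RHS]mulN1r -segintZ//; apply: eq_segint => t _; rewrite Q1.
by case: (_ * (circ r t / _)) => u v /=; ring.
Qed.

End Kernel.
End Cauchy.

(** * Integrals over circles, the Cauchy kernel and Taylor expansion *)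

Section CircleMean.
Context {R : realType}.
Local Notation C := R[i].
Implicit Types (f g : C -> C) (a c z : C) (r : R).

(** Not normalised: a constant is multiplied by [2 pi]. *)
Definition cmean r g := cint (fun t => g (circ r t)).
Definition circ_dv r g := forall z, normc z = r -> cdv g z.

Let pi0 : 0 < (pi *+ 2 : R). Proof. by rewrite mulrn_wgt0// pi_gt0. Qed.

Lemma circ_cdiff2 r g t : 0 <= r -> circ_dv r g ->
  exists A B, cdiff2 (fun _ u => g (circ r u)) 0 t A B.
Proof.
move=> r0 hg; have /hg/derivable_cdiff[d dd] := normc_circ t r0.
by exists (d * 0), (d * (Complex 0 1 * circ r t)); exact: (cdiff2_comp (G := fun _ u => circ r u) dd (cdiff2_circ r 0 t)).
Qed.

Lemma circ_Re_cont r g u v : 0 <= r -> circ_dv r g ->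
  cont_on u v (fun t => complex.Re (g (circ r t))).
Proof.
by move=> r0 hg t _; have [A [B /cdiff2_Re/diff2_cont1r]] := circ_cdiff2 t r0 hg.
Qed.

Lemma circ_Im_cont r g u v : 0 <= r -> circ_dv r g ->
  cont_on u v (fun t => complex.Im (g (circ r t))).
Proof.
by move=> r0 hg t _; have [A [B /cdiff2_Im/diff2_cont1r]] := circ_cdiff2 t r0 hg.
Qed.

Lemma eq_cmean r g h : 0 <= r -> (forall z, normc z = r -> g z = h z) ->
  cmean r g = cmean r h.
Proof.
by move=> r0 gh; rewrite /cmean /cint; congr Complex; apply: eq_segint => t _;
  rewrite gh// normc_circ.
Qed.

Lemma cmeanD r g h : 0 <= r -> circ_dv r g -> circ_dv r h ->
  cmean r (fun z => g z + h z) = cmean r g + cmean r h.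
Proof.
move=> r0 hg hh; rewrite /cmean /cint.
apply/eqP; rewrite eq_complex /=; apply/andP; split; apply/eqP.
  rewrite -segintD; [|exact: circ_Re_cont|exact: circ_Re_cont].
  by apply: eq_segint => t _; case: (g _) (h _) => [u v] [u' v'].
rewrite -segintD; [|exact: circ_Im_cont|exact: circ_Im_cont].
by apply: eq_segint => t _; case: (g _) (h _) => [u v] [u' v'].
Qed.

Lemma cont_onZ u v k (h : R -> R) : cont_on u v h -> cont_on u v (fun t => k * h t).
Proof.
move=> ch t ht e e0; have k0 : 0 < `|k| + 1 by rewrite ltr_wpDl.
have [|del del0 H] := ch t ht (e / (`|k| + 1)); first by rewrite divr_gt0.
exists del => // y /H h1; rewrite -mulrBr normrM.
apply: (@le_trans _ _ ((`|k| + 1) * (e / (`|k| + 1)))); last by rewrite mulrC divfK ?gt_eqF.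
by rewrite ler_pM// lerDl.
Qed.

Lemma cmeanZ r c g : 0 <= r -> circ_dv r g ->
  cmean r (fun z => c * g z) = c * cmean r g.
Proof.
move=> r0 hg; have cR := @circ_Re_cont r g 0 (pi *+ 2) r0 hg.
have cI := @circ_Im_cont r g 0 (pi *+ 2) r0 hg.
case: c => p q; rewrite /cmean /cint.
apply/eqP; rewrite eq_complex /=; apply/andP; split; apply/eqP.
  rewrite -!segintZ// -segintB; [|exact: cont_onZ|exact: cont_onZ].
  by apply: eq_segint => t _; case: (g _) => [u v].
rewrite -!segintZ// -segintD; [|exact: cont_onZ|exact: cont_onZ].
by apply: eq_segint => t _; case: (g _) => [u v].
Qed.

Lemma cmean_cst r c : cmean r (fun=> c) = c * (pi *+ 2)%:C%C.
Proof.
rewrite /cmean /cint !segint_cst ?ltW// subr0.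
apply/eqP; rewrite eq_complex /=; case: c => u v /=.
by rewrite !mulr0 subr0 add0r !eqxx.
Qed.

Lemma cmean_sum r N (F : nat -> C -> C) : 0 <= r -> (forall n, circ_dv r (F n)) ->
  circ_dv r (fun z => \sum_(n < N) F n z) /\
  cmean r (fun z => \sum_(n < N) F n z) = \sum_(n < N) cmean r (F n).
Proof.
move=> r0 hF; elim: N => [|N [IH1 IH2]].
  split; first by move=> z _; under eq_fun do rewrite big_ord0; exact: cdv_cst.
  rewrite big_ord0 -[RHS](mul0r (pi *+ 2)%:C%C) -(cmean_cst r).
  by apply: eq_cmean => // z _; rewrite big_ord0.
split.
  move=> z hz; under eq_fun do rewrite big_ord_recr /=.
  by apply: cdvD; [exact: IH1|exact: hF].
rewrite big_ord_recr /= -IH2 -(cmeanD r0 IH1 (hF N)).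
by apply: eq_cmean => // z _; rewrite big_ord_recr.
Qed.

(** The doubling comes from estimating real and imaginary parts separately. *)
Lemma cmean_bound r g M : 0 <= r -> circ_dv r g ->
  (forall t, 0 <= t <= pi *+ 2 -> normc (g (circ r t)) <= M) ->
  normc (cmean r g) <= M * (pi *+ 2) *+ 2.
Proof.
move=> r0 hg hM; apply: le_trans (normc_le_ReIm _) _; rewrite mulr2n /=.
apply: lerD.
  have := @segint_bound _ 0 (pi *+ 2) _ 0 M (ltW pi0) (@circ_Re_cont r g 0 _ r0 hg).
  rewrite mul0r !subr0; apply => t ht; rewrite subr0.
  exact: le_trans (Re_le_normc _) (hM _ ht).
have := @segint_bound _ 0 (pi *+ 2) _ 0 M (ltW pi0) (@circ_Im_cont r g 0 _ r0 hg).
rewrite mul0r !subr0; apply => t ht; rewrite subr0.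
exact: le_trans (Im_le_normc _) (hM _ ht).
Qed.

Lemma cmean_conj r g : 0 <= r -> circ_dv r g ->
  cmean r (fun z => conjc (g z)) = conjc (cmean r g).
Proof.
move=> r0 hg; rewrite /cmean /cint /=.
apply/eqP; rewrite eq_complex /=; apply/andP; split; apply/eqP.
  by apply: eq_segint => t _; case: (g _).
rewrite -[RHS]mulN1r -segintZ; last exact: circ_Im_cont.
by apply: eq_segint => t _; case: (g _) => u v; rewrite mulN1r.
Qed.

(** This is [cauchy_kernel] at [a = 0], where the kernel [z / (z - a)] is 1. *)
Lemma cmean_pow r k : 0 < r < 1 -> cmean r (fun z => z ^+ k.+1) = 0.
Proof.
move=> /andP[r0 r1].
have := @cauchy_kernel R (fun z => z ^+ k.+1) 0 r (fun z _ => @cdvX R _ z).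
rewrite normc0 => /(_ r0 r1) h; rewrite -[RHS]h /cmean.
rewrite expr0n /=; congr cint; apply/funext => t.
by rewrite !subr0 mulfV ?mulr1// -normc_gt0 normc_circ// ltW.
Qed.

Lemma circ_dvV r k : 0 < r -> circ_dv r (fun z => z ^- k).
Proof.
move=> r0 z hz; apply: cdvV; last exact: cdvX.
by rewrite expf_neq0// -normc_gt0 hz.
Qed.

(** On the circle of radius [r], the inverse of [z] is [r ^- 2] times its conjugate, so the
    conjugate of a positive power is integrated. *)
Lemma cmean_powV r k : 0 < r < 1 -> cmean r (fun z => z ^- k.+1) = 0.
Proof.
move=> /[dup] /andP[r0 r1] r01.
rewrite (@eq_cmean _ _ (fun z => conjc ((r ^- 2 ^+ k.+1)%:C%C * z ^+ k.+1))); first 1 last.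
- exact: ltW.
- move=> z hz; have z0 : z != 0 by rewrite -normc_gt0 hz.
  have zV : z^-1 = (r ^- 2)%:C%C * conjc z.
    rewrite -hz -sqmodE; case: (z) z0 => u v z0; rewrite /sqmod /=.
    have uv : u ^+ 2 + v ^+ 2 != 0.
      by rewrite -[X in X != 0]/(sqmod (Complex u v)) sqmodE expf_neq0// gt_eqF// normc_gt0.
    apply/eqP; rewrite eq_complex /=.
    by apply/andP; split; apply/eqP; rewrite ?mul0r ?subr0 ?addr0 mulrC ?mulNr ?mulrN.
  rewrite -exprVn zV exprMn (rmorphM (@conjc R)); congr (_ * _).
    by transitivity ((r ^- 2 ^+ k.+1)%:C%C : C); [rewrite rmorphXn|exact/esym/conjc_real].
  by rewrite (rmorphXn (@conjc R)).
have dX : circ_dv r (fun z => z ^+ k.+1) by move=> z _; exact: cdvX.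
have dcX c : circ_dv r (fun z => c * z ^+ k.+1).
  by move=> z hz; apply: cdvM; [exact: cdv_cst|exact: dX].
by rewrite (cmean_conj (ltW r0) (dcX _)) (cmeanZ _ (ltW r0) dX) cmean_pow// mulr0 conjc0.
Qed.

Section Expand.
Variables (r : R) (a : C).
Hypothesis (r01 : 0 < r < 1) (ar : normc a < r).
(** The Cauchy kernel in the angular parameter: [dz / (z - a) = i K dt]. *)
Let K z := z / (z - a).

Let r0 : 0 < r. Proof. by case/andP: r01. Qed.

Let za_neq0 z : normc z = r -> z - a != 0.
Proof.
move=> hz; rewrite -normc_gt0 (lt_le_trans _ (normc_le_subD _ _))// hz subr_gt0//.
Qed.

Let K_dv : circ_dv r K.
Proof.
move=> z hz; apply: cdvM; first exact: cdv_id.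
by apply: cdvV; [exact: za_neq0|apply: cdvB; [exact: cdv_id|exact: cdv_cst]].
Qed.

Let K_bound z : normc z = r -> normc (K z) <= r / (r - normc a).
Proof.
move=> hz; rewrite normcM normcV hz ler_pM2l// lef_pV2 ?posrE ?normc_gt0 ?subr_gt0//.
  by rewrite -hz normc_le_subD.
exact: za_neq0.
Qed.

Lemma kernel_geom N z : normc z = r ->
  K z = \sum_(n < N) a ^+ n * z ^- n + a ^+ N * (z ^- N * K z).
Proof.
move=> hz; have z0 : z != 0 by rewrite -normc_gt0 hz.
have za := za_neq0 hz.
elim: N => [|N IH]; first by rewrite big_ord0 add0r !expr0 invr1 !mul1r.
rewrite big_ord_recr /= {1}IH -addrA; congr (_ + _).
rewrite /K !exprSr invfM; move: (z ^- N) (a ^+ N) => u v.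
by field; rewrite z0 za.
Qed.

Lemma cmean_kernel_expand g N : circ_dv r g ->
  cmean r (fun z => g z * K z) =
  \sum_(n < N) a ^+ n * cmean r (fun z => g z * z ^- n) +
  a ^+ N * cmean r (fun z => g z * (z ^- N * K z)).
Proof.
move=> hg; have r0' := ltW r0.
have d1 n : circ_dv r (fun z => g z * z ^- n).
  by move=> z hz; apply: cdvM; [exact: hg|exact: (@circ_dvV r n r0 z hz)].
have d2 : circ_dv r (fun z => g z * (z ^- N * K z)).
  move=> z hz; apply: cdvM; first exact: hg.
  by apply: cdvM; [exact: (@circ_dvV r N r0 z hz)|exact: K_dv].
have d3 n : circ_dv r (fun z => a ^+ n * (g z * z ^- n)).
  by move=> z hz; apply: cdvM; [exact: cdv_cst|exact: d1].
have [s1 s2] := cmean_sum N r0' d3.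
have E z : normc z = r -> g z * K z = \sum_(n < N) a ^+ n * (g z * z ^- n) +
    a ^+ N * (g z * (z ^- N * K z)).
  move=> hz; rewrite {1}(kernel_geom N hz) mulrDr mulr_sumr.
  by congr (_ + _); [apply: eq_bigr => n _|]; rewrite mulrCA.
have d4 : circ_dv r (fun z => a ^+ N * (g z * (z ^- N * K z))).
  by move=> z hz; apply: cdvM; [exact: cdv_cst|exact: d2].
rewrite (eq_cmean r0' E) (cmeanD r0' s1 d4) s2 (cmeanZ _ r0' d2); congr (_ + _).
by apply: eq_bigr => n _; exact: (cmeanZ _ r0' (d1 n)).
Qed.

Lemma cmean_tail_bound g N B : 0 <= B -> circ_dv r g ->
  (forall t, 0 <= t <= pi *+ 2 -> normc (g (circ r t)) <= B) ->
  normc (a ^+ N * cmean r (fun z => g z * (z ^- N * K z))) <=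
  (normc a / r) ^+ N * (B * (r / (r - normc a)) * (pi *+ 2) *+ 2).
Proof.
move=> B0 hg hB; rewrite normcM normcX expr_div_n -[leRHS]mulrA ler_wpM2l//.
  by rewrite exprn_ge0// normc_ge0.
apply: (@le_trans _ _ ((B * (r ^- N * (r / (r - normc a)))) * (pi *+ 2) *+ 2)).
  apply: cmean_bound; first exact: ltW.
    move=> z hz; apply: cdvM; first exact: hg.
    by apply: cdvM; [exact: (@circ_dvV r N r0 z hz)|exact: K_dv].
  move=> t ht; rewrite normcM ler_pM ?normc_ge0//; first exact: hB.
  have hc := normc_circ t (ltW r0).
  rewrite normcM normcV normcX hc ler_wpM2l ?invr_ge0 ?exprn_ge0 ?(ltW r0)//.
  exact: K_bound.
have key (b u v p : R) : b * (u * v) * p *+ 2 = u * (b * v * p *+ 2).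
  by rewrite !mulr2n; ring.
by rewrite key.
Qed.

(** In the geometric expansion of the kernel the negative powers of [z] integrate to 0, the constant
    term gives [2 pi], and the remainder decays like [(normc a / r) ^+ N]. *)
Lemma cmean_kernel : cmean r K = (pi *+ 2)%:C%C.
Proof.
apply/eqP; rewrite -subr_eq0; apply/eqP; apply: eqc_le0 => e e0.
have d1 : circ_dv r (fun=> 1) by move=> z _; exact: cdv_cst.
have q0 : 0 <= normc a / r by rewrite divr_ge0 ?normc_ge0// ltW.
have q1 : normc a / r < 1 by rewrite ltr_pdivrMr// mul1r.
set M := (1 * (r / (r - normc a)) * (pi *+ 2) *+ 2).
have M0 : 0 < M.
  by rewrite /M mul1r mulrn_wgt0// mulr_gt0// divr_gt0// subr_gt0.
have : (fun n => (normc a / r) ^+ n) @ \oo --> (0 : R).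
  by apply: cvg_expr; rewrite ger0_norm.
move=> /cvgrPdist_le /(_ (e / M)); rewrite divr_gt0// => /(_ isT) [n _ hn].
suff -> : cmean r K = (pi *+ 2)%:C%C + a ^+ n.+1 * cmean r (fun z => 1 * (z ^- n.+1 * K z)).
  rewrite addrAC subrr add0r.
  apply: le_trans (@cmean_tail_bound (fun=> 1) n.+1 1 _ d1 _) _ => //.
    by move=> t _; rewrite normc1.
  rewrite -ler_pdivlMr//; have := hn n.+1; rewrite /= sub0r normrN ger0_norm ?exprn_ge0//.
  by apply; rewrite leqnSn.
have := cmean_kernel_expand n.+1 d1.
have -> : cmean r (fun z => 1 * K z) = cmean r K.
  by apply: eq_cmean; [exact: ltW|move=> z _; rewrite mul1r].
rewrite big_ord_recl /= expr0 mul1r.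
rewrite (_ : cmean r (fun z => 1 * z ^- 0) = (pi *+ 2)%:C%C); last first.
  rewrite -[RHS]mul1r -(cmean_cst r); apply: eq_cmean; first exact: ltW.
  by move=> z _; rewrite expr0 invr1 mulr1.
rewrite big1 ?addr0; last first.
  move=> i _; rewrite (_ : cmean r _ = 0) ?mulr0// -[RHS](cmean_powV i r01).
  by apply: eq_cmean; [exact: ltW|move=> z _; rewrite mul1r].
by [].
Qed.

End Expand.

Lemma circ_bounded r g : 0 <= r -> circ_dv r g ->
  exists2 B, 0 <= B & forall t, 0 <= t <= pi *+ 2 -> normc (g (circ r t)) <= B.
Proof.
move=> r0 hg; pose F t := normc (g (circ r t)).
have cF : {within `[0, pi *+ 2], continuous F}.
  apply: continuous_in_subspaceT => t _; apply: cont1_continuous => e e0.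
  have [A [B /cdiff2_lip]] := circ_cdiff2 t r0 hg.
  set L := 1 + _ + _ => -[del del0 H].
  have L0 : 0 < L by rewrite /L -addrA ltr_pwDl// addr_ge0 ?normc_ge0.
  exists (Num.min del (e / L)); first by rewrite lt_min del0 divr_gt0.
  move=> u; rewrite lt_min => /andP[u1 u2].
  have := H 0 u; rewrite subrr normr0 => /(_ del0 u1); rewrite add0r => h.
  apply: (@le_trans _ _ (normc (g (circ r u) - g (circ r t)))).
    rewrite ler_norml; apply/andP; split; last exact: normc_le_subD.
    by rewrite -lerN2 opprK opprB (normc_distC (g (circ r u))); exact: normc_le_subD.
  by apply: le_trans h _; rewrite mulrC -ler_pdivlMr// ltW.
have [c _ hc] := EVT_max (ltW pi0) cF.
exists (F c); first exact: normc_ge0.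
by move=> t ht; apply: hc; rewrite in_itv.
Qed.

(** The Cauchy kernel is expanded on a circle of radius midway between [rho] and 1. As [r], [M] and
    [c] depend neither on [z] nor on [N], this one estimate gives both the convergence of the series
    (large [N]) and the local behaviour at 0 (fixed [N]). *)
Lemma taylor_disk f rho : (forall z, normc z < 1 -> cdv f z) -> 0 < rho < 1 ->
  exists r M (c : nat -> C), [/\ rho < r, r < 1, 0 <= M &
    forall z N, normc z <= rho ->
      normc (f z - \sum_(n < N) c n * z ^+ n) <= M * (normc z / r) ^+ N].
Proof.
move=> hf /andP[rho0 rho1]; pose r := (1 + rho) / 2.
have rr : rho < r by rewrite /r; lra.
have r1 : r < 1 by rewrite /r; lra.
have r0 : 0 < r by exact: lt_trans rr.
have r01 : 0 < r < 1 by rewrite r0.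
have hfr : circ_dv r f by move=> z hz; apply: hf; rewrite hz.
have [B B0 hB] := circ_bounded (ltW r0) hfr.
pose P := (pi *+ 2 : R); have P0 : P%:C%C != 0 :> C.
  by rewrite -normc_gt0 normcR normr_gt0 gt_eqF.
exists r, (B * (r / (r - rho)) *+ 2), (fun n => (P%:C%C)^-1 * cmean r (fun z => f z * z ^- n)).
split => //; first by rewrite mulrn_wge0// mulr_ge0// divr_ge0 ?subr_ge0// ltW.
move=> a N ha; have ar : normc a < r by exact: le_lt_trans rr.
have key : f a * P%:C%C = cmean r (fun z => f z * (z / (z - a))).
  have K_dv : circ_dv r (fun z => z / (z - a)).
    move=> z hz; apply: cdvM; first exact: cdv_id.
    apply: cdvV; last by apply: cdvB; [exact: cdv_id|exact: cdv_cst].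
    by rewrite -normc_gt0 (lt_le_trans _ (normc_le_subD _ _))// hz subr_gt0.
  have r0' := ltW r0.
  have d1 : circ_dv r (fun z => f z * (z / (z - a))).
    by move=> z hz; apply: cdvM; [exact: hfr|exact: K_dv].
  have d2 : circ_dv r (fun z => - f a * (z / (z - a))).
    by move=> z hz; apply: cdvM; [exact: cdv_cst|exact: K_dv].
  have := cauchy_kernel hf ar r1.
  rewrite (_ : cint _ = cmean r (fun z => f z * (z / (z - a)) + - f a * (z / (z - a)))).
    rewrite (cmeanD r0' d1 d2) (cmeanZ _ r0' K_dv) (cmean_kernel r01 ar) mulNr.
    by move/eqP; rewrite subr_eq0 => /eqP ->.
  by apply: (@eq_cmean r (fun z => (f z - f a) * (z / (z - a)))) => // z _; ring.
have E := cmean_kernel_expand r01 ar N hfr; rewrite -key in E.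
have -> : f a - \sum_(n < N) (P%:C%C)^-1 * cmean r (fun z => f z * z ^- n) * a ^+ n =
   (P%:C%C)^-1 * (a ^+ N * cmean r (fun z => f z * (z ^- N * (z / (z - a))))).
  rewrite -[f a](mulfK P0) E mulrDl addrAC -[RHS]add0r [X in _ + X]mulrC; congr (_ + _).
  rewrite mulr_suml; apply/eqP; rewrite subr_eq0; apply/eqP; apply: eq_bigr => n _; ring.
rewrite normcM normcV normcR gtr0_norm//.
have t := cmean_tail_bound r01 ar N B0 hfr hB.
apply: le_trans (ler_wpM2l _ t) _; first by rewrite invr_ge0 ltW.
have -> : P^-1 * ((normc a / r) ^+ N * (B * (r / (r - normc a)) * (pi *+ 2) *+ 2)) =
    B * (r / (r - normc a)) *+ 2 * (normc a / r) ^+ N.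
  have P1 : P != 0 by rewrite gt_eqF.
  have k (p u b v : R) : p != 0 -> p^-1 * (u * (b * v * p *+ 2)) = b * v *+ 2 * u.
    by move=> p0; rewrite !mulr2n; field.
  exact: k.
rewrite ler_wpM2r//; first by rewrite exprn_ge0// divr_ge0 ?normc_ge0// ltW.
rewrite lerMn2r/= ler_wpM2l// ler_pM2l// lef_pV2 ?posrE ?subr_gt0//.
by rewrite lerD2l lerN2.
Qed.

End CircleMean.

(** * Holomorphic functions on the disc *)

Section DiskHolomorphic.
Context {R : realType}.
Local Notation C := R[i].
Implicit Types (f g : C -> C) (a c z w : C).

Definition hol f := forall z, normc z < 1 -> cdv f z.

Lemma holE f : holomorphic_on_disk f <-> hol f.
Proof.
by split => h z; [rewrite -diskE|rewrite diskE]; exact: h.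
Qed.

(** The singularity of [(f z - f 0) / z] at 0 is removable: the Taylor estimate of order 3 gives the
    value [c 1] and the derivative [c 2] there. *)
Lemma hol_div f : hol f ->
  exists2 g, hol g & forall z, normc z < 1 -> f z = f 0 + z * g z.
Proof.
move=> hf; have [|r [M [c [r1 r2 M0 H]]]] := taylor_disk hf (rho := 1 / 2); first by lra.
have r0 : 0 < r by apply: lt_trans r1; lra.
have f0 : f 0 = c 0%N.
  apply/eqP; rewrite -subr_eq0; apply/eqP/eq0_normc/eqP; rewrite eq_le normc_ge0 andbT.
  have := H 0 1%N; have -> : \sum_(n < 1) c n * 0 ^+ n = c 0%N by rewrite big_ord1 mulr1.
  rewrite normc0 mul0r expr1 mulr0.
  by apply; lra.
pose g z := if z == 0 then c 1%N else (f z - f 0) / z.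
exists g; last first.
  move=> z _; rewrite /g; case: eqP => [->|/eqP z0]; first by rewrite mul0r addr0.
  by rewrite mulrC divfK// addrC subrK.
move=> z hz; have [->|z0] := eqVneq z 0; last first.
  apply: (@cdv_eq _ (fun w => (f w - f 0) * w^-1) _ _ (normc z)).
  - by rewrite normc_gt0.
  - move=> w hw; rewrite /g ifF//; apply/negbTE/eqP => w0.
    by move: hw; rewrite w0 sub0r normcN ltxx.
  - apply: cdvM; first by apply: cdvB; [exact: hf|exact: cdv_cst].
    by apply: cdvV => //; exact: cdv_id.
apply/derivable_cdiff; exists (c 2) => e e0.
exists (Num.min (1 / 2) (e * r ^+ 3 / (M + 1))).
  by rewrite lt_min !divr_gt0 ?mulr_gt0 ?exprn_gt0// ltr_wpDl.
move=> w; rewrite subr0 lt_min => /andP[w1 w2].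
rewrite /g eqxx; case: eqP => [->|/eqP w0].
  by rewrite subrr mulr0 subr0 normc0 mulr0.
have -> : (f w - f 0) / w - c 1%N - c 2 * w = (f w - \sum_(n < 3) c n * w ^+ n) / w.
  by rewrite !big_ord_recl big_ord0 /= f0 addr0 expr0 expr1; field.
have w0' : 0 < normc w by rewrite normc_gt0.
rewrite normcM normcV ler_pdivrMr//.
apply: le_trans (H w 3%N (ltW w1)) _.
rewrite expr_div_n.
have -> : M * (normc w ^+ 3 / r ^+ 3) = M * normc w / r ^+ 3 * normc w * normc w by ring.
rewrite ler_pM2r// ler_pM2r// ler_pdivrMr ?exprn_gt0//.
move: w2; rewrite ltr_pdivlMr; last by rewrite ltr_wpDl.
move=> w2; apply: le_trans (ltW w2); rewrite mulrDr mulr1 mulrC lerDl ltW//.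
Qed.

(** Taylor coefficients vanish one after the other: once the earlier ones are 0, the hypothesis and
    the Taylor estimate give [normc (c n) * x ^+ n <= L * x ^+ n.+1] for all small [x > 0]. Then
    [f z] equals its own remainder, which tends to 0. *)
Lemma hol_zero f : hol f ->
  (forall K : nat, exists B del : R, 0 < del /\
     forall z, normc z < del -> normc (f z) <= B * normc z ^+ K) ->
  forall z, normc z < 1 -> f z = 0.
Proof.
move=> hf van z hz; pose rho := Num.max (normc z) (1 / 2).
have rho01 : 0 < rho < 1.
  by rewrite lt_max gt_max hz; apply/andP; split; [apply/orP; right|]; lra.
have [r [M [c [r1 r2 M0 H]]]] := taylor_disk hf rho01.
have rho0 : 0 < rho by case/andP: rho01.
have r0 : 0 < r by apply: lt_trans r1.
have c0 n : c n = 0.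
  elim/ltn_ind: n => n IH; apply: eqc_le0 => e e0.
  have [B [del [del0 hB]]] := van n.+1.
  pose L := 1 + `|B| + M / r ^+ n.+1.
  have L0 : 0 < L.
    by rewrite /L -addrA ltr_pwDl// addr_ge0// divr_ge0// exprn_ge0// ltW.
  pose x := Num.min (Num.min (del / 2) (rho / 2)) (e / L).
  have x0 : 0 < x by rewrite !lt_min !divr_gt0.
  have x1 : x < del by rewrite !gt_min (_ : del / 2 < del)//; lra.
  have x2 : x <= rho by rewrite !ge_min (_ : rho / 2 <= rho) ?orbT//; lra.
  have x3 : x <= e / L by rewrite ge_min lexx orbT.
  have nx : normc (x%:C%C : C) = x by rewrite normcR gtr0_norm.
  have h1 := hB x%:C%C; rewrite nx in h1.
  have h2 := H x%:C%C n.+1; rewrite nx in h2.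
  have E : c n * x%:C%C ^+ n = f x%:C%C - (f x%:C%C - \sum_(k < n.+1) c k * x%:C%C ^+ k).
    rewrite opprB addrC subrK big_ord_recr /= big1 ?add0r// => k _.
    by rewrite IH ?mul0r.
  have : normc (c n) * x ^+ n <= L * x ^+ n.+1.
    rewrite -{1}nx -normcX -normcM E; apply: le_trans (normcB _ _) _.
    apply: le_trans (lerD (h1 x1) (h2 x2)) _.
    rewrite expr_div_n.
    have -> : B * x ^+ n.+1 + M * (x ^+ n.+1 / r ^+ n.+1) = (B + M / r ^+ n.+1) * x ^+ n.+1.
      by ring.
    rewrite ler_wpM2r ?exprn_ge0 ?(ltW x0)// /L -addrA.
    have := ler_norm B; lra.
  rewrite exprS mulrA ler_pM2r ?exprn_gt0// => h.
  by apply: le_trans h _; rewrite mulrC -ler_pdivlMr.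
apply: eqc_le0 => e e0.
have q0 : 0 <= normc z / r by rewrite divr_ge0 ?normc_ge0// ltW.
have zr : normc z <= rho by rewrite le_max lexx.
have q1 : normc z / r < 1 by rewrite ltr_pdivrMr// mul1r (le_lt_trans zr).
have : (fun n => (normc z / r) ^+ n) @ \oo --> (0 : R).
  by apply: cvg_expr; rewrite ger0_norm.
have M1 : 0 < M + 1 by rewrite ltr_wpDl.
move=> /cvgrPdist_le /(_ (e / (M + 1))); rewrite divr_gt0// => /(_ isT) [n _ hn].
have := H z n zr; rewrite big1 ?subr0 => [h|k _]; last by rewrite c0 mul0r.
apply: le_trans h _; have := hn n (leqnn n).
rewrite /= sub0r normrN ger0_norm ?exprn_ge0// ler_pdivlMr// => h.
by apply: le_trans h; rewrite mulrDr mulr1 mulrC lerDl exprn_ge0.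
Qed.

Lemma hol_zero_near f (eta : R) : hol f -> 0 < eta ->
  (forall z, normc z < eta -> f z = 0) -> forall z, normc z < 1 -> f z = 0.
Proof.
move=> hf e0 h; apply: hol_zero => // K; exists 0, eta; split => // z /h ->.
by rewrite normc0 mul0r.
Qed.

Lemma hol_affine f a (s : R) : hol f -> 0 < s -> normc a + s <= 1 ->
  hol (fun w => f (a + s%:C%C * w)).
Proof.
move=> hf s0 h w hw; apply: (@cdv_comp _ f (fun w => a + s%:C%C * w)).
  by apply: cdvD; [exact: cdv_cst|apply: cdvM; [exact: cdv_cst|exact: cdv_id]].
apply: hf; apply: le_lt_trans (le_normcD _ _) _; rewrite normcM normcR gtr0_norm//.
by apply: lt_le_trans h; rewrite ltrD2l -[ltRHS]mulr1 ltr_pM2l.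
Qed.

(** The affine map sending the unit disc onto the largest disc about [a] inside it reduces this to
    [a = 0]. *)
Lemma hol_zero_disk f a (eta : R) : hol f -> normc a < 1 -> 0 < eta ->
  (forall z, normc (z - a) < eta -> f z = 0) ->
  forall z, normc (z - a) < 1 - normc a -> f z = 0.
Proof.
move=> hf a1 e0 h z hz; set s := 1 - normc a in hz; have s0 : 0 < s by rewrite subr_gt0.
have sC : s%:C%C != 0 :> C by rewrite -normc_gt0 normcR gtr0_norm.
have as1 : normc a + s <= 1 by rewrite /s addrC subrK.
have E : a + s%:C%C * ((z - a) / s%:C%C) = z by rewrite mulrC divfK// addrC subrK.
have := @hol_zero_near _ (eta / s) (hol_affine hf s0 as1) _ _ ((z - a) / s%:C%C).
rewrite E; apply; first by rewrite divr_gt0.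
  move=> w hw; apply: h; rewrite addrC addKr normcM normcR gtr0_norm//.
  by rewrite mulrC -ltr_pdivlMr.
by rewrite normcM normcV normcR gtr0_norm// ltr_pdivrMr// mul1r.
Qed.

(* Discs centred on the segment from [a] to [0] reach the origin: each step enlarges the
   distance to the unit circle by a factor at least 3/2. *)
Lemma hol_identity f a (eta : R) : hol f -> normc a < 1 -> 0 < eta ->
  (forall z, normc (z - a) < eta -> f z = 0) -> forall z, normc z < 1 -> f z = 0.
Proof.
move=> hf.
have main n : forall a (eta : R), normc a < 1 -> 0 < eta ->
    1 / 2 < (3 / 2) ^+ n * (1 - normc a) ->
    (forall z, normc (z - a) < eta -> f z = 0) -> forall z, normc z < 1 -> f z = 0.
  elim: n => [|n IH] b et b1 et0 hn h.
    rewrite expr0 mul1r in hn.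
    have hb := hol_zero_disk hf b1 et0 h.
    apply: (@hol_zero_near f (1 - normc b - normc b)) => //; first lra.
    move=> z hz; apply: hb; apply: le_lt_trans (normcB _ _) _; lra.
  have hb := hol_zero_disk hf b1 et0 h.
  have [sm|big] := ltP (normc b) (1 / 2).
    apply: (@hol_zero_near f (1 - normc b - normc b)) => //; first lra.
    move=> z hz; apply: hb; apply: le_lt_trans (normcB _ _) _; lra.
  have b0 : 0 < normc b by apply: lt_le_trans big; lra.
  pose t := (1 - normc b) / 2 / normc b.
  have tb : t * normc b = (1 - normc b) / 2 by rewrite /t divfK ?gt_eqF.
  have t0 : 0 < t by rewrite !divr_gt0 ?subr_gt0.
  have t1 : t <= 1 by rewrite /t ler_pdivrMr// mul1r; lra.
  pose b' := (1 - t)%:C%C * b.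
  have nb' : normc b' = normc b - (1 - normc b) / 2.
    by rewrite normcM normcR ger0_norm ?subr_ge0// mulrBl mul1r tb.
  apply: (IH b' ((1 - normc b) / 2)); first by rewrite nb'; lra.
  - by rewrite divr_gt0// subr_gt0.
  - apply: lt_le_trans hn _; rewrite nb' exprS.
    have -> : 1 - (normc b - (1 - normc b) / 2) = 3 / 2 * (1 - normc b) by lra.
    by rewrite mulrA [_ ^+ n * _]mulrC.
  - move=> z hz; apply: hb.
    have -> : z - b = (z - b') + (b' - b) by ring.
    apply: le_lt_trans (le_normcD _ _) _.
    have -> : b' - b = - (t%:C%C * b) by rewrite /b' rmorphB rmorph1; ring.
    rewrite normcN normcM normcR gtr0_norm// tb; lra.
move=> a1 e0 h.
have s0 : 0 < 1 - normc a by rewrite subr_gt0.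
have [n hn] : exists n : nat, 1 / 2 / (1 - normc a) < (3 / 2) ^+ n.
  have [n hn] := half_pow_small 1 (e := 1 - normc a) s0.
  (* Twice as many steps are taken because [(3 / 2) ^+ 2 >= 2]. *)
  exists (n + n)%N; rewrite ltr_pdivrMr//.
  have p2 : 0 < (2 : R) ^+ n by rewrite exprn_gt0.
  move: hn; rewrite ltr_pdivrMr// => hn.
  apply: (@lt_le_trans _ _ ((1 - normc a) * 2 ^+ n)); first lra.
  rewrite mulrC ler_pM2r// exprD -exprMn lerXn2r ?nnegrE ?mulr_ge0//; lra.
by apply: (main n a eta) => //; move: hn; rewrite ltr_pdivrMr.
Qed.

Definition rootU (K : nat) : C := eit (pi *+ 2 / K%:R).

Lemma rootU_pow K : (0 < K)%N -> rootU K ^+ K = 1.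
Proof.
move=> K0; by rewrite /rootU -eitMn -[X in eit X]mulr_natr divfK ?eit2pi// pnatr_eq0 -lt0n.
Qed.

Lemma rootU_neq1 K n : (0 < n < K)%N -> rootU K ^+ n != 1.
Proof.
move=> /andP[n0 nK]; rewrite /rootU -eitMn; apply/eqP => h.
set x := pi *+ 2 / K%:R *+ n in h.
have K0 : 0 < K%:R :> R by rewrite ltr0n (ltn_trans n0).
have p0 := @pi_gt0 R.
have x0 : 0 < x / 2 by rewrite divr_gt0// mulrn_wgt0// divr_gt0// mulrn_wgt0.
have x1 : x / 2 < pi.
  rewrite ltr_pdivrMr// /x -[ltLHS]mulr_natr mulrAC ltr_pdivrMr// -[pi *+ 2]mulr_natr.
  by rewrite ltr_pM2l ?ltr_nat// mulr_gt0.
have sx : 0 < sin (x / 2) by rewrite sin_gt0_pi// x0.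
have cx : cos x = 1 by case: h.
have : cos x < 1.
  rewrite (_ : x = x / 2 + x / 2); last by lra.
  rewrite cosD; have := cos2Dsin2 (x / 2); rewrite !expr2 => hh.
  have : 0 < sin (x / 2) * sin (x / 2) by rewrite mulr_gt0.
  lra.
by rewrite cx ltxx.
Qed.

Lemma rootU_sum K n : (0 < n < K)%N -> \sum_(j < K) (rootU K ^+ j) ^+ n = 0.
Proof.
move=> nK; have K0 : (0 < K)%N by case/andP: nK => a b; exact: ltn_trans b.
under eq_bigr do rewrite exprAC.
apply: (@mulfI _ (rootU K ^+ n - 1)); first by rewrite subr_eq0 rootU_neq1.
by rewrite -subrX1 exprAC rootU_pow// expr1n subrr mulr0.
Qed.

Lemma normc_rootUX K j : normc (rootU K ^+ j) = 1.
Proof. by rewrite normcX normc_eit expr1n. Qed.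

(** Averaging over the rotations by [K]-th roots of unity cancels the Taylor terms of orders 1 to
    [K - 1], so the error is an average of remainders of order [K], uniformly small on
    [normc z <= rho]. *)
Lemma roots_average f (rho e : R) : hol f -> 0 < rho < 1 -> 0 < e ->
  exists K0 : nat, forall K z, (K0 <= K)%N -> (0 < K)%N -> normc z <= rho ->
   normc (K%:R^-1 * (\sum_(j < K) f (rootU K ^+ j * z)) - f 0) <= e.
Proof.
move=> hf /[dup] rho01 /andP[rho0 rho1] e0.
have [r [M [c [r1 r2 M0 H]]]] := taylor_disk hf rho01.
have r0 : 0 < r by apply: lt_trans r1.
have f0 : f 0 = c 0%N.
  apply/eqP; rewrite -subr_eq0; apply/eqP/eq0_normc/eqP; rewrite eq_le normc_ge0 andbT.
  have := H 0 1%N; have -> : \sum_(n < 1) c n * 0 ^+ n = c 0%N by rewrite big_ord1 mulr1.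
  rewrite normc0 mul0r expr1 mulr0.
  by apply; exact: ltW.
have q0 : 0 <= rho / r by rewrite divr_ge0// ltW.
have q1 : rho / r < 1 by rewrite ltr_pdivrMr// mul1r.
have : (fun n => (rho / r) ^+ n) @ \oo --> (0 : R).
  by apply: cvg_expr; rewrite ger0_norm.
have M1 : 0 < M + 1 by rewrite ltr_wpDl.
move=> /cvgrPdist_le /(_ (e / (M + 1))); rewrite divr_gt0// => /(_ isT) [n _ hn].
exists n => K z nK K0 hz.
have KC : K%:R != 0 :> C by rewrite pnatr_eq0 -lt0n.
have E : c 0%N = K%:R^-1 * \sum_(j < K) \sum_(k < K) c k * (rootU K ^+ j * z) ^+ k.
  rewrite exchange_big /=.
  case: K K0 KC {nK} => // K _ KC.
  rewrite big_ord_recl /= [X in _ + X]big1 ?addr0; last first.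
    move=> k _; under eq_bigr do rewrite exprMn mulrCA.
    by rewrite -mulr_suml rootU_sum ?mul0r// /bump /= add1n !ltnS ltn_ord.
  under eq_bigr do rewrite expr0 mulr1.
  by rewrite sumr_const card_ord -[X in _ * X]mulr_natl mulKf.
rewrite f0 {}E -mulrBr -sumrB normcM normcV.
have -> : normc (K%:R : C) = K%:R by rewrite -(rmorph_nat (real_complex R)) normcR normr_nat.
have KR : 0 < K%:R :> R by rewrite ltr0n.
rewrite -ler_pdivlMl ?invr_gt0// invrK.
apply: le_trans (normc_sum _ _) _.
have -> : K%:R * e = \sum_(j < K) e by rewrite sumr_const card_ord mulr_natl.
apply: ler_sum => j _.
have nz : normc (rootU K ^+ j * z) = normc z by rewrite normcM normc_rootUX mul1r.
have h := H (rootU K ^+ j * z) K; rewrite nz in h.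
apply: le_trans (h hz) _.
have := hn K nK; rewrite /= sub0r normrN ger0_norm ?exprn_ge0// ler_pdivlMr// => h2.
apply: le_trans h2; rewrite mulrDr mulr1.
apply: (@le_trans _ _ (M * (rho / r) ^+ K)); last by rewrite mulrC lerDl exprn_ge0.
rewrite ler_wpM2l// lerXn2r ?nnegrE// ?divr_ge0 ?normc_ge0 ?(ltW r0) ?(ltW rho0)//.
by rewrite ler_pM2r ?invr_gt0.
Qed.

End DiskHolomorphic.

(** * The Bergman space *)

Section DiskMeasure.
Context {R : realType}.
Local Notation C := R[i].
Local Notation D := (@diskR2 R).
Local Notation mu := (@leb2 R).
Implicit Types (f g : C -> C) (p q : R * R).

(** A set open in the sup norm is the union of the boxes with rational corners that it contains, a
    countable family of measurable sets. *)
Lemma box_open_measurable (A : set (R * R)) :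
  (forall p, A p -> exists2 e : R, 0 < e &
     forall q, `|q.1 - p.1| < e -> `|q.2 - p.2| < e -> A q) -> measurable A.
Proof.
move=> oA.
pose B (i : (rat * rat) * (rat * rat)) : set (R * R) :=
  `]ratr i.1.1, ratr i.1.2[ `*` `]ratr i.2.1, ratr i.2.2[.
pose F i : set (R * R) := if `[< B i `<=` A >] then B i else set0.
rewrite (_ : A = \bigcup_i F i).
  apply: countable_bigcupT_measurable => // i; rewrite /F; case: ifP => // _.
  by apply: measurableX; exact: measurable_itv.
apply/seteqP; split => [p Ap|p [i _]]; last by rewrite /F; case: asboolP => // h; exact: h.
have [e e0 he] := oA _ Ap.
have rr (x : R) : exists q1 q2 : rat, [/\ x - e < ratr q1, ratr q1 < x, x < ratr q2 & ratr q2 < x + e].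
  have [|q1] := @rat_in_itvoo R (x - e) x; first by rewrite gtrBl.
  have [|q2] := @rat_in_itvoo R x (x + e); first by rewrite ltrDl.
  by rewrite !in_itv /= => /andP[a b] /andP[c d]; exists q1, q2.
have [a1 [b1 [h1 h2 h3 h4]]] := rr p.1; have [a2 [b2 [k1 k2 k3 k4]]] := rr p.2.
exists ((a1, b1), (a2, b2)) => //; rewrite /F; case: asboolP => [_|[]].
  by rewrite /B; split; rewrite /= in_itv /= ?h2 ?h3 ?k2 ?k3.
move=> q [/=]; rewrite !in_itv /= => /andP[x1 x2] /andP[y1 y2].
by apply: he; rewrite ltr_norml; lra.
Qed.

Lemma diskR2E p : D p <-> normc (cplx p) < 1.
Proof. by rewrite -diskE inE. Qed.

Lemma normc_cplxB p q : normc (cplx q - cplx p) <= `|q.1 - p.1| + `|q.2 - p.2|.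
Proof. exact: le_trans (normc_le_ReIm _) _. Qed.

Lemma cplx_surj (z : C) : exists p, cplx p = z.
Proof. by case: z => a b; exists (a, b). Qed.

Lemma diskR2_box p : D p -> exists2 e : R, 0 < e &
  forall q, `|q.1 - p.1| < e -> `|q.2 - p.2| < e -> D q.
Proof.
move=> /diskR2E h; exists ((1 - normc (cplx p)) / 2); first by rewrite divr_gt0// subr_gt0.
move=> q h1 h2; apply/diskR2E; rewrite -(subrK (cplx p) (cplx q)).
apply: le_lt_trans (le_normcD _ _) _; have := normc_cplxB p q; lra.
Qed.

Lemma diskR2_measurable : measurable D.
Proof. by apply: box_open_measurable => p /diskR2_box. Qed.

Lemma measurable_disk_cont (g : C -> R) :
  (forall z, normc z < 1 -> forall e : R, 0 < e -> exists2 del : R, 0 < del &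
     forall w, normc (w - z) < del -> `|g w - g z| <= e) ->
  measurable_fun D (fun p => g (cplx p)).
Proof.
move=> cg mD; apply: (measurability _ (RGenOInfty.measurableE R)) => //.
move=> /= _ [_ [x ->] <-]; apply: box_open_measurable => p [Dp].
rewrite /= in_itv /= andbT => xg.
have [|d d0 hd] := cg _ (proj1 (diskR2E p) Dp) ((g (cplx p) - x) / 2); first by rewrite divr_gt0// subr_gt0.
have [e e0 he] := diskR2_box Dp.
exists (Num.min e (d / 2)); first by rewrite lt_min e0 divr_gt0.
move=> q; rewrite !lt_min => /andP[q1 q2] /andP[q3 q4]; split; first exact: he.
rewrite /= in_itv /= andbT.
have : normc (cplx q - cplx p) < d by have := normc_cplxB p q; lra.
by move/hd; rewrite ler_norml; lra.
Qed.

Lemma hol_Re_measurable f : hol f -> measurable_fun D (fun p => complex.Re (f (cplx p))).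
Proof.
move=> hf; apply: (@measurable_disk_cont (fun z => complex.Re (f z))) => z /hf/cdv_cont h e /h[d d0 hd].
exists d => // w /hd h'; apply: le_trans h'.
have -> : complex.Re (f w) - complex.Re (f z) = complex.Re (f w - f z).
  by case: (f w) (f z) => [a b] [c k].
exact: Re_le_normc.
Qed.

Lemma hol_Im_measurable f : hol f -> measurable_fun D (fun p => complex.Im (f (cplx p))).
Proof.
move=> hf; apply: (@measurable_disk_cont (fun z => complex.Im (f z))) => z /hf/cdv_cont h e /h[d d0 hd].
exists d => // w /hd h'; apply: le_trans h'.
have -> : complex.Im (f w) - complex.Im (f z) = complex.Im (f w - f z).
  by case: (f w) (f z) => [a b] [c k].
exact: Im_le_normc.
Qed.

Lemma hol_sqmod_measurable f : hol f -> measurable_fun D (fun p => sqmod (f (cplx p))).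
Proof.
by move=> hf; rewrite /sqmod; apply: measurable_funD; apply: measurable_funX;
  [exact: hol_Re_measurable|exact: hol_Im_measurable].
Qed.

Lemma hol_sqmod_emeasurable f : hol f ->
  measurable_fun D (fun p => (sqmod (f (cplx p)))%:E).
Proof.
move=> hf; have h := hol_sqmod_measurable hf.
exact: (proj2 (measurable_EFinP D (fun p => sqmod (f (cplx p)))) h).
Qed.

Lemma leb2_disk_fin : (mu D < +oo)%E.
Proof.
apply: (@le_lt_trans _ _ (mu (`[-1, 1] `*` `[-1, 1]))).
  apply: le_measure; rewrite ?inE.
  - exact: diskR2_measurable.
  - by apply: measurableX; exact: measurable_itv.
  - move=> p /diskR2E h; have := le_lt_trans (Re_le_normc _) h.
    have := le_lt_trans (Im_le_normc _) h.
    by rewrite /= !in_itv /= !ltr_norml => h1 h2; split; lra.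
rewrite /leb2 product_measure1E; [|exact: measurable_itv|exact: measurable_itv].
by rewrite /= lebesgue_measure_itv /= lte_fin ifT -?EFinB -?EFinM ?ltey//; lra.
Qed.

Lemma cst_integrable (c : R) : mu.-integrable D (fun=> c%:E).
Proof.
apply: (@measurable_bounded_integrable _ _ _ _ (fun=> c)).
- exact: diskR2_measurable.
- exact: leb2_disk_fin.
- exact: measurable_cst.
- by exists `|c|; split => [|x cx p _]; [exact: num_real|exact: ltW].
Qed.

Lemma bergman_hol f : f \in @bergman R -> hol f.
Proof. by rewrite inE => -[/holE]. Qed.

Lemma bergman_integrable f : f \in @bergman R ->
  mu.-integrable D (fun p => (sqmod (f (cplx p)))%:E).
Proof. by rewrite inE => -[_]; rewrite inE => -[_ []]. Qed.

Lemma bergman_dom f (G : R * R -> R) : hol f -> mu.-integrable D (fun p => (G p)%:E) ->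
  (forall p, D p -> sqmod (f (cplx p)) <= G p) -> f \in @bergman R.
Proof.
move=> hf iG le; rewrite inE; split; first exact/holE.
rewrite inE; split; first exact: hol_Re_measurable.
split; first exact: hol_Im_measurable.
apply: le_integrable iG; first exact: diskR2_measurable.
  exact: hol_sqmod_emeasurable.
move=> p Dp; rewrite !abse_EFin lee_fin ger0_norm; last by rewrite sqmodE exprn_ge0 ?normc_ge0.
exact: le_trans (le _ Dp) (ler_norm _).
Qed.

(** A single domination serves sums, products with bounded functions and division by [z]; the
    summand 1, integrable as the disc has finite measure, absorbs the constant [f 0] in the last
    case. *)
Lemma bergman_lin (k : R) f g h : hol h -> f \in @bergman R -> g \in @bergman R ->
  (forall z, normc z < 1 -> sqmod (h z) <= k * (1 + (sqmod (f z) + sqmod (g z)))) ->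
  h \in @bergman R.
Proof.
move=> hh /bergman_integrable fi /bergman_integrable gi le.
apply: (@bergman_dom _ (fun p => k * (1 + (sqmod (f (cplx p)) + sqmod (g (cplx p)))))) => //.
  have -> : (fun p => (k * (1 + (sqmod (f (cplx p)) + sqmod (g (cplx p)))))%:E) =
    (fun p => k%:E * ((fun=> 1%:E) \+ ((fun p => (sqmod (f (cplx p)))%:E) \+
       (fun p => (sqmod (g (cplx p)))%:E))) p)%E by [].
  have mD := diskR2_measurable.
  apply: integrableZl => //; apply: integrableD => //; first exact: cst_integrable.
  exact: integrableD.
by move=> p /diskR2E; exact: le.
Qed.

Lemma sqmodD_le (u v : C) : sqmod (u + v) <= 2 * (sqmod u + sqmod v).
Proof. case: u v => [a b] [c d]; rewrite /sqmod /=.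
have := sqr_ge0 (a - c); have := sqr_ge0 (b - d); rewrite !expr2; nra.
Qed.

Lemma bergman_axpy (c : C) f g : f \in @bergman R -> g \in @bergman R ->
  (fun z => c * f z + g z) \in @bergman R.
Proof.
move=> Bf Bg; have hf := bergman_hol Bf; have hg := bergman_hol Bg.
apply: (@bergman_lin (2 * (1 + sqmod c)) f g _ _ Bf Bg).
  by move=> z hz; apply: cdvD; [apply: cdvM; [exact: cdv_cst|exact: hf]|exact: hg].
move=> z _; apply: le_trans (sqmodD_le _ _) _; rewrite -mulrA ler_pM2l//.
rewrite !sqmodE normcM exprMn.
have := sqr_ge0 (normc c); have := sqr_ge0 (normc (f z)); have := sqr_ge0 (normc (g z)).
move: (normc c ^+ 2) (normc (f z) ^+ 2) (normc (g z) ^+ 2) => x y w; nra.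
Qed.

Lemma bergmanM b (K : R) f : hol b -> (forall z, normc z < 1 -> normc (b z) <= K) ->
  f \in @bergman R -> (fun z => b z * f z) \in @bergman R.
Proof.
move=> hb bK Bf; have hf := bergman_hol Bf.
apply: (@bergman_lin (K ^+ 2) f f _ _ Bf Bf).
  by move=> z hz; apply: cdvM; [exact: hb|exact: hf].
move=> z hz; rewrite !sqmodE normcM exprMn.
have bz := normc_ge0 (b z); have := bK _ hz => bz'.
have K2 : normc (b z) ^+ 2 <= K ^+ 2 by rewrite lerXn2r// nnegrE (le_trans bz).
have := sqr_ge0 (normc (f z)); have := sqr_ge0 (normc (b z)); move: K2.
move: (normc (b z) ^+ 2) (normc (f z) ^+ 2) (K ^+ 2) => x y w; nra.
Qed.

Lemma bergman_cst (c : C) : (fun=> c) \in @bergman R.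
Proof.
apply: (@bergman_dom _ (fun=> sqmod c)); first by move=> z _; exact: cdv_cst.
  exact: cst_integrable.
by move=> p _.
Qed.

Lemma bergman_expr n : (fun z : C => z ^+ n) \in @bergman R.
Proof.
have -> : (fun z : C => z ^+ n) = (fun z => z ^+ n * (fun=> 1) z).
  by apply/funext => z; rewrite mulr1.
apply: (@bergmanM _ 1); last exact: bergman_cst.
  by move=> z _; exact: cdvX.
by move=> z hz; rewrite normcX exprn_ile1 ?normc_ge0// ltW.
Qed.

Lemma intD_sqmod_ge0 f : 0 <= intD (fun p => sqmod (f (cplx p))).
Proof.
rewrite /intD mulr_ge0// ?invr_ge0 ?pi_ge0// Rintegral_ge0// => p _.
by rewrite sqmodE exprn_ge0// normc_ge0.
Qed.

Lemma sqr_normD f : normD f ^+ 2 = intD (fun p => sqmod (f (cplx p))).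
Proof. by rewrite /normD sqr_sqrtr// intD_sqmod_ge0. Qed.

Lemma normD_ge0 f : 0 <= normD f. Proof. exact: sqrtr_ge0. Qed.

Lemma eqD_normD f g : eqD f g -> normD f = normD g.
Proof.
move=> fg; rewrite /normD /intD; congr (Num.sqrt (_ * _)); apply: eq_Rintegral => p.
by rewrite inE => /diskR2E; rewrite -diskE => /fg ->.
Qed.

(** If [f z] were nonzero, [normc f] would exceed half its value at [z] on a small square, which has
    positive measure. *)
Lemma bergman_int0 f : f \in @bergman R -> intD (fun p => sqmod (f (cplx p))) = 0 ->
  eqD f (fun=> 0).
Proof.
move=> Bf int0 z; rewrite diskE => hz; have hf := bergman_hol Bf.
apply: contrapT => /eqP fz; have f0 : 0 < normc (f z) by rewrite normc_gt0.
have [|d d0 hd] := cdv_cont (hf _ hz) (e := normc (f z) / 2); first by rewrite divr_gt0.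
have [p pz] := cplx_surj z.
have [|e e0 he] := @diskR2_box p; first by apply/diskR2E; rewrite pz.
pose s := Num.min e (d / 2); have s0 : 0 < s by rewrite lt_min e0 divr_gt0.
pose Q : set (R * R) := `]p.1 - s, p.1 + s[ `*` `]p.2 - s, p.2 + s[.
have mQ : measurable Q by apply: measurableX; exact: measurable_itv.
have inQ q : Q q -> D q /\ normc (cplx q - z) < d.
  move=> [/=]; rewrite !in_itv /= => q1 q2.
  have : s <= e by rewrite ge_min lexx.
  have : s <= d / 2 by rewrite ge_min lexx orbT.
  move=> s1 s2; split; first by apply: he; rewrite ltr_norml; lra.
  rewrite -pz; apply: le_lt_trans (normc_cplxB p q) _.
  have : `|q.1 - p.1| < s by rewrite ltr_norml; lra.
  have : `|q.2 - p.2| < s by rewrite ltr_norml; lra.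
  lra.
pose c := (normc (f z) / 2) ^+ 2; have c0 : 0 < c by rewrite exprn_gt0// divr_gt0.
have mf := hol_sqmod_emeasurable hf.
have f_ge0 q : 0 <= sqmod (f (cplx q)) by rewrite sqmodE exprn_ge0// normc_ge0.
have low : (c%:E * mu Q <= \int[mu]_(q in D) (sqmod (f (cplx q)))%:E)%E.
  rewrite -integral_cst//; apply: (@le_trans _ _ (\int[mu]_(q in Q) (sqmod (f (cplx q)))%:E)%E).
    apply: (@ge0_le_integral _ _ _ mu Q mQ).
    - by move=> q _; rewrite lee_fin ltW.
    - exact: measurable_cst.
    - apply: measurable_funS mf; first exact: diskR2_measurable.
      by move=> q /inQ[].
    - move=> q /inQ[_ /hd h]; rewrite lee_fin sqmodE lerXn2r ?nnegrE ?normc_ge0 ?divr_ge0//.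
        exact: normc_ge0.
      have := normc_le_subD (f z) (f (cplx q)); rewrite normc_distC => h2.
      have := le_trans h2 h; lra.
  apply: (@ge0_subset_integral _ _ _ mu Q D mQ diskR2_measurable _ mf) => q; first by rewrite lee_fin.
  by move=> /inQ[].
have : (0 < \int[mu]_(q in D) (sqmod (f (cplx q)))%:E)%E.
  apply: lt_le_trans low; rewrite mule_gt0// ?lte_fin//.
  rewrite /leb2 product_measure1E; [|exact: measurable_itv|exact: measurable_itv].
  rewrite /= !lebesgue_measure_itv /= !lte_fin !ifT; [|lra|lra].
  rewrite -!EFinB -EFinM lte_fin mulr_gt0//; lra.
have fin := @integrable_fin_num _ _ _ mu D diskR2_measurable _ (bergman_integrable Bf).
move: int0; rewrite /intD => /eqP; rewrite mulf_eq0 invr_eq0 gt_eqF ?pi_gt0//= => /eqP.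
by rewrite /Rintegral => h; rewrite -(fineK fin) h lte_fin ltxx.
Qed.

Lemma bergman_normD0 f : f \in @bergman R -> normD f <= 0 -> eqD f (fun=> 0).
Proof.
move=> Bf n0; apply: bergman_int0 => //; rewrite -sqr_normD.
have -> : normD f = 0 by apply/eqP; rewrite eq_le n0 normD_ge0.
by rewrite expr0n.
Qed.

(** Since [u] itself meets the specification of the projection, the chosen function meets it too;
    their difference lies in the Bergman space and is orthogonal to itself. *)
Lemma bergman_projE u : u \in @bergman R -> eqD (bergman_proj u) u.
Proof.
move=> Bu; rewrite /bergman_proj; set P := (X in xget _ X).
have [Bg hg] : P (xget (fun=> 0) P).
  apply: xgetPex; exists u; split => // k _; rewrite /ipD /intD.
  by congr Complex; under eq_Rintegral do rewrite /= subrr mul0r /=;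
    rewrite Rintegral_cst ?mul0r ?mulr0//; exact: diskR2_measurable.
set g := xget _ _ in Bg hg *.
have Bk : (fun z => (-1) * g z + u z) \in @bergman R by exact: bergman_axpy.
have := hg _ Bk => /eqP; rewrite eq_complex /= => /andP[/eqP h _].
have k0 : eqD (fun z => (-1) * g z + u z) (fun=> 0).
  apply: bergman_int0 => //; rewrite -[RHS]h /intD; congr (_ * _).
  apply: eq_Rintegral => p _ /=.
  have -> : -1 * g (cplx p) + u (cplx p) = u (cplx p) - g (cplx p) by ring.
  by case: (u _ - g _) => a b; rewrite /sqmod /=; ring.
move=> z /k0 /eqP; rewrite mulN1r addrC subr_eq0 => /eqP ->//.
Qed.

End DiskMeasure.

(** * Rotation invariance and moments *)

Section Rotation.
Context {R : realType}.
Local Notation C := R[i].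
Local Notation T1 := (measurableTypeR R).
Local Notation T2 := (T1 * T1)%type.
Local Notation lam := (@lebesgue_measure R).
Local Notation D := (@diskR2 R).
Local Notation mu := (@leb2 R).

Definition shiftr (a : R) : T1 -> T1 := fun x => x + a.

Lemma measurable_shift (a : R) : measurable_fun [set: T1] (shiftr a).
Proof. by apply: measurable_funD; [exact: measurable_id|exact: measurable_cst]. Qed.

Lemma lebesgue_measure_shift (a : R) (A : set T1) : measurable A ->
  pushforward lam (shiftr a) A = lam A.
Proof.
move=> mA; apply/esym; have m := measurable_shift a.
apply: (@lebesgue_measure_unique R (pushforward lam ((shiftr a)))) => //=.
move=> _ [[u v]] _ <-.
rewrite /pushforward (_ : _ @^-1` _ = `]u - a, v - a]%classic).
  by rewrite !lebesgue_measure_itv /= !lte_fin ltrD2r -!EFinB opprB addrA subrK.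
by apply/seteqP; split => x /=; rewrite !in_itv /= ltrBlDr lerBrDr.
Qed.

Lemma integral_shift (a : R) (f : T1 -> \bar R) : measurable_fun setT f ->
  (forall x, 0 <= f x)%E -> (\int[lam]_x f (shiftr a x) = \int[lam]_x f x)%E.
Proof.
move=> mf f0.
transitivity (\int[lam]_(x in shiftr a @^-1` setT) (f \o shiftr a) x)%E.
  by rewrite preimage_setT.
rewrite -(ge0_integral_pushforward (measurable_shift a))//.
apply: eq_measure_integral; first exact: measurable_shift.
by move=> mm A mA _ /=; rewrite -[RHS](lebesgue_measure_shift a).
Qed.

Lemma measurable_shearx (a : R) :
  measurable_fun [set: T2] ((fun p => (p.1 + a * p.2, p.2)) : T2 -> T2).
Proof.
apply: measurable_fun_pair; last exact: measurable_snd.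
apply: measurable_funD; first exact: measurable_fst.
by apply: measurable_funM; [exact: measurable_cst|exact: measurable_snd].
Qed.

Lemma measurable_sheary (a : R) :
  measurable_fun [set: T2] ((fun p => (p.1, p.2 + a * p.1)) : T2 -> T2).
Proof.
apply: measurable_fun_pair; first exact: measurable_fst.
apply: measurable_funD; first exact: measurable_snd.
by apply: measurable_funM; [exact: measurable_cst|exact: measurable_fst].
Qed.

Lemma integral_shearx (a : R) (f : T2 -> \bar R) : measurable_fun setT f ->
  (forall p, 0 <= f p)%E -> (\int[mu]_p f (p.1 + a * p.2, p.2)%R = \int[mu]_p f p)%E.
Proof.
move=> mf f0; have mfs := measurableT_comp mf (measurable_shearx a).
have L := @fubini_tonelli2 _ _ _ _ _ lam lam _ mfs (fun p => f0 _).
have M := @fubini_tonelli2 _ _ _ _ _ lam lam _ mf f0.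
apply: (etrans L); apply: etrans (esym M).
apply: eq_integral => y _; rewrite /fubini_G /=.
apply: (@integral_shift (a * y) (fun x => f (x, y))) => //.
exact: measurable_fun_pair1.
Qed.

Lemma integral_sheary (a : R) (f : T2 -> \bar R) : measurable_fun setT f ->
  (forall p, 0 <= f p)%E -> (\int[mu]_p f (p.1, p.2 + a * p.1)%R = \int[mu]_p f p)%E.
Proof.
move=> mf f0; have mfs := measurableT_comp mf (measurable_sheary a).
have L := @fubini_tonelli1 _ _ _ _ _ lam lam _ mfs (fun p => f0 _).
have M := @fubini_tonelli1 _ _ _ _ _ lam lam _ mf f0.
apply: (etrans L); apply: etrans (esym M).
apply: eq_integral => x _; rewrite /fubini_F /=.
apply: (@integral_shift (a * x) (fun y => f (x, y))) => //.
exact: measurable_fun_pair2.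
Qed.

(* A rotation by an angle other than pi is a product of three shears. *)
Lemma integral_rotation (c s : R) (f : T2 -> \bar R) : c ^+ 2 + s ^+ 2 = 1 -> 1 + c != 0 ->
  measurable_fun setT f -> (forall p, 0 <= f p)%E ->
  (\int[mu]_p f (c * p.1 - s * p.2, s * p.1 + c * p.2)%R = \int[mu]_p f p)%E.
Proof.
(* For the angle [theta], [t = - tan (theta / 2)]: the shears are by [t] in x, by [s] in y and again
   by [t] in x. *)
move=> cs c1 mf f0; pose t := - (s / (1 + c)).
rewrite -(integral_shearx t mf f0).
have m1 := measurableT_comp mf (measurable_shearx t).
rewrite -(@integral_sheary s _ m1); last by move=> p; exact: f0.
have m2 := measurableT_comp m1 (measurable_sheary s).
rewrite -(@integral_shearx t _ m2); last by move=> p; exact: f0.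
apply: eq_integral => -[x y] _ /=; congr (f (_, _)); rewrite /t.
  have s2 : s ^+ 2 = 1 - c ^+ 2 by rewrite -cs; ring.
  apply: (mulfI c1); apply: (mulfI c1).
  have -> : (1 + c) * ((1 + c) * (x + - (s / (1 + c)) * y +
    - (s / (1 + c)) * (y + s * (x + - (s / (1 + c)) * y)))) =
    (1 + c) * ((1 + c) * x - s * y - s * y - s ^+ 2 * x) + s ^+ 2 * (s * y) by field.
  by rewrite s2; ring.
have s2 : s ^+ 2 = 1 - c ^+ 2 by rewrite -cs; ring.
apply: (mulfI c1).
have -> : (1 + c) * (y + s * (x + - (s / (1 + c)) * y)) =
  (1 + c) * (y + s * x) - s ^+ 2 * y by field.
by rewrite s2; ring.
Qed.

Lemma disk_integral_rot (w : C) (phi : C -> R) : normc w = 1 -> 1 + complex.Re w != 0 ->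
  measurable_fun D (fun p => phi (cplx p)) -> (forall z, 0 <= phi z) ->
  (\int[mu]_(p in D) (phi (w * cplx p))%:E = \int[mu]_(p in D) (phi (cplx p))%:E)%E.
Proof.
move=> w1 w2 mphi phi0.
have mD := @diskR2_measurable R.
pose F : T2 -> \bar R := (fun p => (phi (cplx p))%:E) \_ D.
have mF : measurable_fun setT F.
  apply/(measurable_restrictT _ mD).
  exact: (proj2 (measurable_EFinP D (fun p => phi (cplx p))) mphi).
have F0 p : (0 <= F p)%E by rewrite /F patchE; case: ifP => // _; rewrite lee_fin.
rewrite integral_mkcond [RHS]integral_mkcond -/F.
case: w w1 w2 => c s w1 /= w2.
have cs : c ^+ 2 + s ^+ 2 = 1.
  by rewrite -[LHS]/(sqmod (Complex c s)) sqmodE w1 expr1n.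
rewrite -(integral_rotation cs w2 mF F0); apply: eq_integral => -[x y] _.
have E : cplx (c * x - s * y, s * x + c * y) = Complex c s * cplx (x, y).
  by rewrite /cplx /=; congr Complex; rewrite addrC.
rewrite /F /= !patchE E.
suff -> : ((x, y) \in D) = ((c * x - s * y, s * x + c * y) \in D) by [].
apply/idP/idP; rewrite !inE => /diskR2E h; apply/diskR2E; move: h; rewrite E normcM w1 mul1r//.
Qed.

(** For [K > 2] the angle [2 pi / K] is less than [pi], so the rotation is a product of shears; its
    powers are reached by iteration. *)
Lemma disk_integral_rootU (f : C -> C) K j : hol f -> (2 < K)%N ->
  (\int[mu]_(p in D) (sqmod (f (rootU K ^+ j * cplx p)))%:E =
   \int[mu]_(p in D) (sqmod (f (cplx p)))%:E)%E.
Proof.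
move=> hf K2; elim: j => [|j IH].
  by apply: eq_integral => p _; rewrite expr0 mul1r.
rewrite -IH.
have h w : normc w = 1 -> hol (fun z => f (w * z)).
  move=> w1 z hz; apply: (@cdv_comp _ f (fun z => w * z)).
    by apply: cdvM; [exact: cdv_cst|exact: cdv_id].
  by apply: hf; rewrite normcM w1 mul1r.
rewrite -(@disk_integral_rot (rootU K) (fun z => sqmod (f (rootU K ^+ j * z)))).
- by apply: eq_integral => p _; rewrite exprSr mulrA.
- exact: normc_eit.
- rewrite /=; apply: lt0r_neq0; set x := pi *+ 2 / K%:R.
  have K0 : 0 < K%:R :> R by rewrite ltr0n (ltn_trans _ K2).
  have p0 := @pi_gt0 R.
  have x0 : 0 < x by rewrite divr_gt0// mulrn_wgt0.
  have x1 : x < pi by rewrite /x ltr_pdivrMr// -[ltLHS]mulr_natr ltr_pM2l// ltr_nat.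
  have : cos pi < cos x by rewrite ltr_cos// in_itv /= ?(ltW x0) ?(ltW x1) ?pi_ge0 ?lexx.
  by rewrite cospi; lra.
- exact: (hol_sqmod_measurable (h _ (normc_rootUX _ _))).
- by move=> z; rewrite sqmodE exprn_ge0// normc_ge0.
Qed.

End Rotation.

(** * Norms of monomials and the lower bound by the leading Taylor coefficient *)

Section Moments.
Context {R : realType}.
Local Notation C := R[i].
Local Notation D := (@diskR2 R).
Local Notation mu := (@leb2 R).
Implicit Types (F G : C -> C).

Lemma sqmod_ge0 (z : C) : 0 <= sqmod z.
Proof. by rewrite sqmodE exprn_ge0// normc_ge0. Qed.

Lemma sqmodM (z w : C) : sqmod (z * w) = sqmod z * sqmod w.
Proof. by rewrite !sqmodE normcM exprMn. Qed.

(** Convexity by supporting planes: [tr] is the affine minorant of [sqmod] touching it at the mean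
    [m], and its sum over the [a j] is [K * sqmod m]. *)
Lemma sqmod_mean K (a : nat -> C) : (0 < K)%N ->
  sqmod (K%:R^-1 * \sum_(j < K) a j) <= K%:R^-1 * \sum_(j < K) sqmod (a j).
Proof.
move=> K0; set m := _ * \sum_(j < K) a j.
have KC : K%:R != 0 :> C by rewrite pnatr_eq0 -lt0n.
have KR : 0 < K%:R :> R by rewrite ltr0n.
have mE : \sum_(j < K) a j = K%:R * m by rewrite /m mulVKf.
rewrite -ler_pdivrMl ?invr_gt0// invrK.
pose tr (z : C) : R := 2 * (complex.Re z * complex.Re m + complex.Im z * complex.Im m) - sqmod m.
apply: (@le_trans _ _ (\sum_(j < K) tr (a j))); last first.
  apply: ler_sum => j _; have := sqmod_ge0 (a j - m).
  by rewrite /tr /sqmod; case: (a j) m {mE tr} => [u v] [u' v'] /=; nra.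
rewrite le_eqVlt; apply/orP; left; apply/eqP.
rewrite /tr sumrB sumr_const card_ord -mulr_sumr big_split /= -!mulr_suml.
have E1 : \sum_(j < K) complex.Re (a j) = complex.Re (\sum_(j < K) a j).
  by apply/esym; apply: (big_morph _ (id1 := 0) (op1 := +%R)) => // -[? ?] [? ?].
have E2 : \sum_(j < K) complex.Im (a j) = complex.Im (\sum_(j < K) a j).
  by apply/esym; apply: (big_morph _ (id1 := 0) (op1 := +%R)) => // -[? ?] [? ?].
rewrite E1 E2 mE -[X in _ - X]mulr_natl.
have -> : (K%:R : C) = (K%:R)%:C%C by rewrite rmorph_nat.
by rewrite /sqmod; case: m {mE tr E1 E2} => u v /=; ring.
Qed.

Lemma limn_einf_le (u : nat -> \bar R) (c : \bar R) : (forall n, u n <= c)%E ->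
  (limn_einf u <= c)%E.
Proof.
move=> uc; rewrite limn_einf_lim; apply: lime_le; first exact: is_cvg_einfs.
apply: nearW => n; apply: le_trans (uc n).
by apply: ereal_inf_lbound; exists n => /=.
Qed.

Lemma cvg_normc_sqmod (u : nat -> C) l :
  (forall e : R, 0 < e -> exists n0, forall n, (n0 <= n)%N -> normc (u n - l) <= e) ->
  (fun n => sqmod (u n)) @ \oo --> sqmod l.
Proof.
move=> h; have c1 : (fun n => normc (u n)) @ \oo --> normc l.
  apply/cvgrPdist_le => /= e /h[n0 hn]; exists n0 => // n /= /hn.
  apply: le_trans; rewrite ler_norml; apply/andP; split.
    by rewrite -lerN2 opprK opprB; exact: normc_le_subD.
  by rewrite normc_distC; exact: normc_le_subD.
under eq_fun do rewrite sqmodE expr2.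
by rewrite sqmodE expr2; exact: cvgM.
Qed.

(** The squared norm of [z ^+ n], classically [1 / (n + 1)]; only inequalities between consecutive
    values enter below. *)
Definition moment n : R := intD (fun q => sqmod (cplx q ^+ n : C)).

(* Averaging over the K-th roots of unity kills the coefficients of [G] of order strictly
   between 0 and K; Fatou's lemma lets K tend to infinity. *)
Lemma moment_le_norm F G n : F \in @bergman R -> hol G ->
  (forall z, normc z < 1 -> F z = z ^+ n * G z) ->
  sqmod (G 0) * moment n <= intD (fun q => sqmod (F (cplx q))).
Proof.
move=> BF hG FG; have hF := bergman_hol BF; have mD := @diskR2_measurable R.
(* The shift by 3 keeps the number of rotations above 2, as rotation invariance demands. Leaving
   [z ^+ n] unrotated alters each summand by a unimodular factor only and makes [psi k] tend to
   [z ^+ n * G 0]. *)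
pose psi k (z : C) : C := k.+3%:R^-1 * \sum_(j < k.+3) (z ^+ n * G (rootU k.+3 ^+ j * z)).
have hrot k j : hol (fun z => G (rootU k ^+ j * z)).
  move=> z hz; apply: (@cdv_comp _ G (fun z => rootU k ^+ j * z)).
    by apply: cdvM; [exact: cdv_cst|exact: cdv_id].
  by apply: hG; rewrite normcM normc_rootUX mul1r.
have hrotF k j : hol (fun z => F (rootU k ^+ j * z)).
  move=> z hz; apply: (@cdv_comp _ F (fun z => rootU k ^+ j * z)).
    by apply: cdvM; [exact: cdv_cst|exact: cdv_id].
  by apply: hF; rewrite normcM normc_rootUX mul1r.
have hpsi k : hol (psi k).
  move=> z hz; apply: cdvM; first exact: cdv_cst.
  suff hs N : cdv (fun w => \sum_(j < N) (w ^+ n * G (rootU k.+3 ^+ j * w))) z by exact: hs.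
  elim: N => [|N IH].
    by under eq_fun do rewrite big_ord0; exact: cdv_cst.
  under eq_fun do rewrite big_ord_recr /=.
  by apply: cdvD; [exact: IH|apply: cdvM; [exact: cdvX|exact: (hrot _ _ _ hz)]].
have psi_le k z : normc z < 1 -> sqmod (psi k z) <=
    \sum_(j < k.+3) k.+3%:R^-1 * sqmod (F (rootU k.+3 ^+ j * z)).
  move=> hz; apply: le_trans (sqmod_mean (fun j => z ^+ n * G (rootU k.+3 ^+ j * z)) _) _ => //.
  rewrite mulr_sumr; apply: ler_sum => j _; rewrite ler_pM2l ?invr_gt0 ?ltr0n//.
  rewrite FG ?normcM ?normc_rootUX ?mul1r// !sqmodM !sqmodE !normcX normcM normc_rootUX mul1r.
  exact: lexx.
pose f k (p : R * R) : \bar R := (sqmod (psi k (cplx p)))%:E.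
have mf k : measurable_fun D (f k) by exact: (hol_sqmod_emeasurable (hpsi k)).
have f0 k p : D p -> (0 <= f k p)%E by move=> _; rewrite lee_fin sqmod_ge0.
have int_le k : (\int[mu]_(p in D) f k p <= \int[mu]_(p in D) (sqmod (F (cplx p)))%:E)%E.
  have mG j : measurable_fun D (fun p => (k.+3%:R^-1 * sqmod (F (rootU k.+3 ^+ j * cplx p)))%:E).
    apply: (proj2 (measurable_EFinP D _)); apply: measurable_funM; first exact: measurable_cst.
    exact: (hol_sqmod_measurable (hrotF k.+3 j)).
  have G0 (j : nat) p : (0 <= (k.+3%:R^-1 * sqmod (F (rootU k.+3 ^+ j * cplx p)))%:E)%E.
    by rewrite lee_fin mulr_ge0 ?invr_ge0 ?sqmod_ge0.
  apply: (@le_trans _ _ (\int[mu]_(p in D) \sum_(j < k.+3)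
      (k.+3%:R^-1 * sqmod (F (rootU k.+3 ^+ j * cplx p)))%:E)%E).
    apply: (@ge0_le_integral _ _ _ mu D mD) => //.
    - by move=> p; exact: f0.
    - exact: mf.
    - pose hh (j : 'I_k.+3) (p : R * R) := (k.+3%:R^-1 * sqmod (F (rootU k.+3 ^+ j * cplx p)))%:E.
      exact: (@emeasurable_sum _ _ _ D _ (index_enum _) hh (fun j => mG j)).
    - by move=> p /diskR2E hp; rewrite sumEFin lee_fin; exact: psi_le.
  have Z (j : nat) : (\int[mu]_(p in D) (k.+3%:R^-1 * sqmod (F (rootU k.+3 ^+ j * cplx p)))%:E =
      (k.+3%:R^-1)%:E * \int[mu]_(p in D) (sqmod (F (cplx p)))%:E)%E.
    rewrite -(@disk_integral_rootU _ F k.+3 j hF isT).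
    apply: (@ge0_integralZl_EFin _ _ _ mu D mD
      (fun p => (sqmod (F (rootU k.+3 ^+ j * cplx p)))%:E)); last by rewrite invr_ge0.
      by move=> p _; rewrite lee_fin sqmod_ge0.
    exact: (hol_sqmod_emeasurable (hrotF k.+3 j)).
  rewrite (@ge0_integral_sum _ _ _ mu D mD 'I_k.+3 (fun j p =>
      (k.+3%:R^-1 * sqmod (F (rootU k.+3 ^+ j * cplx p)))%:E)); last 2 first.
  - by move=> j; exact: mG.
  - by move=> j p _; exact: G0.
  rewrite (eq_bigr (fun=> ((k.+3%:R^-1)%:E * \int[mu]_(p in D) (sqmod (F (cplx p)))%:E)%E));
    last by move=> j _; exact: Z.
  rewrite -(fineK (@integrable_fin_num _ _ _ mu D mD _ (bergman_integrable BF))).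
  by rewrite -EFinM sumEFin lee_fin sumr_const card_ord -[leLHS]mulr_natl mulVKf// pnatr_eq0.
have fat := @fatou _ _ _ mu D mD f mf f0.
have lim p : D p -> limn_einf (f^~ p) = (sqmod (G 0) * sqmod (cplx p ^+ n))%:E.
  move=> /diskR2E hp; rewrite -sqmodM mulrC.
  suff c : (fun k => sqmod (psi k (cplx p))) @ \oo --> sqmod (cplx p ^+ n * G 0).
    have : (f^~ p) @ \oo --> (sqmod (cplx p ^+ n * G 0))%:E.
      by apply/fine_cvgP; split; [exact: nearW|exact: c].
    by move=> /cvg_limn_einf_sup[].
  apply: cvg_normc_sqmod => e e0.
  pose rho := Num.max (normc (cplx p)) (1 / 2).
  have rho01 : 0 < rho < 1.
    by rewrite lt_max gt_max hp; apply/andP; split; [apply/orP; right|]; lra.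
  have [K0 hK] := roots_average hG rho01 e0.
  exists K0 => k kK; rewrite /psi -mulr_sumr mulrCA -mulrBr normcM.
  have zr : normc (cplx p) <= rho by rewrite le_max lexx.
  have kK3 : (K0 <= k.+3)%N by rewrite -addn3; exact: leq_trans kK (leq_addr 3 k).
  have h := hK k.+3 _ kK3 (ltn0Sn _) zr.
  apply: (@le_trans _ _ (1 * e)); last by rewrite mul1r.
  apply: ler_pM (normc_ge0 _) (normc_ge0 _) _ h.
  by rewrite normcX exprn_ile1 ?normc_ge0// ltW.
have big := le_trans fat (limn_einf_le int_le).
have : (\int[mu]_(p in D) (sqmod (G 0) * sqmod (cplx p ^+ n))%:E <=
        \int[mu]_(p in D) (sqmod (F (cplx p)))%:E)%E.
  apply: le_trans big; rewrite le_eqVlt; apply/orP; left; apply/eqP.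
  by apply: eq_integral => p; rewrite inE => /lim ->.
have fin1 := @integrable_fin_num _ _ _ mu D mD _ (bergman_integrable BF).
have iz := bergman_integrable (@bergman_expr R n).
have fin2 := @integrable_fin_num _ _ _ mu D mD _ iz.
have -> : (\int[mu]_(p in D) (sqmod (G 0) * sqmod (cplx p ^+ n))%:E =
   (sqmod (G 0))%:E * \int[mu]_(p in D) (sqmod (cplx p ^+ n))%:E)%E.
  under eq_integral do rewrite EFinM.
  exact: (@integralZl _ _ _ mu D mD _ iz).
rewrite -(fineK fin1) -(fineK fin2) -EFinM lee_fin => h.
rewrite /moment /intD mulrCA ler_pM2l ?invr_gt0 ?pi_gt0//.
Qed.

Lemma moment_gt0 n : 0 < moment n.
Proof.
have m0 : 0 <= moment n := intD_sqmod_ge0 (fun z => z ^+ n).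
rewrite lt_def m0 andbT; apply/eqP => h.
have := @bergman_int0 R (fun z => z ^+ n) (bergman_expr n) h (1 / 2)%:C%C.
have n12 : normc ((1 / 2)%:C%C : C) = 1 / 2 by rewrite normcR ger0_norm.
rewrite diskE n12 => /(_ _)/eqP; rewrite expf_eq0 -[_ == 0]negbK -normc_gt0 n12.
rewrite divr_gt0//= andbF => x; apply: notF; apply: x; lra.
Qed.

Lemma moment_sq n : moment n = normD (fun z : C => z ^+ n) ^+ 2.
Proof. by rewrite (sqr_normD (fun z : C => z ^+ n)). Qed.

(** Chebyshev's correlation inequality: with [t] the squared modulus and [k] its mean over the disc,
    [(t ^+ n - k ^+ n) * (t - k) >= 0] is integrated, and the terms carrying [k ^+ n] cancel. *)
Lemma moment_ratio : exists2 k : R, 0 < k & forall n, k * moment n <= moment n.+1.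
Proof.
pose k := moment 1 / moment 0; have m0 := moment_gt0 0; have m1 := moment_gt0 1.
have k0 : 0 < k by rewrite divr_gt0.
exists k => // n; have mD := @diskR2_measurable R.
have ii j : mu.-integrable D (EFin \o (fun p => sqmod (cplx p ^+ j : C))).
  exact: (bergman_integrable (@bergman_expr R j)).
have iZ c j : mu.-integrable D (EFin \o (fun p => c * sqmod (cplx p ^+ j : C))).
  exact: (@integrableZl _ _ _ mu D mD c _ (ii j)).
have iD a b i j : mu.-integrable D (EFin \o (fun p => a * sqmod (cplx p ^+ i : C) +
    b * sqmod (cplx p ^+ j : C))).
  exact: (@integrableD _ _ _ mu D mD _ _ (iZ a i) (iZ b j)).
pose J j := (\int[mu]_(p in D) sqmod (cplx p ^+ j : C)).
have JD a b i j : (\int[mu]_(p in D) (a * sqmod (cplx p ^+ i : C) + b * sqmod (cplx p ^+ j : C)))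
    = a * J i + b * J j.
  by rewrite RintegralD ?RintegralZl.
have : (\int[mu]_(p in D) (k * sqmod (cplx p ^+ n : C) + k ^+ n * sqmod (cplx p ^+ 1 : C))) <=
   (\int[mu]_(p in D) (1 * sqmod (cplx p ^+ n.+1 : C) + k ^+ n.+1 * sqmod (cplx p ^+ 0 : C))).
  apply: le_Rintegral => // p _; rewrite expr1 expr0 !sqmodE !normcX normc1 !expr1n mulr1 mul1r.
  rewrite -!exprM mulnC exprM [(n.+1 * 2)%N]mulnC exprM.
  set t := normc _ ^+ 2; have t0 : 0 <= t by rewrite sqr_ge0.
  rewrite !exprS; suff : 0 <= (t ^+ n - k ^+ n) * (t - k) by lra.
  have [tk|kt] := leP t k.
    by rewrite mulr_le0// subr_le0// lerXn2r// nnegrE ltW.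
  by rewrite mulr_ge0// subr_ge0 ?lerXn2r ?nnegrE// ltW.
rewrite !JD mul1r.
have mJ j : moment j = pi^-1 * J j by [].
have kJ : k * J 0 = J 1.
  have pi1 : (pi : R)^-1 != 0 by rewrite invr_eq0 gt_eqF// pi_gt0.
  apply: (mulfI pi1); rewrite mulrCA -!mJ /k divfK// gt_eqF//.
rewrite exprSr -mulrA kJ lerD2r => h.
by rewrite !mJ mulrCA ler_pM2l// invr_gt0 pi_gt0.
Qed.

Lemma moment_le n : moment n.+1 <= moment n.
Proof.
rewrite /moment /intD ler_pM2l ?invr_gt0 ?pi_gt0//.
apply: le_Rintegral; first exact: diskR2_measurable.
- exact: (bergman_integrable (@bergman_expr R n.+1)).
- exact: (bergman_integrable (@bergman_expr R n)).
move=> p /diskR2E h; rewrite !sqmodE !normcX lerXn2r ?nnegrE ?exprn_ge0 ?normc_ge0//.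
by rewrite exprS -[leRHS]mul1r ler_wpM2r ?exprn_ge0 ?normc_ge0// ltW.
Qed.

End Moments.

(** * Points of univalence of a polynomial on the circle *)

Section PolynomialMaximum.
Context {R : realType}.
Local Notation C := R[i].
Implicit Types (z w v a b : C) (h : {poly C}).

Lemma polar_unit z : normc z = 1 -> exists2 t, - pi <= t <= pi & z = eit t.
Proof.
case: z => c s h.
have cs : c ^+ 2 + s ^+ 2 = 1.
  by rewrite -[LHS]/(sqmod (Complex c s)) sqmodE h expr1n.
have c1 : -1 <= c <= 1.
  rewrite -ler_norml -(@ler_pXn2r _ 2) ?nnegrE// expr1n real_normK ?num_real//.
  by rewrite -cs lerDl sqr_ge0.
have s1 : Num.sqrt (1 - c ^+ 2) = `|s| by rewrite -cs addrAC subrr add0r sqrtr_sqr.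
have a0 := acos_ge0 c1; have a1 := acos_lepi c1; have p0 := @pi_ge0 R.
have [s0|s0] := leP 0 s.
  exists (acos c); first by rewrite a1 (le_trans _ a0)// oppr_le0.
  by rewrite /eit acosK ?in_itv// sin_acos// s1 ger0_norm.
exists (- acos c); first by rewrite lerN2 a1 (le_trans _ p0)// oppr_le0.
by rewrite /eit cosN sinN acosK ?in_itv// sin_acos// s1 ltr0_norm// opprK.
Qed.

Lemma polar_disk z : normc z <= 1 -> exists r t,
  [/\ 0 <= r <= 1, - pi <= t <= pi & z = circ r t].
Proof.
move=> hz; have [->|z0] := eqVneq z 0.
  by exists 0, 0; rewrite lexx ler01 oppr_le0 pi_ge0 /circ mul0r.
have n0 : 0 < normc z by rewrite normc_gt0.
have nC : (normc z)%:C%C != 0 :> C by rewrite -normc_gt0 normcR gtr0_norm.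
have [|t ht E] := @polar_unit (z / (normc z)%:C%C).
  by rewrite normcM normcV normcR gtr0_norm// mulfV// gt_eqF.
exists (normc z), t; split => //; first by rewrite normc_ge0.
by rewrite /circ -E mulrC divfK.
Qed.

(** For [m >= 2] the powers [v ^+ m] of the right half-plane reach every direction needed to turn
    [b] into the right half-plane; this excludes multiple points at a boundary maximum. *)
Lemma half_plane_power b m : b != 0 -> (1 < m)%N ->
  exists v, 0 < complex.Re v /\ 0 < complex.Re (b * v ^+ m).
Proof.
move=> b0 m1; have n0 : 0 < normc b by rewrite normc_gt0.
have nC : (normc b)%:C%C != 0 :> C by rewrite -normc_gt0 normcR gtr0_norm.
have [|t /andP[t1 t2] E] := @polar_unit (b / (normc b)%:C%C).
  by rewrite normcM normcV normcR gtr0_norm// mulfV// gt_eqF.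
have bE : b = (normc b)%:C%C * eit t by rewrite -E mulrC divfK.
have p0 := @pi_gt0 R; have m0 : 0 < m%:R :> R by rewrite ltr0n ltnW.
have m2 : 2 <= m%:R :> R by rewrite ler_nat.
(* With [t] the argument of [b], the angle [x] is at most [3 pi / 8] in absolute value, and
   [b * v ^+ m] has argument [t / 4]. *)
pose x := - (3 / 4 * t / m%:R).
have xm : x *+ m = - (3 / 4 * t) by rewrite -[LHS]mulr_natr /x mulNr divfK// gt_eqF.
exists (eit x); split.
  rewrite /=; apply: cos_gt0_pihalf.
  have pm : 0 <= pi * (m%:R - 2) :> R by rewrite mulr_ge0 ?subr_ge0// ltW.
  have x1 : 3 / 4 * t / m%:R <= 3 / 8 * pi.
    rewrite ler_pdivrMr//; move: (m%:R : R) pm => M; lra.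
  have x2 : - (3 / 8 * pi) <= 3 / 4 * t / m%:R.
    rewrite ler_pdivlMr//; move: (m%:R : R) pm => M; lra.
  rewrite /x; move: (_ / m%:R) x1 x2 => y; lra.
rewrite bE -mulrA -eitMn -eitD xm /= mul0r subr0 mulr_gt0//.
by apply: cos_gt0_pihalf; lra.
Qed.

Definition reh a h z : R := complex.Re (conjc a * h.[z]).

Lemma disk_max a h : exists2 w, normc w <= 1 & forall z, normc z <= 1 -> reh a h z <= reh a h w.
Proof.
pose F (p : R * R) : R := reh a h (circ p.1 p.2).
pose A : set (R * R) := `[0, 1] `*` `[- pi, pi].
have pi0 := @pi_ge0 R.
have A0 : A !=set0 by exists (0, 0); split; rewrite /= in_itv /= ?lexx ?ler01 ?oppr_le0 ?pi0.
have cA : compact A by apply: compact_setX; exact: segment_compact.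
have cF : {within A, continuous F}.
  apply: continuous_subspaceT => -[x y]; apply/cvgrPdist_le => /= e e0.
  have /derivable_cdiff[d dd] : cdv (fun z => conjc a * h.[z]) (circ x y).
    by apply: cdvM; [exact: cdv_cst|exact: cdv_horner].
  have dc := cdiff2M (cdiff2_fst x y) (cdiff2_eit x y).
  have := cdiff2_lip (cdiff2_comp (G := fun s t => circ s t) dd dc).
  set L := 1 + _ + _ => -[del del0 H].
  have L0 : 0 < L by rewrite /L -addrA ltr_pwDl// addr_ge0 ?normc_ge0.
  have r0 : 0 < Num.min del (e / L / 2) by rewrite lt_min del0 !divr_gt0.
  exists (ball x (Num.min del (e / L / 2)), ball y (Num.min del (e / L / 2))).
    by split; exact: nbhsx_ballx.
  move=> -[x' y'] [/=].
  rewrite /ball /= ![`|_ - x'|]distrC ![`|_ - y'|]distrC !lt_min => /andP[x1 x2] /andP[y1 y2].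
  have h1 := H _ _ x1 y1; rewrite distrC.
  have -> : F (x', y') - F (x, y) = complex.Re (conjc a * h.[circ x' y'] - conjc a * h.[circ x y]).
    by rewrite /F /reh /=; case: (conjc a * _) (conjc a * _) => [? ?] [? ?].
  apply: le_trans (Re_le_normc _) _; apply: le_trans h1 _.
  rewrite mulrC -ler_pdivlMr//; lra.
have [[x y]] := compact_EVT_max A0 cA cF.
rewrite inE => -[/=]; rewrite !in_itv /= => hx hy hm.
exists (circ x y); first by rewrite normc_circ; case/andP: hx.
move=> z /polar_disk[r [t [hr ht ->]]]; apply: (hm (r, t)).
by rewrite inE; split; rewrite /= in_itv.
Qed.

Lemma Re_limit (f : C -> C) z v c : cdv f z ->
  (exists2 d : R, 0 < d & forall e : R, 0 < e < d -> complex.Re (f (z + e%:C%C * v) * c) <= 0) ->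
  complex.Re (f z * c) <= 0.
Proof.
move=> /cdv_cont cf [d d0 H]; rewrite leNgt; apply/negP => pos.
have n0 : 0 < normc c + 1 by rewrite ltr_wpDl// normc_ge0.
have v0 : 0 < normc v + 1 by rewrite ltr_wpDl// normc_ge0.
have [|del del0 hd] := cf (complex.Re (f z * c) / 2 / (normc c + 1)); first by rewrite !divr_gt0.
pose e := Num.min (d / 2) (del / (normc v + 1) / 2).
have e0 : 0 < e by rewrite lt_min !divr_gt0.
have ed : e < d by rewrite gt_min (_ : d / 2 < d)//; lra.
have := H e; rewrite e0 => /(_ ed) h.
have hdv : normc (z + e%:C%C * v - z) < del.
  rewrite addrC addKr normcM normcR gtr0_norm//.
  apply: (@lt_le_trans _ _ (del / 2 * 2)); last by rewrite divfK.
  have e1 : e <= del / (normc v + 1) / 2 by rewrite ge_min lexx orbT.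
  apply: (@le_lt_trans _ _ (del / (normc v + 1) / 2 * (normc v + 1))).
    by rewrite ler_pM ?normc_ge0 ?(ltW e0)// lerDl.
  rewrite mulrAC divfK ?gt_eqF//; lra.
have b1 := hd _ hdv.
have b2 : normc ((f (z + e%:C%C * v) - f z) * c) <= complex.Re (f z * c) / 2.
  rewrite normcM; apply: (@le_trans _ _ (complex.Re (f z * c) / 2 / (normc c + 1) * (normc c + 1))).
    by rewrite ler_pM ?normc_ge0// lerDl.
  by rewrite divfK// gt_eqF.
have := le_trans (Re_le_normc _) b2; rewrite mulrBl.
have -> : complex.Re (f (z + e%:C%C * v) * c - f z * c) =
  complex.Re (f (z + e%:C%C * v) * c) - complex.Re (f z * c).
  by case: (_ * c) (_ * c) => [? ?] [? ?].
rewrite ler_norml; lra.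
Qed.

(** Write [h - h w = q * (z - w) ^+ m] with [q w] nonzero. Every direction [v] pointing into the
    disc satisfies [Re (conj a * q w * v ^+ m) <= 0]. All directions do so at an interior point,
    which is absurd; on the circle they form an open half-plane, which forces [m = 1], and a linear
    form nonpositive on a half-plane is determined up to a positive factor, whence the vanishing
    imaginary part. *)
Lemma disk_max_boundary a h w : a != 0 -> (1 < size h)%N -> normc w <= 1 ->
  (forall z, normc z <= 1 -> reh a h z <= reh a h w) ->
  [/\ normc w = 1, h^`().[w] != 0 & complex.Im (conjc a * (w * h^`().[w])) = 0].
Proof.
move=> a0 sh w1 mx; pose p := h - h.[w]%:P.
have p0 : p != 0.
  rewrite subr_eq0; apply/eqP => E; move: sh; rewrite E size_polyC; by case: eqP.
have [m [q]] := multiplicity_XsubC p w; rewrite p0 /= => qw pE.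
have m0 : (0 < m)%N.
  rewrite lt0n; apply/eqP => m0; move: qw; rewrite m0 expr0 mulr1 in pE.
  by rewrite -pE /root /p !hornerE subrr eqxx.
have hE z : h.[z] - h.[w] = q.[z] * (z - w) ^+ m.
  by have : p.[z] = h.[z] - h.[w] by [rewrite !hornerE]; rewrite pE !hornerE => <-.
have qw0 : q.[w] != 0 by [].
have ca0 : conjc a != 0 by rewrite conjc_eq0.
have dir v : (exists2 d : R, 0 < d & forall e : R, 0 < e < d -> normc (w + e%:C%C * v) <= 1) ->
    complex.Re ((conjc a * q.[w]) * v ^+ m) <= 0.
  move=> [d d0 H]; apply: (@Re_limit (fun z => conjc a * q.[z]) w v).
    by apply: cdvM; [exact: cdv_cst|exact: cdv_horner].
  exists d => // e /[dup] /andP[e0 _] /H/mx; rewrite /reh => h1.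
  have em : 0 < e ^+ m by rewrite exprn_gt0.
  rewrite -(pmulr_rle0 _ em).
  have -> : e ^+ m * complex.Re (conjc a * q.[w + e%:C%C * v] * v ^+ m) =
    complex.Re (conjc a * h.[w + e%:C%C * v]) - complex.Re (conjc a * h.[w]).
    have -> : complex.Re (conjc a * h.[w + e%:C%C * v]) - complex.Re (conjc a * h.[w]) =
      complex.Re (conjc a * (h.[w + e%:C%C * v] - h.[w])).
      by rewrite mulrBr; case: (_ * _) (_ * _) => [? ?] [? ?].
    have wv : w + e%:C%C * v - w = e%:C%C * v by ring.
    rewrite hE wv exprMn -rmorphXn.
    have -> : conjc a * (q.[w + e%:C%C * v] * ((e ^+ m)%:C%C * v ^+ m)) =
      (e ^+ m)%:C%C * (conjc a * q.[w + e%:C%C * v] * v ^+ m) by ring.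
    by case: (conjc a * _ * _) => u u' /=; rewrite mul0r subr0.
  by rewrite subr_le0.
have [win|wbd] := ltP (normc w) 1.
  exfalso; pose b := conjc a * q.[w].
  have b0 : b != 0 by rewrite mulf_neq0.
  (* In this direction [b * v ^+ m] is the squared modulus of [b]. *)
  pose v := m.-root (conjc b).
  have := dir v; rewrite -/b rootCK// => /(_ _).
  have -> : complex.Re (b * conjc b) = sqmod b.
    by case: (b) => u u'; rewrite /sqmod /=; ring.
  rewrite leNgt sqmodE exprn_gt0 ?normc_gt0// => hh; suff: false by []; apply: hh.
  have v0 : 0 < normc v + 1 by rewrite ltr_wpDl// normc_ge0.
  exists ((1 - normc w) / (normc v + 1)); first by rewrite divr_gt0// subr_gt0.
  move=> e /andP[e0 e1]; apply: le_trans (le_normcD _ _) _.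
  rewrite normcM normcR gtr0_norm//; move: e1; rewrite ltr_pdivlMr//; lra.
have w1E : normc w = 1 by apply/eqP; rewrite eq_le w1 wbd.
have w0 : w != 0 by rewrite -normc_gt0 w1E.
pose b := conjc a * q.[w] * (- w) ^+ m.
have b0 : b != 0 by rewrite !mulf_neq0// expf_neq0// oppr_eq0.
have dir' v : 0 < complex.Re v -> complex.Re (b * v ^+ m) <= 0.
  move=> rv; rewrite /b -mulrA -exprMn; apply: dir.
  have nv : 0 < sqmod v.
    by rewrite sqmodE exprn_gt0// (lt_le_trans rv)// (le_trans (ler_norm _))// Re_le_normc.
  (* Second intersection with the circle of the ray from [w] in the direction [- w * v]. *)
  exists (2 * complex.Re v / sqmod v); first by rewrite divr_gt0// mulr_gt0.
  move=> e /andP[e0]; rewrite ltr_pdivlMr// => e1.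
  have -> : w + e%:C%C * (- w * v) = w * (1 - e%:C%C * v) by ring.
  rewrite normcM w1E mul1r -(@ler_pXn2r _ 2) ?nnegrE ?normc_ge0// expr1n -sqmodE.
  have -> : sqmod (1 - e%:C%C * v) = 1 - e * (2 * complex.Re v - e * sqmod v).
    by case: (v) => u u'; rewrite /sqmod /=; ring.
  by rewrite gerBl mulr_ge0 ?ltW// subr_gt0.
have m1 : m = 1%N.
  apply/eqP; rewrite eqn_leq m0 andbT leqNgt; apply/negP => m2.
  have [v [v1 v2]] := half_plane_power b0 m2.
  by have := dir' v v1; rewrite leNgt v2.
have h'E : h^`().[w] = q.[w].
  have -> : h = p + h.[w]%:P by rewrite /p subrK.
  rewrite pE m1 expr1 derivD derivC addr0 derivM derivXsubC !hornerE subrr mulr0 add0r//.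
split => //; first by rewrite h'E.
have bE : b = - (conjc a * (w * h^`().[w])) by rewrite /b m1 expr1 h'E; ring.
set X := conjc a * _ in bE *.
have lin y : complex.Re (- X * (Complex 1 y)) <= 0.
  by have := dir' (Complex 1 y); rewrite m1 expr1 -bE; apply; rewrite ltr01.
move: lin; case: (X) => u u' /= lin.
apply: contrapT => /eqP u'0.
have := lin ((u + 1) / u').
have -> : - u * 1 - - u' * ((u + 1) / u') = 1 :> R by field.
by rewrite ler10.
Qed.

End PolynomialMaximum.

(** * Coincidences [h (t w) = h w] on the torus and their elimination *)

Section Coincidence.
Context {R : realType}.
Local Notation C := R[i].
Implicit Types (z w t : C) (h p q : {poly C}).

Lemma poly_inj_roots p (f : nat -> C) : injective f -> (forall n, root p (f n)) -> p = 0.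
Proof.
move=> fi fr; apply: contrapT => /eqP p0.
have := @max_poly_roots C p (mkseq f (size p)) p0.
rewrite size_mkseq ltnn => h; suff : false by []; apply: h.
  by apply/allP => x /mapP[n _ ->].
by rewrite mkseq_uniq.
Qed.

Lemma poly_natr_nonroot p (T : R) : p != 0 -> exists2 t, T <= normc t & p.[t] != 0.
Proof.
move=> p0; apply: contrapT => N.
have /negP := p0; apply; apply/eqP.
pose B := Num.bound `|T|.
apply: (@poly_inj_roots p (fun n => (B + n)%:R)).
  by move=> n m /eqP; rewrite eqr_nat eqn_add2l => /eqP.
move=> n; apply/negPn/negP => nr; apply: N; exists (B + n)%:R => //.
have -> : normc ((B + n)%:R : C) = (B + n)%:R.
  by rewrite -(rmorph_nat (real_complex R)) normcR normr_nat.
apply: le_trans (ler_norm _) _; apply: (@le_trans _ _ B%:R); last by rewrite ler_nat leq_addr.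
by apply: ltW; rewrite archi_boundP.
Qed.

(** Each nonzero coefficient of index [k] forces [t ^+ k = 1]. So [t] is a root of unity, its order
    [l] exceeds 1, and only multiples of [l] occur as exponents. *)
Lemma rotation_invariant_poly h t : t != 1 -> (1 < size h)%N ->
  h \Po (t *: 'X) = h -> exists (h1 : {poly C}) l, (1 < l)%N /\ h = h1 \Po 'X^l.
Proof.
move=> t1 sh E.
have ck k : h`_k != 0 -> t ^+ k = 1.
  move=> hk; have := congr1 (fun p : {poly C} => p`_k) E.
  have -> : (h \Po (t *: 'X))`_k = h`_k * t ^+ k.
    rewrite comp_polyE.
    under eq_bigr do rewrite exprZn scalerA.
    rewrite -(poly_def (size h) (fun i => h`_i * t ^+ i)) coef_poly.
    by case: ltnP => // sk; rewrite nth_default ?mul0r.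
  by rewrite -[RHS]mulr1 => /(mulfI hk).
have n0 : (0 < (size h).-1)%N by rewrite -ltnS prednK// ltnW.
have tn : t ^+ (size h).-1 = 1.
  by apply: ck; rewrite -/(lead_coef h) lead_coef_eq0 -size_poly_gt0 ltnW.
have [l prim _] := prim_order_exists n0 tn.
have l0 : (0 < l)%N := prim_order_gt0 prim.
have l1 : (1 < l)%N.
  rewrite ltn_neqAle l0 andbT; apply/eqP => l1; move: t1.
  by rewrite -[t]expr1 l1 (prim_expr_order prim) eqxx.
exists (\poly_(i < size h) h`_(l * i)), l; split => //.
apply/polyP => k; rewrite coef_comp_poly_Xn// coef_poly.
case: ifP => [lk|nlk].
  rewrite mulnC divnK//; case: ltnP => // sk; rewrite nth_default//.
  by apply: leq_trans sk _; exact: leq_div.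
apply/eqP; apply: contraFT nlk => /ck tk.
by rewrite (prim_order_dvd prim) tk.
Qed.

Definition coefsum p : R := \sum_(k < size p) normc p`_k.

Lemma coefsum_ge0 p : 0 <= coefsum p.
Proof. by apply: sumr_ge0 => k _; exact: normc_ge0. Qed.

Lemma normc_horner_le p z (M : R) : 1 <= M -> normc z <= M ->
  normc p.[z] <= coefsum p * M ^+ (size p).-1.
Proof.
move=> M1 zM; rewrite horner_coef (le_trans (normc_sum _ _))// /coefsum mulr_suml.
apply: ler_sum => k _; rewrite normcM normcX ler_wpM2l ?normc_ge0//.
apply: (@le_trans _ _ (M ^+ k)).
  by rewrite lerXn2r ?nnegrE ?normc_ge0// (le_trans _ M1).
by rewrite ler_weXn2l// -ltnS prednK ?ltn_ord// (leq_ltn_trans _ (ltn_ord k)).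
Qed.

(** For large [t] the point [w] is much smaller than [z = t * w], so [p w] and the lower terms of
    [p z] balance the leading term of [p z] only while [z] is bounded. *)
Lemma coincidence_bound p : (1 < size p)%N -> exists B T : R,
  forall t w, T <= normc t -> p.[t * w] = p.[w] -> normc (t * w) <= B.
Proof.
move=> sp; set n := (size p).-1; set S := coefsum p.
have n0 : (0 < n)%N by rewrite /n -ltnS prednK// ltnW.
have sE : size p = n.+1 by rewrite /n prednK// ltnW.
have L0 : 0 < normc p`_n.
  by rewrite normc_gt0 -/(lead_coef p) lead_coef_eq0 -size_poly_gt0 ltnW.
have S0 : 0 <= S := coefsum_ge0 p.
(* With [x] the modulus of [z], the leading term gives [normc p_n * x <= 2 * S + S * normc w]; the
   threshold on [t] bounds [S * normc w] by half of the left side, leaving [normc p_n * x <= 4 * S].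
   The summands 1 cover [x <= 1] and ensure [normc t >= 1]. *)
exists (1 + 4 * S / normc p`_n), (1 + 2 * S / normc p`_n) => t w hT E.
set z := t * w in E *; set x := normc z.
have T1 : 1 <= 1 + 2 * S / normc p`_n by rewrite lerDl divr_ge0 ?mulr_ge0 ?normc_ge0.
have q0 : 0 <= S / normc p`_n by rewrite divr_ge0 ?normc_ge0.
have [x1|x1] := leP x 1; first by apply: le_trans x1 _; rewrite lerDl divr_ge0 ?mulr_ge0 ?normc_ge0.
have xw : normc w * normc t = x by rewrite /x /z normcM mulrC.
have t1 : 1 <= normc t by exact: le_trans hT.
have wx : normc w <= x by rewrite -xw ler_peMr// normc_ge0.
set M := Num.max 1 (normc w).
have M1 : 1 <= M by rewrite le_max lexx.
have Mx : M <= x by rewrite ge_max (ltW x1).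
have pw : normc p.[w] <= S * (M * x ^+ n.-1).
  have wM : normc w <= M by rewrite le_max lexx orbT.
  apply: le_trans (@normc_horner_le p w M M1 wM) _.
  rewrite -/n -/S ler_wpM2l// -{1}(prednK n0) exprS ler_wpM2l//; first by rewrite (le_trans _ M1).
  by rewrite lerXn2r ?nnegrE// (le_trans ler01)// ltW.
pose tail := \sum_(k < n) p`_k * z ^+ k.
have pz : p.[z] = tail + p`_n * z ^+ n by rewrite horner_coef sE big_ord_recr.
have tl : normc tail <= S * x ^+ n.-1.
  rewrite /tail (le_trans (normc_sum _ _))//.
  apply: (@le_trans _ _ (\sum_(k < n) normc p`_k * x ^+ n.-1)).
    apply: ler_sum => k _; rewrite normcM normcX ler_wpM2l ?normc_ge0//.
    by rewrite ler_weXn2l ?(ltW x1)// -ltnS prednK.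
  rewrite -mulr_suml ler_wpM2r ?exprn_ge0 ?(le_trans ler01 (ltW x1))//.
  by rewrite /S /coefsum sE big_ord_recr /= lerDl normc_ge0.
have lead : normc p`_n * x ^+ n <= S * (M * x ^+ n.-1) + S * x ^+ n.-1.
  rewrite -normcX -normcM.
  have -> : p`_n * z ^+ n = p.[w] - tail by rewrite -E pz addrC addKr.
  by apply: le_trans (normcB _ _) _; exact: lerD.
have xp : 0 < x ^+ n.-1 by rewrite exprn_gt0// (lt_trans ltr01).
have xn : x ^+ n = x * x ^+ n.-1 by rewrite -exprS prednK.
move: lead; rewrite xn !mulrA -mulrDl ler_pM2r// => lead.
have Mle : M <= 1 + normc w by rewrite ge_max lerDl normc_ge0 lerDr ler01.
have SM : S * M <= S * (1 + normc w) by rewrite ler_wpM2l.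
have Sw : 2 * (S * normc w) <= normc p`_n * x.
  have : (1 + 2 * S / normc p`_n) * normc w <= x.
    by rewrite -xw mulrC ler_wpM2l ?normc_ge0.
  move=> h; have : normc p`_n * ((1 + 2 * S / normc p`_n) * normc w) <= normc p`_n * x.
    by rewrite ler_pM2l.
  have -> : normc p`_n * ((1 + 2 * S / normc p`_n) * normc w) =
    normc p`_n * normc w + 2 * (S * normc w) by field; rewrite gt_eqF.
  have : 0 <= normc p`_n * normc w by rewrite mulr_ge0 ?normc_ge0.
  lra.
have : normc p`_n * x <= 4 * S by lra.
rewrite mulrC -ler_pdivlMr//; lra.
Qed.

(* [coinA] and [coinB], polynomials in w over polynomials in t, evaluate to h(tw) - h(w)
   and to (tw)^n times the conjugate of h(w) - h(tw) on the torus. *)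
Definition coinA h : {poly {poly C}} := \poly_(k < size h) (h`_k *: ('X^k - 1)).
Definition coinB h : {poly {poly C}} :=
  \sum_(k < size h) (conjc h`_k *: ('X^((size h).-1 - k) * ('X^k - 1))) *: 'X^((size h).-1 - k).

Definition ev2 (P : {poly {poly C}}) t w : C := (map_poly (fun p : {poly C} => p.[t]) P).[w].

Lemma ev2E P t w : ev2 P t w = P.[w%:P].[t].
Proof.
rewrite /ev2 /map_poly horner_poly (horner_coef P) horner_sum.
by apply: eq_bigr => i _; rewrite hornerM horner_exp hornerC.
Qed.

Lemma ev2_coinA h t w : ev2 (coinA h) t w = h.[t * w] - h.[w].
Proof.
rewrite ev2E /coinA horner_poly horner_sum !horner_coef -sumrB.
apply: eq_bigr => k _; rewrite !hornerE ?horner_exp ?hornerE exprMn; ring.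
Qed.

Lemma ev2_coinB h t w : ev2 (coinB h) t w = \sum_(k < size h)
  conjc h`_k * (t ^+ ((size h).-1 - k) * (t ^+ k - 1)) * w ^+ ((size h).-1 - k).
Proof.
rewrite ev2E /coinB horner_sum horner_sum.
by apply: eq_bigr => k _; rewrite !hornerE ?horner_exp ?hornerE.
Qed.

Lemma ev2_coinB_neq0 h t w : t != 0 -> w != 0 ->
  ev2 (coinB h) t w = (t * w) ^+ (size h).-1 *
    ((map_poly conjc h).[w^-1] - (map_poly conjc h).[(t * w)^-1]).
Proof.
move=> t0 w0; rewrite ev2_coinB !horner_coef.
rewrite size_map_poly -sumrB mulr_sumr; apply: eq_bigr => k _.
rewrite coef_map /= !exprVn !exprMn.
have -> : (size h).-1 = (((size h).-1 - k) + k)%N.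
  by rewrite subnK// -ltnS prednK ?ltn_ord// (leq_ltn_trans _ (ltn_ord k)).
rewrite addnK; set a := (_ - k)%N; rewrite !exprD.
have tk : t ^+ k != 0 by rewrite expf_neq0.
have wk : w ^+ k != 0 by rewrite expf_neq0.
by field; rewrite tk wk.
Qed.

Lemma coinA_neq0 h : (1 < size h)%N -> coinA h != 0.
Proof.
move=> sh; apply/eqP => A0.
have := congr1 (fun P : {poly {poly C}} => P`_(size h).-1) A0.
rewrite coef_poly prednK ?(ltnW sh)// leqnn coef0 => /eqP.
rewrite scaler_eq0 -/(lead_coef h) lead_coef_eq0 -size_poly_eq0 -leqn0 leqNgt (ltnW sh) /=.
have n0 : (0 < (size h).-1)%N by rewrite -ltnS prednK// ltnW.
by rewrite -size_poly_eq0 size_XnsubC.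
Qed.

(** [coincidence_bound] applies to [h] at [w], bounding [t * w], and to the conjugate polynomial at
    [1 / (t * w)], bounding [1 / w]; the product of the two bounded quantities is [t]. *)
Lemma coin_no_large h : (1 < size h)%N -> exists T : R, forall t w, T <= normc t ->
  ev2 (coinA h) t w = 0 -> ev2 (coinB h) t w = 0 -> False.
Proof.
move=> sh; have [B1 [T1 H1]] := coincidence_bound sh.
have sh' : (1 < size (map_poly conjc h))%N by rewrite size_map_poly.
have [B2 [T2 H2]] := coincidence_bound sh'.
have n0 : (0 < (size h).-1)%N by rewrite -ltnS prednK// ltnW.
exists (2 + `|T1| + `|T2| + `|B1| * `|B2|) => t w hT A0 B0.
have a1 := normr_ge0 T1; have a2 := normr_ge0 T2.
have a3 : 0 <= `|B1| * `|B2| by rewrite mulr_ge0.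
have t1 : 2 <= normc t by lra.
have tT1 : T1 <= normc t by have := ler_norm T1; lra.
have tT2 : T2 <= normc t by have := ler_norm T2; lra.
have t0 : t != 0 by rewrite -normc_gt0; lra.
(* At [w = 0] only the leading coefficient of [h] survives in [coinB], so [t ^+ n = 1], against
   [normc t >= 2]. *)
have [w0|w0] := eqVneq w 0.
  have [n sE] : exists n, size h = n.+1 by exists (size h).-1; rewrite prednK// ltnW.
  have hn : h`_n != 0.
    have -> : h`_n = lead_coef h by rewrite /lead_coef sE.
    by rewrite lead_coef_eq0 -size_poly_gt0 sE.
  move: B0; rewrite ev2_coinB w0 sE big_ord_recr /= subnn !expr0 mulr1 mul1r.
  rewrite big1 ?add0r; last first.
    by move=> k _; rewrite expr0n subn_eq0 leqNgt ltn_ord /= mulr0.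
  move/eqP; rewrite mulf_eq0 conjc_eq0 (negbTE hn) /= subr_eq0 => /eqP tn.
  have := normc1 R; rewrite -tn normcX => tn1.
  have n1 : (n != 0)%N by move: sh; rewrite sE; case: (n).
  have : 1 < normc t ^+ n by rewrite exprn_egt1//; lra.
  by rewrite tn1 ltxx.
have e1 : normc (t * w) <= B1.
  by apply: H1 => //; apply/eqP; rewrite -subr_eq0 -ev2_coinA A0.
have tw0 : t * w != 0 by rewrite mulf_neq0.
have e2 : normc (t * (t * w)^-1) <= B2.
  have tV : t * (t * w)^-1 = w^-1 by rewrite invfM mulrA mulfV// mul1r.
  apply: H2 => //; rewrite tV.
  move: B0; rewrite ev2_coinB_neq0// => /eqP; rewrite mulf_eq0 expf_eq0 (negbTE tw0) andbF /=.
  by rewrite subr_eq0 => /eqP.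
have e3 : normc t <= `|B1| * `|B2|.
  have -> : normc t = normc (t * w) * normc (t * (t * w)^-1).
    by rewrite -normcM; congr normc; rewrite mulrCA mulfV// mulr1.
  by rewrite ler_pM ?normc_ge0// (le_trans _ (ler_norm _)).
lra.
Qed.

(* Either a nonzero polynomial in t vanishes at every common zero, or the gcd produces
   common zeros with t arbitrarily large. *)
Lemma coin_eliminant h : (1 < size h)%N -> exists2 E : {poly C}, E != 0 &
  forall t w, ev2 (coinA h) t w = 0 -> ev2 (coinB h) t w = 0 -> E.[t] = 0.
Proof.
move=> sh; have A0 := coinA_neq0 sh.
have [cop|ncop] := boolP (coprimep (coinA h) (coinB h)).
  (* Over the domain of polynomials in [t], Bezout's identity holds up to nonzero scalars,
     themselves polynomials in [t]; [c2] is the eliminant. *)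
  have /Pdiv.Idomain.Bezout_coprimepP[[u v] /Pdiv.Idomain.eqpP[[c1 c2] /= /andP[c10 c20] E]] := cop.
  exists c2 => // t w hA hB.
  have := congr1 (fun P : {poly {poly C}} => P.[w%:P].[t]) E.
  rewrite !hornerE -!ev2E hA hB !mulr0 addr0 mulr0 ?mulr1 => <-//.
exfalso; set A := coinA h in A0 ncop *; set B := coinB h in ncop *.
pose g := gcdp A B.
have g0 : g != 0 by rewrite gcdp_eq0 negb_and A0.
have sg : (1 < size g)%N.
  by rewrite ltn_neqAle eq_sym size_poly_gt0 g0 andbT.
have /Pdiv.Idomain.dvdpP[[cA qA] /= cA0 EA] : g %| A by exact: dvdp_gcdl.
have /Pdiv.Idomain.dvdpP[[cB qB] /= cB0 EB] : g %| B by exact: dvdp_gcdr.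
have [T hT] := coin_no_large sh.
(* Divisibility by [g] also holds only up to the factors [cA] and [cB]. Where these and the leading
   coefficient do not vanish, [g] specialises to a nonconstant polynomial in [w] whose roots are
   common zeros of [A] and [B]. *)
have P0 : lead_coef g * cA * cB != 0.
  by rewrite !mulf_neq0// lead_coef_eq0.
have [t tT] := poly_natr_nonroot T P0.
rewrite !hornerE !mulf_eq0 !negb_or => /andP[/andP[lt At] Bt].
pose gt := map_poly (fun p : {poly C} => p.[t]) g.
have sgt : (1 < size gt)%N.
  apply: leq_trans sg _; apply: leq_trans (_ : (size g).-1 < _)%N; first by rewrite prednK// size_poly_gt0.
  rewrite ltnNge; apply/negP => le; have := leq_sizeP _ _ le _ (leqnn _).
  rewrite coef_poly prednK ?size_poly_gt0// leqnn => /eqP; rewrite -/(lead_coef g).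
  by rewrite (negbTE lt).
have [w hw] : exists w, root gt w by apply/closed_rootP; rewrite neq_ltn sgt orbT.
have gw : g.[w%:P].[t] = 0 by rewrite -ev2E; exact/eqP.
apply: (hT t w tT).
  apply: (mulfI At); rewrite mulr0 ev2E.
  by have := congr1 (fun P : {poly {poly C}} => P.[w%:P].[t]) EA; rewrite !hornerE gw mulr0.
apply: (mulfI Bt); rewrite mulr0 ev2E.
by have := congr1 (fun P : {poly {poly C}} => P.[w%:P].[t]) EB; rewrite !hornerE gw mulr0.
Qed.

Lemma conj_unit w : normc w = 1 -> conjc w = w^-1.
Proof.
move=> w1; have w0 : w != 0 by rewrite -normc_gt0 w1.
apply: (mulfI w0); rewrite mulfV//.
have : sqmod w = 1 by rewrite sqmodE w1 expr1n.
case: (w) => a b; rewrite /sqmod /= => ab; apply/eqP; rewrite eq_complex /=.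
by apply/andP; split; apply/eqP; [rewrite -ab|]; ring.
Qed.

(** All ratios [z n / w n] are roots of one eliminant and differ from 1. The product of the
    polynomials [h (r w) - h w] over the roots [r] other than 1 then vanishes at infinitely many
    points, so one of its factors is zero. *)
Lemma torus_coincidence h (w z : nat -> C) : (1 < size h)%N -> injective w ->
  (forall n, [/\ normc (w n) = 1, normc (z n) = 1, z n <> w n & h.[z n] = h.[w n]]) ->
  exists (h1 : {poly C}) l, (1 < l)%N /\ h = h1 \Po 'X^l.
Proof.
move=> sh wi H; have [E E0 HE] := coin_eliminant sh.
have w0 n : w n != 0 by have [w1 _ _ _] := H n; rewrite -normc_gt0 w1.
pose t n := z n / w n.
have tw n : t n * w n = z n by rewrite /t divfK.
have Et n : E.[t n] = 0.
  have [w1 z1 _ hwz] := H n.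
  have z0 : z n != 0 by rewrite -normc_gt0 z1.
  have t0 : t n != 0 by rewrite mulf_neq0// invr_eq0.
  apply: (HE (t n) (w n)); first by rewrite ev2_coinA tw hwz subrr.
  rewrite ev2_coinB_neq0// tw -!conj_unit//.
  have cj x : (map_poly conjc h).[conjc x] = conjc h.[x] by rewrite horner_map.
  by rewrite !cj hwz subrr mulr0.
have [rs rsE] := closed_field_poly_normal E.
pose P := \prod_(r <- rs | r != 1) (h \Po (r *: 'X) - h).
have P0 : P = 0.
  apply: (poly_inj_roots wi) => n; rewrite /P /root horner_prod prodf_seq_eq0.
  apply/hasP; exists (t n).
    have := Et n; rewrite rsE hornerZ => /eqP; rewrite mulf_eq0 lead_coef_eq0 (negbTE E0) /=.
    by rewrite -/(root _ _) root_prod_XsubC.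
  have [_ _ zw hwz] := H n.
  rewrite !hornerE horner_comp !hornerE tw hwz subrr eqxx andbT.
  by apply/eqP => t1; apply: zw; rewrite -tw t1 mul1r.
move: P0 => /eqP; rewrite /P prodf_seq_eq0 => /hasP[r _ /andP[r1]].
rewrite subr_eq0 => /eqP hr.
exact: rotation_invariant_poly hr.
Qed.

End Coincidence.

(** * Existence of a boundary point of univalence, with uniform lower bounds *)

Section UnivalentPoint.
Context {R : realType}.
Local Notation C := R[i].
Implicit Types (z w : C) (h p : {poly C}).

Definition divdiff h z w : C :=
  \sum_(k < size h) h`_k * \sum_(i < k) z ^+ (k.-1 - i) * w ^+ i.

Definition divdiff_poly h w : {poly C} :=
  \sum_(k < size h) h`_k *: \sum_(i < k) w ^+ i *: 'X^(k.-1 - i).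

Lemma divdiffE h z w : h.[z] - h.[w] = (z - w) * divdiff h z w.
Proof.
rewrite !horner_coef -sumrB /divdiff mulr_sumr; apply: eq_bigr => k _.
by rewrite -mulrBr subrXX mulrCA.
Qed.

Lemma horner_divdiff_poly h w z : (divdiff_poly h w).[z] = divdiff h z w.
Proof.
rewrite /divdiff_poly horner_sum; apply: eq_bigr => k _.
rewrite hornerZ horner_sum; congr (_ * _); apply: eq_bigr => i _.
by rewrite hornerZ hornerXn mulrC.
Qed.

Lemma divdiff_diag h w : divdiff h w w = h^`().[w].
Proof.
have E : h = divdiff_poly h w * ('X - w%:P) + h.[w]%:P.
  apply/eqP; rewrite -subr_eq0; apply/eqP.
  apply: (@poly_inj_roots R _ (fun n => n%:R)).
    by move=> n m /eqP; rewrite eqr_nat => /eqP.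
  move=> n; rewrite /root !hornerE horner_divdiff_poly mulrC -divdiffE subrK subrr//.
rewrite {2}E derivD derivC addr0 derivM derivXsubC !hornerE subrr mulr0 add0r.
by rewrite horner_divdiff_poly.
Qed.

(** All roots lie outside the closed disc, and a linear factor with root [r] has modulus at least
    [normc r - 1] there. *)
Lemma poly_lower_bound p : (forall z, normc z <= 1 -> p.[z] != 0) ->
  exists2 d : R, 0 < d & forall z, normc z <= 1 -> d <= normc p.[z].
Proof.
move=> np; have [rs rsE] := closed_field_poly_normal p.
have l0 : lead_coef p != 0.
  rewrite lead_coef_eq0; apply/eqP => p0; have := np 0; rewrite p0 horner0 eqxx normc0 ler01.
  by move=> /(_ isT).
have big r : r \in rs -> 1 < normc r.
  move=> rr; rewrite ltNge; apply/negP => /np; rewrite rsE hornerZ mulf_eq0 negb_or => /andP[_].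
  by rewrite -/(root _ _) root_prod_XsubC rr.
have [d d0 hd] : exists2 d : R, 0 < d & forall z, normc z <= 1 ->
    d <= normc (\prod_(r <- rs) (z - r)).
  elim: rs big {rsE} => [|r rs IH] big.
    by exists 1 => // z _; rewrite big_nil normc1.
  have [|d d0 hd] := IH; first by move=> x xr; apply: big; rewrite inE xr orbT.
  have r1 : 1 < normc r by apply: big; rewrite inE eqxx.
  exists ((normc r - 1) * d); first by rewrite mulr_gt0// subr_gt0.
  move=> z z1; rewrite big_cons normcM ler_pM ?subr_ge0 ?(ltW r1) ?(ltW d0)//; last exact: hd.
  rewrite normc_distC; apply: le_trans (normc_le_subD _ _); lra.
exists (normc (lead_coef p) * d); first by rewrite mulr_gt0// normc_gt0.
move=> z /hd h; rewrite {2}rsE hornerZ normcM ler_wpM2l ?normc_ge0//.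
rewrite horner_prod; under eq_bigr do rewrite hornerXsubC.
exact: h.
Qed.

Lemma normc_subX_le z w (M : R) n : 1 <= M -> normc z <= M -> normc w <= M ->
  normc (z ^+ n - w ^+ n) <= normc (z - w) * (n%:R * M ^+ n).
Proof.
move=> M1 zM wM; rewrite subrXX normcM ler_wpM2l ?normc_ge0//.
apply: le_trans (normc_sum _ _) _.
have -> : n%:R * M ^+ n = \sum_(i < n) M ^+ n by rewrite sumr_const card_ord mulr_natl.
apply: ler_sum => i _; rewrite normcM !normcX.
have M0 : 0 <= M by exact: le_trans M1.
apply: (@le_trans _ _ (M ^+ (n.-1 - i) * M ^+ i)).
  by rewrite ler_pM ?exprn_ge0 ?normc_ge0// lerXn2r ?nnegrE ?normc_ge0.
rewrite -exprD ler_weXn2l// subnK ?leq_pred//.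
by rewrite -ltnS prednK ?ltn_ord// (leq_ltn_trans _ (ltn_ord i)).
Qed.

Lemma divdiff_lip h : exists2 L : R, 0 <= L & forall z w w', normc z <= 1 ->
  normc w <= 2 -> normc w' <= 2 ->
  normc (divdiff h z w - divdiff h z w') <= L * normc (w - w').
Proof.
exists (\sum_(k < size h) normc h`_k * \sum_(i < k) (i%:R * 2 ^+ i)).
  by apply: sumr_ge0 => k _; rewrite mulr_ge0 ?normc_ge0// sumr_ge0// => i _; rewrite mulr_ge0 ?exprn_ge0.
move=> z w w' z1 w2 w2'; rewrite /divdiff -sumrB mulr_suml.
apply: le_trans (normc_sum _ _) _; apply: ler_sum => k _.
rewrite -mulrBr normcM -mulrA ler_wpM2l ?normc_ge0// -sumrB mulr_suml.
apply: le_trans (normc_sum _ _) _; apply: ler_sum => i _.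
rewrite -mulrBr normcM normcX -[leRHS]mul1r ler_pM ?exprn_ge0 ?normc_ge0//.
  by rewrite exprn_ile1 ?normc_ge0.
rewrite mulrC; apply: normc_subX_le => //; lra.
Qed.

(** The conclusion says that [h] takes the value [h w] on the closed disc at [w] only, and simply:
    the diagonal case [z = w] is [h' w != 0]. *)
Lemma poly_univalent_point h :
  ~ (exists (h1 : {poly C}) (l : nat), (1 < l)%N /\ h = h1 \Po 'X^l) ->
  exists2 w, normc w = 1 & forall z, normc z <= 1 -> divdiff h z w != 0.
Proof.
move=> nh; apply: contrapT => N.
have sh : (1 < size h)%N.
  rewrite ltnNge; apply/negP => /size1_polyC hc; apply: nh; exists h, 2; split => //.
  by rewrite hc comp_polyC.
have bad w : normc w = 1 -> exists2 z, normc z <= 1 & divdiff h z w = 0.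
  move=> w1; apply: contrapT => M; apply: N; exists w => // z z1.
  by apply/eqP => d0; apply: M; exists z.
(* Directions spanning pairwise distinct real lines. *)
pose al (n : nat) : C := Complex 1 n%:R.
have al0 n : al n != 0 by rewrite eq_complex /= oner_eq0.
have mx n := cid2 (disk_max (al n) h).
pose w n := s2val (mx n).
have wP n : [/\ normc (w n) = 1, h^`().[w n] != 0 &
    complex.Im (conjc (al n) * (w n * h^`().[w n])) = 0].
  by apply: disk_max_boundary => //; [exact: (s2valP (mx n))|exact: (s2valP' (mx n))].
have zb n : exists z, [/\ normc z = 1, z <> w n & h.[z] = h.[w n]].
  have [w1 h'w _] := wP n.
  have [z z1 dz] := bad _ w1; exists z.
  have hz : h.[z] = h.[w n] by apply/eqP; rewrite -subr_eq0 divdiffE dz mulr0.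
  split => //.
    (* The partner [z] has the same value as [w n], so it is a maximiser too and lies on the
       circle. *)
    have mz : forall x, normc x <= 1 -> reh (al n) h x <= reh (al n) h z.
      by move=> x x1; rewrite {2}/reh hz; exact: (s2valP' (mx n)).
    by have [] := disk_max_boundary (al0 n) sh z1 mz.
  by move=> zw; move: h'w; rewrite -divdiff_diag -{1}zw dz eqxx.
have z n := cid (zb n).
apply: nh; apply: (@torus_coincidence R h w (fun n => sval (z n)) sh); last first.
  by move=> n; have [w1 _ _] := wP n; have [] := svalP (z n).
(* If two directions shared their maximiser, the nonzero number [w * h' w] would lie on two distinct
   real lines through 0. *)
move=> n m E.
have [w1 h'w I1] := wP n; have [_ _ I2] := wP m; rewrite -E in I2.
have X0 : w n * h^`().[w n] != 0 by rewrite mulf_neq0// -normc_gt0 w1.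
move: I1 I2 X0; case: (w n * _) => x y /= I1 I2 X0.
apply/eqP; rewrite -(@eqr_nat R); apply: contraNT X0 => nm.
have x0 : x = 0.
  have : (n%:R - m%:R) * x = 0 by move: I1 I2; rewrite !mul1r !mulNr; lra.
  by move/eqP; rewrite mulf_eq0 subr_eq0 (negbTE nm) => /eqP.
have y0 : y = 0 by move: I1; rewrite x0 mulr0 addr0 mul1r.
by rewrite x0 y0 eq_complex /= eqxx.
Qed.

(** The lower bound at [w0] persists nearby because the divided difference is Lipschitz in [w],
    uniformly in [z]. *)
Lemma poly_univalent_region h :
  ~ (exists (h1 : {poly C}) (l : nat), (1 < l)%N /\ h = h1 \Po 'X^l) ->
  exists w0 (eta d : R), [/\ normc w0 = 1, 0 < eta, 0 < d &
    forall z w, normc z <= 1 -> normc (w - w0) < eta -> d <= normc (divdiff h z w)].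
Proof.
move=> /poly_univalent_point[w0 w01 nz].
have [|d d0 hd] := @poly_lower_bound (divdiff_poly h w0).
  by move=> z z1; rewrite horner_divdiff_poly nz.
have [L L0 hL] := divdiff_lip h.
have L1 : 0 < L + 1 by rewrite ltr_wpDl.
(* The radius is at most 1 to keep [normc w <= 2], the range of the Lipschitz estimate; the other
   bound loses at most half of [d]. *)
exists w0, (Num.min 1 (d / 2 / (L + 1))), (d / 2); split => //.
- by rewrite lt_min ltr01 !divr_gt0.
- by rewrite divr_gt0.
move=> z w z1; rewrite lt_min => /andP[e1 e2].
have w2 : normc w <= 2.
  by rewrite -(subrK w0 w) (le_trans (le_normcD _ _))// w01; lra.
have := hL z w0 w z1 _ w2; rewrite w01 => /(_ _) h1.
have h2 : normc (divdiff h z w0 - divdiff h z w) <= d / 2.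
  apply: le_trans (h1 _) _; first lra.
  rewrite normc_distC; apply: (@le_trans _ _ ((L + 1) * normc (w - w0))).
    by rewrite ler_wpM2r ?normc_ge0// lerDl.
  by rewrite mulrC -ler_pdivlMr// ltW.
have h3 := hd z z1; rewrite horner_divdiff_poly in h3.
have := normc_le_subD (divdiff h z w0) (divdiff h z w); lra.
Qed.

End UnivalentPoint.

(** * Operators commuting with a Toeplitz operator *)

Section HolomorphicFactor.
Context {R : realType}.
Local Notation C := R[i].
Implicit Types (f g : C -> C).

Lemma hol_bounded_near f : hol f ->
  exists2 d : R, 0 < d & forall z, normc z < d -> normc (f z) <= normc (f 0) + 1.
Proof.
move=> hf; have n0 : normc (0 : C) < 1 by rewrite normc0.
have [d d0 hd] := cdv_cont (hf 0 n0) ltr01; exists d => // z hz.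
have := hd z; rewrite subr0 => /(_ hz) h.
by rewrite -(subrK (f 0) (f z)) (le_trans (le_normcD _ _))// addrC lerD2l.
Qed.

Lemma hol_zero_factor f : hol f ->
  (forall K : nat, exists2 g, hol g & forall z, normc z < 1 -> f z = z ^+ K * g z) ->
  forall z, normc z < 1 -> f z = 0.
Proof.
move=> hf H; apply: hol_zero => // K; have [g hg fg] := H K.
have [d d0 hd] := hol_bounded_near hg.
exists (normc (g 0) + 1), (Num.min 1 d); split; first by rewrite lt_min ltr01.
move=> z; rewrite lt_min => /andP[z1 zd]; rewrite fg// normcM normcX mulrC.
by rewrite ler_wpM2r ?exprn_ge0 ?normc_ge0// hd.
Qed.

Lemma hol_factor f : hol f -> (forall z, normc z < 1 -> f z = 0) \/
  exists (s : nat) g, [/\ hol g, g 0 != 0 & forall z, normc z < 1 -> f z = z ^+ s * g z].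
Proof.
move=> hf.
pose P K := exists2 g, hol g & forall z, normc z < 1 -> f z = z ^+ K * g z.
have [all|nall] := pselect (forall K, P K); first by left; exact: hol_zero_factor.
right; apply: contrapT => N; apply: nall; elim => [|K [g hg fg]].
  by exists f => // z _; rewrite expr0 mul1r.
have [g0|g0] := eqVneq (g 0) 0; last by exfalso; apply: N; exists K, g.
have [g1 hg1 gg1] := hol_div hg; exists g1 => // z hz.
by rewrite fg// gg1// g0 add0r exprSr mulrA.
Qed.

(** The quotient is bounded near 0 by continuity, and for [normc z >= d] division by [z] costs at
    most a factor [1 / d]; the two summands of the domination constant correspond to these
    regions. *)
Lemma bergman_div f : f \in @bergman R ->
  exists2 g, g \in @bergman R & forall z, normc z < 1 -> f z = f 0 + z * g z.
Proof.
move=> Bf; have [g hg fg] := hol_div (bergman_hol Bf); exists g => //.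
have [d d0 hd] := hol_bounded_near hg.
set c := f 0 in fg.
apply: (@bergman_lin _ ((normc (g 0) + 1) ^+ 2 + 2 * (1 + sqmod c) / d ^+ 2) f f _ hg Bf Bf).
move=> z hz; have s0 := sqmod_ge0 (f z); have c0 := sqmod_ge0 c.
have d2 : 0 < d ^+ 2 by rewrite exprn_gt0.
have k1 : 0 <= (normc (g 0) + 1) ^+ 2 by rewrite sqr_ge0.
have k2 : 0 <= 2 * (1 + sqmod c) / d ^+ 2 by rewrite divr_ge0 ?(ltW d2)// mulr_ge0// addr_ge0.
have [zd|dz] := ltP (normc z) d.
  have : sqmod (g z) <= (normc (g 0) + 1) ^+ 2.
    by rewrite sqmodE lerXn2r ?nnegrE ?addr_ge0 ?normc_ge0// hd.
  move: (sqmod (g z)) ((normc (g 0) + 1) ^+ 2) (2 * (1 + sqmod c) / d ^+ 2) k1 k2 => x y u.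
  nra.
have z2 : d ^+ 2 <= sqmod z by rewrite sqmodE lerXn2r ?nnegrE ?normc_ge0 ?(ltW d0).
have E : sqmod z * sqmod (g z) = sqmod (f z - c) by rewrite -sqmodM fg// addrC addKr.
have F : sqmod (f z - c) <= 2 * (sqmod (f z) + sqmod c).
  apply: le_trans (sqmodD_le _ _) _; suff -> : sqmod (- c) = sqmod c by [].
  by rewrite !sqmodE normcN.
have G : d ^+ 2 * sqmod (g z) <= 2 * (sqmod (f z) + sqmod c).
  by apply: le_trans F; rewrite -E ler_wpM2r// sqmod_ge0.
rewrite mulrDl; set k1X := (X in _ <= X + _).
have kk : 0 <= k1X by rewrite /k1X mulr_ge0// addr_ge0// addr_ge0.
rewrite -[leLHS]add0r lerD//.
rewrite mulrAC ler_pdivlMr// mulrC; apply: le_trans G _.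
move: (sqmod (f z)) (sqmod c) s0 c0 => x y; nra.
Qed.

Lemma bergman_scale (c : C) f : f \in @bergman R -> (fun z => c * f z) \in @bergman R.
Proof.
move=> Bf; apply: (@bergmanM _ (fun=> c) (normc c)) => //.
by move=> z _; exact: cdv_cst.
Qed.

Lemma normD_scale (c : C) f : f \in @bergman R -> normD (fun z => c * f z) = normc c * normD f.
Proof.
move=> Bf; apply: (@pexpIrn _ 2) => //.
- by rewrite nnegrE normD_ge0.
- by rewrite nnegrE mulr_ge0 ?normc_ge0 ?normD_ge0.
rewrite exprMn !sqr_normD -sqmodE /intD mulrCA; congr (_ * _).
rewrite -RintegralZl; last 2 first.
- exact: diskR2_measurable.
- exact: (bergman_integrable Bf).
by apply: eq_Rintegral => p _; rewrite sqmodM.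
Qed.

End HolomorphicFactor.

(** * Bounded operators up to equality on the disc *)

Section Operator.
Context {R : realType}.
Local Notation C := R[i].
Variable S : (C -> C) -> (C -> C).
Hypothesis bS : bounded_linear_op S.
Implicit Types (f g : C -> C).

Lemma opB f : f \in @bergman R -> S f \in @bergman R.
Proof. by case: bS => h _; exact: h. Qed.

Lemma op_lin (c : C) f g : f \in @bergman R -> g \in @bergman R ->
  eqD (S (fun z => c * f z + g z)) (fun z => c * S f z + S g z).
Proof. by case: bS => _ [h _]; exact: h. Qed.

Lemma normD_zero : normD (fun=> 0 : C) = 0.
Proof.
have E := @normD_scale R 0 _ (bergman_cst 0); rewrite normc0 in E.
rewrite -[RHS](mul0r (normD (fun=> 0 : C))) -E.
by apply: eqD_normD => z _; rewrite mul0r.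
Qed.

(** Boundedness makes [S] compatible with [eqD]: a function vanishing on the disc has norm 0, hence
    so has its image. *)
Lemma op_zero f : f \in @bergman R -> eqD f (fun=> 0) -> eqD (S f) (fun=> 0).
Proof.
move=> Bf f0; apply: bergman_normD0; first exact: opB.
case: bS => _ [_ [M hM]]; apply: le_trans (hM _ Bf) _.
by rewrite (eqD_normD f0) normD_zero mulr0.
Qed.

Lemma op_ext f g : f \in @bergman R -> g \in @bergman R -> eqD f g -> eqD (S f) (S g).
Proof.
move=> Bf Bg fg z hz.
have B : (fun z => (-1) * f z + g z) \in @bergman R by exact: bergman_axpy.
have h : S (fun z => (-1) * f z + g z) z = 0.
  by apply: (op_zero B) => // w hw; rewrite fg// mulN1r addNr.
move: h; rewrite (op_lin (-1) Bf Bg hz) mulN1r addrC => /eqP.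
by rewrite subr_eq0 => /eqP.
Qed.

Lemma op_scale (c : C) f : f \in @bergman R -> eqD (S (fun z => c * f z)) (fun z => c * S f z).
Proof.
move=> Bf z hz; have B0 : (fun=> 0) \in @bergman R := bergman_cst 0.
have Bs := bergman_scale c Bf.
rewrite (op_ext Bs (bergman_axpy c Bf B0)) => [||//]; last by move=> w _; rewrite addr0.
by rewrite op_lin// (op_zero B0)// addr0.
Qed.

Lemma bergman_eqD f g : f \in @bergman R -> eqD g f -> g \in @bergman R.
Proof.
move=> Bf gf; apply: (@bergman_lin _ 1 f f _ _ Bf Bf).
  move=> w hw; apply: (@cdv_eq _ f _ _ (1 - normc w)).
  - by rewrite subr_gt0.
  - move=> u hu; apply/esym/gf; rewrite diskE -(subrK w u).
    by apply: le_lt_trans (le_normcD _ _) _; lra.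
  - exact: (bergman_hol Bf).
move=> w hw; rewrite gf ?diskE// mul1r; have := sqmod_ge0 (f w); lra.
Qed.

(** When the product is already in the Bergman space the projection fixes it, so Toeplitz operators
    with polynomial symbols are multiplications on the disc. *)
Lemma toeplitz_mul (q f : C -> C) : (fun z => q z * f z) \in @bergman R ->
  eqD (toeplitz q f) (fun z => q z * f z).
Proof. by move=> B; exact: bergman_projE. Qed.

Variable m : nat.
Hypothesis m0 : (0 < m)%N.

Lemma bergman_mulX k f : f \in @bergman R -> (fun z => z ^+ k * f z) \in @bergman R.
Proof.
move=> Bf; apply: (@bergmanM _ (fun z => z ^+ k) 1) => //.
  by move=> z _; exact: cdvX.
by move=> z hz; rewrite normcX exprn_ile1 ?normc_ge0// ltW.
Qed.

(** * From commutation with [h(z^m)] to commutation with [z^m] *)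

Section Commutation.
Variable h : {poly C}.
Hypothesis nh : ~ (exists (h1 : {poly C}) (l : nat), (1 < l)%N /\ h = h1 \Po 'X^l).
Hypothesis cS : commute_op S (toeplitz (fun z => h.[z ^+ m])).

Lemma bergman_mulh f : f \in @bergman R -> (fun z => h.[z ^+ m] * f z) \in @bergman R.
Proof.
move=> Bf; apply: (@bergmanM _ (fun z => h.[z ^+ m]) (coefsum h)) => //.
  by move=> z _; apply: (@cdv_comp _ (fun w => h.[w])); [exact: cdvX|exact: cdv_horner].
move=> z hz; have := @normc_horner_le R h (z ^+ m) 1 (lexx _).
by rewrite expr1n mulr1 normcX; apply; rewrite exprn_ile1 ?normc_ge0// ltW.
Qed.

Lemma op_mulh f : f \in @bergman R ->
  eqD (S (fun z => h.[z ^+ m] * f z)) (fun z => h.[z ^+ m] * S f z).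
Proof.
move=> Bf z hz; have B1 := bergman_mulh Bf.
have e1 := toeplitz_mul B1.
have Bt : toeplitz (fun z => h.[z ^+ m]) f \in @bergman R := bergman_eqD B1 e1.
rewrite -(op_ext Bt B1 e1)// cS// (toeplitz_mul _)//.
by apply: bergman_mulh; exact: opB.
Qed.

Lemma op_mulX_at f w (d : R) : f \in @bergman R -> normc w < 1 -> 0 < d ->
  (forall z, normc z <= 1 -> d <= normc (divdiff h z (w ^+ m))) ->
  S (fun z => z ^+ m * f z) w = w ^+ m * S f w.
Proof.
move=> Bf hw d0 low.
pose r z := divdiff h (z ^+ m) (w ^+ m).
have zm (z : C) : normc z < 1 -> normc (z ^+ m) <= 1.
  by move=> hz; rewrite normcX exprn_ile1 ?normc_ge0// ltW.
have r0 z : normc z < 1 -> r z != 0.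
  by move=> hz; rewrite -normc_gt0; apply: lt_le_trans d0 _; apply: low; exact: zm.
have hr z : cdv r z.
  have -> : r = (fun z => (divdiff_poly h (w ^+ m)).[z ^+ m]).
    by apply/funext => x; rewrite horner_divdiff_poly.
  by apply: (@cdv_comp _ (fun u => (divdiff_poly h (w ^+ m)).[u])); [exact: cdvX|exact: cdv_horner].
pose k z := (r z)^-1 * f z.
have Bk : k \in @bergman R.
  apply: (@bergmanM _ (fun z => (r z)^-1) d^-1) => //.
    by move=> z hz; apply: cdvV; [exact: r0|exact: hr].
  move=> z hz; rewrite normcV lef_pV2 ?posrE ?normc_gt0 ?r0//.
  by apply: low; exact: zm.
have Bhk := bergman_mulh Bk; have Bmf := bergman_mulX m Bf.
have Dw : w \in @disk R by rewrite diskE.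
have E : eqD (fun z => - h.[w ^+ m] * k z + h.[z ^+ m] * k z)
             (fun z => - w ^+ m * f z + z ^+ m * f z).
  move=> z; rewrite diskE => hz.
  have -> : - h.[w ^+ m] * k z + h.[z ^+ m] * k z = (h.[z ^+ m] - h.[w ^+ m]) * k z by ring.
  rewrite divdiffE /k -mulrA mulVKf ?r0//; ring.
(* Since [k] depends on [w], the identity is used at that point only, where the two terms in [h]
   cancel after applying [S]. *)
have := op_ext (bergman_axpy _ Bk Bhk) (bergman_axpy _ Bf Bmf) E Dw.
rewrite (op_lin _ Bk Bhk Dw) (op_lin _ Bf Bmf Dw) (op_mulh Bk Dw) => H.
apply/eqP; rewrite -subr_eq0; apply/eqP.
have -> : S (fun z => z ^+ m * f z) w - w ^+ m * S f w =
  - w ^+ m * S f w + S (fun z => z ^+ m * f z) w by ring.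
by rewrite -H; ring.
Qed.

Lemma op_mulX f : f \in @bergman R ->
  eqD (S (fun z => z ^+ m * f z)) (fun z => z ^+ m * S f z).
Proof.
move=> Bf.
have [w0 [eta [d [w01 eta0 d0 H]]]] := poly_univalent_region nh.
(* The univalent region concerns [w ^+ m], so it is pulled back to a neighbourhood of an [m]-th root
   of [w0] on the circle. *)
pose ze : C := m.-root w0.
have zem : ze ^+ m = w0 by exact: rootCK.
have ze1 : normc ze = 1.
  apply: (@pexpIrn _ m) => //; first by rewrite nnegrE normc_ge0.
    by rewrite nnegrE.
  by rewrite expr1n -normcX zem.
have [|del del0 hdel] := cdv_cont (@cdvX R m ze) (e := eta / 2); first by rewrite divr_gt0.
pose dl := Num.min (1 / 2) (del / 2).
have dl0 : 0 < dl by rewrite lt_min !divr_gt0.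
have dl1 : dl <= 1 / 2 by rewrite ge_min lexx.
have dl2 : dl <= del / 2 by rewrite ge_min lexx orbT.
(* The disc of radius [dl] about [a] is internally tangent to the unit circle at [ze], and all its
   points are within [2 * dl <= del] of [ze]. *)
pose a := (1 - dl)%:C%C * ze.
have na : normc a = 1 - dl by rewrite normcM ze1 mulr1 normcR ger0_norm//; lra.
have hF : hol (fun z => S (fun z => z ^+ m * f z) z - z ^+ m * S f z).
  move=> z hz; apply: cdvB; first exact: (bergman_hol (opB (bergman_mulX m Bf))).
  by apply: cdvM; [exact: cdvX|exact: (bergman_hol (opB Bf))].
have van z : normc (z - a) < dl -> S (fun z => z ^+ m * f z) z - z ^+ m * S f z = 0.
  move=> hz; have z1 : normc z < 1.
    by rewrite -(subrK a z); apply: le_lt_trans (le_normcD _ _) _; rewrite na; lra.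
  have zz : normc (z - ze) < del.
    have -> : z - ze = (z - a) + (a - ze) by ring.
    have -> : a - ze = - (dl%:C%C * ze) by rewrite /a rmorphB rmorph1; ring.
    apply: le_lt_trans (le_normcD _ _) _; rewrite normcN normcM ze1 mulr1 normcR gtr0_norm//; lra.
  apply/eqP; rewrite subr_eq0; apply/eqP; apply: (op_mulX_at Bf z1 d0) => u u1.
  by apply: H => //; have := hdel _ zz; rewrite zem; lra.
move=> z; rewrite diskE => hz; apply/eqP; rewrite -subr_eq0; apply/eqP.
by apply: (hol_identity hF _ dl0 van) => //; rewrite na; lra.
Qed.

Lemma op_commute : commute_op S (toeplitz (fun z => z ^+ m)).
Proof.
move=> f Bf z hz; have B1 := bergman_mulX m Bf; have e1 := toeplitz_mul B1.
have Bt : toeplitz (fun z => z ^+ m) f \in @bergman R := bergman_eqD B1 e1.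
rewrite (op_ext Bt B1 e1)// op_mulX//; apply/esym.
by rewrite (toeplitz_mul _)//; apply: bergman_mulX; exact: opB.
Qed.

Lemma op_mulXn n f : f \in @bergman R ->
  eqD (S (fun z => z ^+ (m * n) * f z)) (fun z => z ^+ (m * n) * S f z).
Proof.
move=> Bf; elim: n => [|n IH] z hz.
  rewrite muln0 expr0 mul1r; apply: op_ext => //; first exact: bergman_mulX.
  by move=> w _; rewrite expr0 mul1r.
have B1 := bergman_mulX (m * n) Bf.
rewrite (op_ext (g := fun z => z ^+ m * (z ^+ (m * n) * f z))) => [||||//]; last first.
- by move=> w _; rewrite mulnS exprD mulrA.
- exact: bergman_mulX.
- exact: bergman_mulX.
by rewrite op_mulX// IH// mulnS exprD mulrA.
Qed.

(** * Compact operators in the commutant *)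

Section Compactness.
Hypothesis cpt : compact_op S.

Lemma compact_monomial j : eqD (S (fun z => z ^+ j)) (fun=> 0).
Proof.
have Bj := @bergman_expr R j; have Bg := opB Bj.
set g := S (fun z => z ^+ j) in Bg *.
have [z0|[s [G [hG G0 gG]]]] := hol_factor (bergman_hol Bg).
  by move=> z; rewrite diskE => /z0.
exfalso.
have [kap kap0 hkap] := @moment_ratio R.
pose nn n := normD (fun z : C => z ^+ (m * n + j)).
have nn2 n : nn n ^+ 2 = moment (m * n + j) by rewrite moment_sq.
have nn0 n : 0 < nn n.
  by rewrite lt_def normD_ge0 andbT; apply/eqP => n0; have := @moment_gt0 R (m * n + j);
    rewrite -nn2 n0 expr0n ltxx.
pose u n (z : C) : C := ((nn n)^-1)%:C%C * z ^+ (m * n + j).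
have Bu n : u n \in @bergman R by apply: bergman_scale; exact: bergman_expr.
have Nu n : normD (u n) <= 1.
  rewrite (normD_scale _ (bergman_expr _)) normcR gtr0_norm ?invr_gt0//.
  by rewrite mulVf// gt_eqF// nn0.
have Su n : eqD (S (u n)) (fun z => ((nn n)^-1)%:C%C * (z ^+ (m * n) * g z)).
  move=> z hz; rewrite (op_scale _ (bergman_expr _))//; congr (_ * _).
  rewrite -(op_mulXn n Bj hz); apply: op_ext => //; first exact: bergman_expr.
    exact: bergman_mulX.
  by move=> w _; rewrite exprD.
have [phi [phiS cauchy]] := @cpt u Bu Nu.
(* Lower bound for the squared distance of two images: [moment (m p + s)] is at least
   [moment (m p + j + s)], which is at least [kap ^+ s] times the squared norm [moment (m p + j)]
   used to normalise. *)
pose L := sqmod (G 0) * kap ^+ s.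
have L0 : 0 < L by rewrite mulr_gt0 ?exprn_gt0// sqmodE exprn_gt0// normc_gt0.
have [|N hN] := cauchy (Num.sqrt L); first by rewrite sqrtr_gt0.
have := hN N N.+1 (leqnn _) (leqnSn _).
set p := phi N; set q := phi N.+1; have pq : (p < q)%N := phiS N.
pose F (z : C) : C := (-1) * S (u q) z + S (u p) z.
have BF : F \in @bergman R by exact: bergman_axpy (opB (Bu q)) (opB (Bu p)).
have -> : normD (S (u p) \- S (u q)) = normD F.
  by apply: eqD_normD => z _; rewrite /F mulN1r addrC.
(* What remains of the difference after extracting [z ^+ (m * p + s)]; as [p < q] and [m > 0], the
   second term vanishes at 0. *)
pose H (z : C) : C := ((nn p)^-1)%:C%C * G z - ((nn q)^-1)%:C%C * (z ^+ (m * (q - p)) * G z).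
have hH : hol H.
  move=> z hz; apply: cdvB; first by apply: cdvM; [exact: cdv_cst|exact: (hG _ hz)].
  by apply: cdvM; [exact: cdv_cst|apply: cdvM; [exact: cdvX|exact: (hG _ hz)]].
have H0 : H 0 = ((nn p)^-1)%:C%C * G 0.
  have mpq : (0 < m * (q - p))%N by rewrite muln_gt0 m0 subn_gt0.
  by rewrite /H expr0n eqn0Ngt mpq mul0r mulr0 subr0.
have FH z : normc z < 1 -> F z = z ^+ (m * p + s) * H z.
  move=> hz; have Dz : z \in @disk R by rewrite diskE.
  rewrite /F !Su// gG// /H.
  have -> : (m * q)%N = (m * p + m * (q - p))%N by rewrite -mulnDr subnKC// ltnW.
  rewrite !exprD; ring.
have low := moment_le_norm BF hH FH.
rewrite -sqr_normD H0 sqmodM in low.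
have kapn n : kap ^+ n * moment (m * p + j) <= moment (m * p + j + n).
  elim: n => [|n IH]; first by rewrite expr0 mul1r addn0.
  rewrite addnS exprS -mulrA; apply: le_trans (hkap _).
  by rewrite ler_pM2l.
have mono i n : @moment R (i + n) <= moment i.
  elim: n => [|n IH]; first by rewrite addn0.
  by rewrite addnS; apply: le_trans (moment_le _) IH.
have km : kap ^+ s * moment (m * p + j) <= moment (m * p + s).
  by apply: le_trans (kapn s) _; rewrite -addnA (addnC j) addnA; exact: mono.
have sq : sqmod (((nn p)^-1)%:C%C : C) = (moment (m * p + j))^-1.
  by rewrite sqmodE normcR gtr0_norm ?invr_gt0// exprVn nn2.
move=> lt; have : normD F ^+ 2 < L.
  rewrite -(@sqr_sqrtr _ L) ?(ltW L0)// ltrXn2r// ?nnegrE ?normD_ge0 ?sqrtr_ge0//.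
apply/negP; rewrite -leNgt; apply: le_trans low.
rewrite sq /L -mulrA mulrCA.
rewrite ler_wpM2l ?sqmod_ge0// ler_pdivlMl; last exact: moment_gt0.
by rewrite mulrC.
Qed.

(** Taylor terms are removed one at a time: each is a multiple of a monomial, which [S] annihilates,
    and the quotient stays in the Bergman space. *)
Lemma compact_tail K f : f \in @bergman R ->
  exists2 g, g \in @bergman R & eqD (S f) (S (fun z => z ^+ K * g z)).
Proof.
move=> Bf; elim: K => [|K [g Bg E]].
  exists f => //; apply: op_ext => //; first exact: bergman_mulX.
  by move=> z _; rewrite expr0 mul1r.
have [g1 Bg1 gg1] := bergman_div Bg; exists g1 => // z hz; rewrite E//.
have B1 := @bergman_expr R K; have B2 := bergman_mulX K.+1 Bg1.
rewrite (op_ext (bergman_mulX K Bg) (bergman_axpy (g 0) B1 B2)) => [||//]; last first.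
  by move=> w; rewrite diskE => hw; rewrite gg1// mulrDr mulrC exprSr mulrA.
by rewrite op_lin// compact_monomial// mulr0 add0r.
Qed.

Lemma compact_zero f : f \in @bergman R -> eqD (S f) (fun=> 0).
Proof.
move=> Bf z; rewrite diskE; apply: hol_zero_factor; first exact: (bergman_hol (opB Bf)).
move=> K; have [g Bg E] := compact_tail (m * K) Bf.
(* The factor [z ^+ (m * K)] provides order at least [K] because [m >= 1]. *)
exists (fun z => z ^+ (m * K - K) * S g z).
  by move=> w hw; apply: cdvM; [exact: cdvX|exact: (bergman_hol (opB Bg))].
move=> w hw; rewrite mulrA -exprD subnKC ?leq_pmull//.
by rewrite E ?diskE// op_mulXn// diskE.
Qed.

End Compactness.
End Commutation.
End Operator.

Unset Implicit Arguments.

Theorem theorem0p1 (R : realType) (m : nat) (h : {poly R[i]})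
  (S : (R[i] -> R[i]) -> (R[i] -> R[i])) :
  (0 < m)%N ->
  ~ (exists (h1 : {poly R[i]}) (l : nat), (1 < l)%N /\ h = h1 \Po 'X^l) ->
  bounded_linear_op S ->
  commute_op S (toeplitz (fun z => h.[z ^+ m])) ->
  commute_op S (toeplitz (fun z => z ^+ m)) /\
  (compact_op S -> forall f, f \in @bergman R -> eqD (S f) (fun _ => 0)).
Proof.
move=> m0 nh bS cS; split; first exact: (op_commute bS m0 nh cS).
by move=> cpt f Bf; exact: (compact_zero bS m0 nh cS cpt Bf).
Qed.
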